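(* Let $\lambda>0$, let $\alpha=\{\alpha_1,\alpha_2,\dots\}$ be a sequence of non-zero real numbers, let $q\in\mathbb N$ be even, and let $\{f_n^{(i)}:n,i\in\mathbb N\}$ be a bi-indexed sequence of symmetric functions in $L^2(\mathbb R_+^q)$. Let $I(f)$ denote the free stochastic integral of $f\in L^2(\mathbb R_+^q)$ with respect to a free Brownian motion in $(\mathcal A,\varphi)$. Then the following two statements are equivalent. (1) The sequence $\{I(f_n^{(i)}):i=1,2,\dots\}$ converges in distribution, as $n\to\infty$, to a sequence $\{a_i:i=1,2,\dots\}$ with distribution $Z(\lambda,\alpha)$. (2) For all $i,j\in\mathbb N$, $$\lim_{n\to\infty}\langle f_n^{(i)},f_n^{(j)}\rangle=\alpha_i\alpha_j\lambda,$$ $$\lim_{n\to\infty}\varphi\big(I(f_n^{(i)})^2I(f_n^{(j)})^2\big)=(2\lambda^2+\lambda)\alpha_i^2\alpha_j^2,\qquad \lim_{n\to\infty}\varphi\big(I(f_n^{(i)})I(f_n^{(j)})^2\big)=\lambda\alpha_i\alpha_j^2.$$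
   Context: $(\mathcal A,\varphi)$ is a tracial $W^*$-probability space (a finite von Neumann algebra with a faithful normal tracial state) and $\kappa_n$ is the $n$-th free cumulant. A sequence $\{a_i\}_{i\ge1}$ of random variables in a non-commutative probability space $(\mathcal B,\psi)$ has the centered infinite dimensional free Poisson distribution $Z(\lambda,\alpha)$ if $\kappa_1(a_i)=0$ for all $i$ and $\kappa_n(a_{\chi(1)},\dots,a_{\chi(n)})=\lambda\alpha_{\chi(1)}\cdots\alpha_{\chi(n)}$ for all $n\ge2$ and $\chi:\{1,\dots,n\}\to\mathbb N$. Convergence in distribution means that for all $m\ge1$ and $\chi:\{1,\dots,m\}\to\mathbb N$, $\varphi(I(f_n^{(\chi(1))})\cdots I(f_n^{(\chi(m))}))\to\psi(a_{\chi(1)}\cdots a_{\chi(m)})$ as $n\to\infty$. $L^2(\mathbb R_+^q)$ is the space of complex-valued Lebesgue square-integrable functions on $\mathbb R_+^q$ with the usual inner product $\langle\cdot,\cdot\rangle$; $L^2(\mathbb R_+^0)=\mathbb C$. Put $f^*(t_1,\dots,t_q)=\overline{f(t_q,\dots,t_1)}$; $f$ is symmetric if $f=f^*$. A free Brownian motion $S=\{S_t:t\ge0\}$ consists of a filtration $\{\mathcal A_t\}_{t\ge0}$ of von Neumann subalgebras of $\mathcal A$ and self-adjoint $S_t\in\mathcal A_t$ with $S_0=0$, such that $S_t$ has the centered semicircular law $S(0,t)$ of variance $t$, and for $0<s<t$ the increment $S_t-S_s$ is free from $\mathcal A_s$ and has law $S(0,t-s)$. The multiple integral $I(f)$, $f\in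 L^2(\mathbb R_+^n)$, is defined by $I(\mathbf 1_{(a_1,b_1)}\otimes\cdots\otimes\mathbf 1_{(a_n,b_n)})=(S_{b_1}-S_{a_1})\cdots(S_{b_n}-S_{a_n})$ for pairwise disjoint intervals, extended by linearity to simple functions vanishing on diagonals and then to $L^2(\mathbb R_+^n)$ by the isometry $\langle I(f),I(g)\rangle_{L^2(\mathcal A,\varphi)}=\langle f,g\rangle$; $I(c)=c$ for $c\in\mathbb C$. These integrals span a unital $*$-algebra with $I(f)^*=I(f^* )$ and $I(f)I(g)=\sum_{k=0}^{\min\{m,n\}}I(f\stackrel{k}{\frown}g)$ for $f\in L^2(\mathbb R_+^m)$, $g\in L^2(\mathbb R_+^n)$, where $$f\stackrel{p}{\frown}g(t_1,\dots,t_{m+n-2p})=\int_{\mathbb R_+^p}f(t_1,\dots,t_{m-p},s_p,\dots,s_1)\,g(s_1,\dots,s_p,t_{m-p+1},\dots,t_{m+n-2p})\,ds_1\cdots ds_p,$$ and $f\stackrel{0}{\frown}g=f\otimes g$. *)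

(* Defs.v *)
From HB Require Import structures.
From mathcomp Require Import all_boot all_order all_algebra.
From mathcomp Require Import sesquilinear complex.
From mathcomp Require Import all_classical all_reals all_analysis.
Import Order.TTheory GRing.Theory Num.Theory numFieldNormedType.Exports.

Set Implicit Arguments.
Unset Strict Implicit.
Unset Printing Implicit Defensive.

Local Open Scope classical_set_scope.
Local Open Scope ring_scope.
Local Open Scope complex_scope.

Record ncProbSpace (R : realType) := NcProbSpace {
  nc_carrier :> algType R[i];
  nc_state : {scalar nc_carrier};
  nc_state1 : nc_state 1 = 1 }.

Definition noncrossing n (P : {set {set 'I_n}}) : bool :=
  finset.partition P [set: 'I_n]%SET &&
  [forall V in P, forall W in P, (V != W) ==>
    ~~ [exists i in V, exists j in W, exists k in V, exists l in W,
          [&& (i < j)%N, (j < k)%N & (k < l)%N]]].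

Lemma noncrossing_block_gt0 n (P : {set {set 'I_n}}) V :
  noncrossing P -> V \in P -> (0 < #|V|)%N.
Proof.
move=> /andP[/and3P[_ _ P0] _] VP; rewrite card_gt0.
by apply: contra P0 => /eqP <-.
Qed.

Lemma noncrossing_block_lt n (P : {set {set 'I_n}}) V : noncrossing P ->
  P != [set [set: 'I_n]]%SET -> V \in P -> (#|V| < n)%N.
Proof.
move=> ncP PT VP; rewrite -[ltnRHS]card_ord -cardsT; apply: proper_card.
rewrite finset.properT; apply: contra PT => /eqP VT.
rewrite finset.eqEsubset finset.sub1set -VT VP andbT.
apply/fintype.subsetP => W WP; rewrite finset.in_set1; apply/contraT => WV.
have := noncrossing_block_gt0 ncP WP.
case/andP: ncP => /and3P[_ /finset.trivIsetP /(_ _ _ WP VP WV) + _] _.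
by rewrite VT -finset.setI_eq0 finset.setIT => /eqP ->; rewrite cards0.
Qed.

Lemma noncrossing_one_block n : (0 < n)%N ->
  noncrossing [set [set: 'I_n]]%SET.
Proof.
move=> n0; apply/andP; split.
  apply/and3P; split; first by rewrite /finset.cover big_set1.
    by apply/finset.trivIsetP => U V /finset.set1P-> /finset.set1P->; rewrite eqxx.
  rewrite inE eq_sym -card_gt0 cardsT card_ord //.
apply/forall_inP => U /finset.set1P->; apply/forall_inP => V /finset.set1P->.
by rewrite eqxx.
Qed.

Section FreeCumulants.
Context {R : realType} {B : ncProbSpace R}.

(* (b_1, ..., b_n) |-> (b_i)_{i in V}, in increasing order of i *)
Definition restrict_word (s : seq B) (V : {set 'I_(size s)}) : seq B :=
  [seq tnth (in_tuple s) i | i <- enum V].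

(* The moment-cumulant formula
     psi(b_1 ... b_n) = sum_{P in NC(n)} prod_{V in P} kappa(b_i, i in V),
   solved for the term of the one-block partition. All other blocks are
   shorter than n, so the size of the word is enough fuel: see
   [moment_cumulant]. *)
Fixpoint free_cumulant_rec (fuel : nat) (s : seq B) : R[i] :=
  if fuel is k.+1 then
    nc_state B (\prod_(b <- s) b) -
    \sum_(P : {set {set 'I_(size s)}} |
           noncrossing P && (P != [set [set: 'I_(size s)]]%SET))
       \prod_(V in P) free_cumulant_rec k (restrict_word V)
  else 0.

Definition free_cumulant (s : seq B) : R[i] := free_cumulant_rec (size s) s.

Lemma size_restrict_word (s : seq B) (V : {set 'I_(size s)}) :
  size (restrict_word V) = #|V|.
Proof. by rewrite size_map -cardE. Qed.

Lemma free_cumulant_rec_fuel k (s : seq B) : (size s <= k)%N -> s != [::] ->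
  free_cumulant_rec k s = free_cumulant s.
Proof.
rewrite /free_cumulant.
have [m sm] := ubnP (size s); elim: m s sm k => // m IH s sm k sk s0.
case: k sk => [|k]; first by rewrite leqn0 size_eq0 (negPf s0).
move=> sk; rewrite -[in RHS](prednK (_ : 0 < size s)%N) ?lt0n ?size_eq0//=.
congr (_ - _); apply: eq_bigr => P /andP[ncP PT]; apply: eq_bigr => V VP.
have Vs := noncrossing_block_lt ncP PT VP.
have r0 : restrict_word V != [::].
  by rewrite -size_eq0 size_restrict_word -lt0n (noncrossing_block_gt0 ncP).
have rm : (size (restrict_word V) < m)%N.
  by rewrite size_restrict_word (leq_trans Vs).
have Vk : (size (restrict_word V) <= k)%N.
  by rewrite size_restrict_word -ltnS (leq_trans Vs).
have Vp : (size (restrict_word V) <= (size s).-1)%N.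
  by rewrite size_restrict_word -ltnS prednK// lt0n size_eq0.
exact: etrans (IH _ rm k Vk r0) (esym (IH _ rm _ Vp r0)).
Qed.

Lemma moment_cumulant (s : seq B) : s != [::] ->
  nc_state B (\prod_(b <- s) b) =
  \sum_(P : {set {set 'I_(size s)}} | noncrossing P)
     \prod_(V in P) free_cumulant (restrict_word V).
Proof.
move=> s0; have n0 : (0 < size s)%N by rewrite lt0n size_eq0.
rewrite (bigD1 [set [set: 'I_(size s)]]%SET) ?noncrossing_one_block//=.
have rT : restrict_word [set: 'I_(size s)]%SET = s.
  by rewrite /restrict_word enum_setT -enumT map_tnth_enum.
rewrite big_set1 rT.
have sE : free_cumulant s = nc_state B (\prod_(b <- s) b) -
    \sum_(P : {set {set 'I_(size s)}} |
           noncrossing P && (P != [set [set: 'I_(size s)]]%SET))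
       \prod_(V in P) free_cumulant_rec (size s).-1 (restrict_word V).
  by rewrite /free_cumulant -[X in free_cumulant_rec X s](prednK n0).
rewrite sE -addrA [- _ + _]addrC -[LHS]addr0; congr (_ + _).
apply/esym/eqP; rewrite subr_eq0; apply/eqP.
apply: eq_bigr => P /andP[ncP PT]; apply: eq_bigr => V VP.
apply/esym/free_cumulant_rec_fuel; rewrite -?size_eq0 size_restrict_word.
  by rewrite -ltnS prednK//; exact: noncrossing_block_lt ncP PT VP.
by rewrite -lt0n (noncrossing_block_gt0 ncP).
Qed.

End FreeCumulants.

(* The sequences of the theory are indexed from 0; only distinctness of the
   indices matters. *)
Definition centered_free_poisson_seq (R : realType) (lambda : R)
    (alpha : nat -> R) (B : ncProbSpace R) (a : nat -> B) : Prop :=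
  (forall i, free_cumulant [:: a i] = 0) /\
  (forall chi : seq nat, (2 <= size chi)%N ->
     free_cumulant [seq a i | i <- chi] =
     lambda%:C * \prod_(i <- chi) (alpha i)%:C).

Definition cvgC (R : realType) (u : nat -> R[i]) (l : R[i]) : Prop :=
  u @ \oo --> (l : R[i]^o).

Definition converges_in_distribution (R : realType) (A B : ncProbSpace R)
    (X : nat -> nat -> A) (a : nat -> B) : Prop :=
  forall chi : seq nat, chi != [::] ->
    cvgC (fun n => nc_state A (\prod_(i <- chi) X n i))
         (nc_state B (\prod_(i <- chi) a i)).

Definition freely_independent (R : realType) (B : ncProbSpace R)
    (N1 N2 : set B) : Prop :=
  forall w : seq (bool * B), w != [::] ->
    sorted (fun u v => u.1 != v.1) w ->
    {in w, forall u, (if u.1 then N1 else N2) u.2 /\ nc_state B u.2 = 0} ->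
    nc_state B (\prod_(u <- w) u.2) = 0.

Definition unital_subalgebra_of (R : realType) (B : ncProbSpace R) (b : B) :
  set B := range (horner_alg b).

Definition semicircle_density (R : realType) (t x : R) : R :=
  (2 * pi * t)^-1 * Num.sqrt (4 * t - x ^+ 2).

(* [b] has law S(0, t): the compactly supported law of a self-adjoint element
   is determined by its moments. *)
Definition semicircular (R : realType) (B : ncProbSpace R) (t : R) (b : B) :
    Prop :=
  forall m : nat, nc_state B (b ^+ m) =
    (\int[lebesgue_measure]_(x in `[- (2 * Num.sqrt t), 2 * Num.sqrt t])
       (x ^+ m * semicircle_density t x))%:C.

Record hilbertSpace (R : realType) := HilbertSpace {
  hs_carrier :> completeNormedModType R[i];
  hs_dot : {dot hs_carrier for Num.conj};
  hs_dotE : forall x : hs_carrier, `|x| ^+ 2 = hs_dot x x }.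

Section Operators.
Context {R : realType} {H : hilbertSpace R}.

Definition bounded_operator (T : H -> H) : Prop := linear T /\ continuous T.

Definition commutant (X : set (H -> H)) : set (H -> H) :=
  [set T | bounded_operator T /\ forall U, X U -> forall x, T (U x) = U (T x)].

Definition positive_operator (T : H -> H) : Prop :=
  forall x, 0 <= hs_dot H (T x) x.

End Operators.

(* A von Neumann algebra is a unital *-algebra of bounded operators on a
   Hilbert space that equals its bicommutant. [ws_act] identifies the elements
   of the algebra with operators; that these are bounded and linear is part of
   [ws_bicommutant]. *)
Record tracialWstarProbSpace (R : realType) := TracialWstarProbSpace {
  ws_nc :> ncProbSpace R;
  ws_hilb : hilbertSpace R;
  ws_act : ws_nc -> ws_hilb -> ws_hilb;
  ws_adj : ws_nc -> ws_nc;
  ws_act_inj : injective ws_act;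
  ws_act_lin : forall k a b x,
    ws_act (k *: a + b) x = k *: ws_act a x + ws_act b x;
  ws_act1 : forall x, ws_act 1 x = x;
  ws_actM : forall a b x, ws_act (a * b) x = ws_act a (ws_act b x);
  ws_adjP : forall a x y,
    hs_dot ws_hilb (ws_act a x) y = hs_dot ws_hilb x (ws_act (ws_adj a) y);
  ws_bicommutant : commutant (commutant (range ws_act)) = range ws_act;
  ws_finite : forall v, ws_adj v * v = 1 -> v * ws_adj v = 1;
  ws_state_ge0 : forall a, 0 <= nc_state ws_nc (ws_adj a * a);
  ws_state_faithful : forall a, nc_state ws_nc (ws_adj a * a) = 0 -> a = 0;
  ws_stateC : forall a b, nc_state ws_nc (a * b) = nc_state ws_nc (b * a);
  ws_state_normal : let le a b := positive_operator (ws_act (b - a)) in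
    forall (D : set ws_nc) (x : ws_nc), D !=set0 ->
    (forall a, D a -> ws_adj a = a) ->
    (forall a b, D a -> D b -> exists c, [/\ D c, le a c & le b c]) ->
    (forall a, D a -> le a x) ->
    (forall y, (forall a, D a -> le a y) -> le x y) ->
    forall c : R[i], (forall a, D a -> nc_state ws_nc a <= c) ->
      nc_state ws_nc x <= c }.

Section FreeBrownianMotion.
Context {R : realType} {A : tracialWstarProbSpace R}.

Definition vonNeumann_subalgebra (N : set A) : Prop :=
  (forall a, N a -> N (ws_adj a)) /\
  commutant (commutant (ws_act (t := A) @` N)) = ws_act (t := A) @` N.

Record free_brownian_motion (F : R -> set A) (S : R -> A) : Prop := {
  fbm_vN : forall t, 0 <= t -> vonNeumann_subalgebra (F t);
  fbm_filtration : forall s t, 0 <= s -> s <= t -> F s `<=` F t;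
  fbm_adapted : forall t, 0 <= t -> F t (S t);
  fbm_selfadjoint : forall t, 0 <= t -> ws_adj (S t) = S t;
  fbm0 : S 0 = 0;
  fbm_law : forall t, 0 < t -> semicircular t (S t);
  fbm_increment_free : forall s t, 0 < s -> s < t ->
    freely_independent (unital_subalgebra_of (S t - S s)) (F s);
  fbm_increment_law : forall s t, 0 < s -> s < t ->
    semicircular (t - s) (S t - S s) }.

End FreeBrownianMotion.

Lemma product_sigma_finite d1 d2 (T1 : measurableType d1)
    (T2 : measurableType d2) (R : realType)
    (m1 : {sigma_finite_measure set T1 -> \bar R})
    (m2 : {sigma_finite_measure set T2 -> \bar R}) :
  sigma_finite setT (m1 \x m2)%E.
Proof.
have /sigma_finiteP[F [TF ndF Foo]] := sigma_finiteT m1.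
have /sigma_finiteP[G [TG ndG Goo]] := sigma_finiteT m2.
exists (fun n => F n `*` G n).
  rewrite -setXTT TF TG predeqE => -[x y]; split.
    move=> [/= [n _ Fnx] [k _ Gky]]; exists (maxn n k) => //; split.
    - by move: x Fnx; exact/subsetPset/ndF/leq_maxl.
    - by move: y Gky; exact/subsetPset/ndG/leq_maxr.
  by move=> [n _ []/= ? ?]; split; exists n.
move=> k; have [? ?] := Foo k; have [? ?] := Goo k.
split; first exact: measurableX.
by rewrite product_measure1E// lte_mul_pinfty// ge0_fin_numE.
Qed.

(* R^q is [q.-tuple (measurableTypeR R)]: [measurableTypeR R] is R with the
   Borel structure that carries [lebesgue_measure]. *)
Section LebesgueTuple.
Context {R : realType}.

Definition cons_pair n (x : measurableTypeR R * n.-tuple (measurableTypeR R)) : n.+1.-tuple (measurableTypeR R) :=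
  [tuple of x.1 :: x.2].

Definition uncons n (t : n.+1.-tuple (measurableTypeR R)) : measurableTypeR R * n.-tuple (measurableTypeR R) :=
  (thead t, [tuple of behead t]).

Lemma cons_pairK n : cancel (@cons_pair n) (@uncons n).
Proof. by case=> x t; congr pair; apply: val_inj. Qed.

Lemma measurable_cons_pair n :
  measurable_fun [set: measurableTypeR R * n.-tuple (measurableTypeR R)] (@cons_pair n).
Proof. by apply: measurable_cons. Qed.

Lemma measurable_uncons n : measurable_fun [set: n.+1.-tuple (measurableTypeR R)] (@uncons n).
Proof.
apply/measurable_fun_pair; last exact: measurable_behead.
exact: measurable_tnth.
Qed.

Section TupleStep.
Context n (leb : {sigma_finite_measure set (measurableTypeR R) -> \bar R})
  (mu : {sigma_finite_measure set (n.-tuple (measurableTypeR R)) -> \bar R}).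

Definition tuple_step : set (n.+1.-tuple (measurableTypeR R)) -> \bar R :=
  pushforward (leb \x mu)%E (@cons_pair n).

Let tuple_step0 : tuple_step set0 = 0%E.
Proof. by rewrite /tuple_step /pushforward preimage_set0 measure0. Qed.

Let tuple_step_ge0 E : (0 <= tuple_step E)%E.
Proof. by rewrite /tuple_step /pushforward; exact: (measure_ge0 (leb \x mu)%E). Qed.

Let tuple_step_sigma_additive : semi_sigma_additive tuple_step.
Proof.
have m := @measurable_cons_pair n.
move=> E mE tE mUE; rewrite /tuple_step /pushforward preimage_bigcup.
apply: measure_semi_sigma_additive.
- by move=> k; rewrite -[X in measurable X]setTI; exact: m.
- apply/classical_sets.trivIsetP => i j _ _ ij; rewrite -preimage_setI.
  by move/classical_sets.trivIsetP : tE => /(_ _ _ Logic.I Logic.I ij) ->; rewrite preimage_set0.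
- by rewrite -preimage_bigcup -[X in measurable X]setTI; exact: m.
Qed.

HB.instance Definition _ := isMeasure.Build _ _ _ tuple_step
  tuple_step0 tuple_step_ge0 tuple_step_sigma_additive.

Let tuple_step_sigma_finite : sigma_finite setT tuple_step.
Proof.
have [F TF Foo] : sigma_finite setT (leb \x mu)%E.
  exact: product_sigma_finite.
exists (fun k => @uncons n @^-1` F k).
  by rewrite -preimage_bigcup -TF preimage_setT.
move=> k; have [mF Fk] := Foo k; split.
  by rewrite -[X in measurable X]setTI; exact: measurable_uncons.
rewrite /tuple_step /pushforward -comp_preimage.
by rewrite (_ : _ \o _ = id) ?preimage_id//; apply/funext => x;
  exact: cons_pairK.
Qed.

HB.instance Definition _ := Measure_isSigmaFinite.Build _ _ _ tuple_step
  tuple_step_sigma_finite.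

End TupleStep.

Fixpoint lebesgue_tuple (q : nat) :
    {sigma_finite_measure set (q.-tuple (measurableTypeR R)) -> \bar R} :=
  if q is n.+1 then
    tuple_step lebesgue_measure (lebesgue_tuple n)
      : {sigma_finite_measure set _ -> \bar R}
  else \d_[tuple].

Lemma lebesgue_tuple_box q (E : 'I_q -> set (measurableTypeR R)) :
  (forall i, measurable (E i)) ->
  lebesgue_tuple q [set t | forall i, E i (tnth t i)] =
  (\prod_(i < q) lebesgue_measure (E i))%E.
Proof.
elim: q E => [|q IH] E mE.
  rewrite big_ord0 /= diracE.
  by rewrite mem_set// => -[].
rewrite big_ord_recl -IH //= /tuple_step /pushforward.
have mB : measurable [set t : q.-tuple (measurableTypeR R) |
    forall i, E (lift ord0 i) (tnth t i)].
  rewrite (_ : mkset _ = \bigcap_(i in [set: 'I_q])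
      ((fun t => tnth t i) @^-1` E (lift ord0 i))).
    apply: fin_bigcap_measurable => // i _.
    by rewrite -[X in measurable X]setTI; exact: measurable_tnth.
  by apply/seteqP; split=> [t h i _|t h i]; [exact: h|exact: (h i)].
rewrite -product_measure1E//; congr (product_measure1 _ _ _).
apply/seteqP; split=> [[x t] h|[x t] [h0 h]] /=.
  split=> [|i]; first by have := h ord0; rewrite tnth0.
  by have := h (lift ord0 i); rewrite tnthS.
by move=> i; case: (unliftP ord0 i) => [k ->|->];
  rewrite ?tnthS ?tnth0//; exact: h.
Qed.

Definition orthant (q : nat) : set (q.-tuple (measurableTypeR R)) :=
  [set t | forall i, 0 <= (tnth t i : R)].
Arguments orthant : clear implicits.

Definition sqmod (z : R[i]) : R := complex.Re z ^+ 2 + complex.Im z ^+ 2.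

Definition L2norm2 q (f : q.-tuple (measurableTypeR R) -> R[i]) : \bar R :=
  (\int[lebesgue_tuple q]_(t in orthant q) (sqmod (f t))%:E)%E.

Definition square_integrable q (f : q.-tuple (measurableTypeR R) -> R[i]) :
    Prop :=
  [/\ measurable_fun (orthant q) (fun t => complex.Re (f t)),
      measurable_fun (orthant q) (fun t => complex.Im (f t)) &
      (L2norm2 f < +oo)%E].

Definition L2dot q (f g : q.-tuple (measurableTypeR R) -> R[i]) : R[i] :=
  let h t := f t * (g t)^* in
  (\int[lebesgue_tuple q]_(t in orthant q) complex.Re (h t)) +i*
  (\int[lebesgue_tuple q]_(t in orthant q) complex.Im (h t)).

Definition mirror q (f : q.-tuple (measurableTypeR R) -> R[i]) :
    q.-tuple (measurableTypeR R) -> R[i] := fun t =>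
  (f [tuple of rev t])^*.

Definition mirror_symmetric q (f : q.-tuple (measurableTypeR R) -> R[i]) :
    Prop :=
  {ae lebesgue_tuple q, forall t, orthant q t -> f t = mirror f t}.

End LebesgueTuple.

Section FreeStochasticIntegral.
Context {R : realType} {A : tracialWstarProbSpace R} (S : R -> A).

(* A list of (c, ((a_1, b_1), ..., (a_q, b_q))) represents the simple function
   sum c 1_(a_1, b_1) (x) ... (x) 1_(a_q, b_q). Each term vanishes on the
   diagonals since its intervals are pairwise disjoint. *)
Definition off_diagonal_step q (s : seq (R[i] * q.-tuple (R * R))) : Prop :=
  {in s, forall u,
    (forall j, 0 <= (tnth u.2 j).1 < (tnth u.2 j).2) /\
    trivIset setT (fun j => `](tnth u.2 j).1, (tnth u.2 j).2[%classic)}.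

Definition step_fun q (s : seq (R[i] * q.-tuple (R * R)))
    (t : q.-tuple (measurableTypeR R)) : R[i] :=
  \sum_(u <- s) u.1 *
    \prod_(j < q)
      (\1_(`](tnth u.2 j).1, (tnth u.2 j).2[%classic) (tnth t j : R))%:C.

Definition step_integral q (s : seq (R[i] * q.-tuple (R * R))) : A :=
  \sum_(u <- s) u.1 *:
    \prod_(j < q) (S (tnth u.2 j).2 - S (tnth u.2 j).1).

(* x is the value at f of the isometric extension of [step_integral] to
   L^2(R_+^q): x is the limit in L^2(A, phi) of the integrals of simple
   functions that converge to f in L^2(R_+^q). *)
Definition is_free_integral q (f : q.-tuple (measurableTypeR R) -> R[i])
    (x : A) : Prop :=
  exists s : nat -> seq (R[i] * q.-tuple (R * R)),
    [/\ forall k, off_diagonal_step (s k),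
        L2norm2 (fun t => f t - step_fun (s k) t) @[k --> \oo] --> 0%E &
        cvgC (fun k => nc_state A (ws_adj (x - step_integral (s k)) *
                                   (x - step_integral (s k)))) 0].

Definition free_stochastic_integral q
    (I : (q.-tuple (measurableTypeR R) -> R[i]) -> A) : Prop :=
  forall f, square_integrable f -> is_free_integral f (I f).

End FreeStochasticIntegral.

(* Main.v *)
(* Z(lambda, alpha) is the law of (alpha_i a) for one centered free Poisson
   variable a, whose moments count noncrossing partitions without singletons;
   so (1) implies (2) by computing moments of order at most 4. Conversely, the
   second moments show that I(f_n^(i)) / alpha_i - I(f_n^(0)) / alpha_0 tends to 0
   in L2, which leaves a single sequence X = I(f). By the product formula,
     phi(X^4) - 2 phi(X^3) + |f|^2 - 2 |f|^4
   is the sum of the |f ^k f - [2k = q] f|^2 over 0 < k < q, so it controls the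
   distance between X P_h and P_(h+1) + P_h + lambda P_(h-1), where P_h is the
   integral of the h-th tensor power of f. Iterating this recursion from P_0 = 1
   makes phi(X^m) a count of weighted Motzkin paths, which are in bijection with
   the noncrossing partitions. All estimates are made in L2 for simple f on a
   common grid, where X is a combination of words in normalized increments, and
   passed to the limit by the bound |X a| <= (q + 1) |f| |a|. *)

Require Import Defs.
From HB Require Import structures.
From mathcomp Require Import all_boot all_order all_algebra.
From mathcomp Require Import sesquilinear complex.
From mathcomp Require Import all_classical all_reals all_analysis.
From mathcomp Require Import measurable_realfun.
From mathcomp Require Import ring lra zify.
Import Order.TTheory GRing.Theory Num.Theory numFieldNormedType.Exports.
Import ComplexField.Normc.

Set Implicit Arguments.
Unset Strict Implicit.
Unset Printing Implicit Defensive.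

Local Open Scope classical_set_scope.
Local Open Scope ring_scope.
Local Open Scope complex_scope.

(** L2 convergence alone does not pass to products. The argument therefore rests on bounds for left
    multiplication on L2(A, phi): they follow from the growth of moments, and traciality makes them
    survive L2 limits. On a grid it is a combinatorial identity for Wick words, and a general
    integral enters only through its step approximations. The analytic input about the semicircle
    law is one integration of a derivative, which yields that Wick words have mean 0. The step
    approximations of different I(f_n^(i)) live on unrelated grids, so these integrals are compared
    inside A and not through their kernels. Evenness of q gives the contraction with 2k = q the
    degree q again, which produces the level step P_h. The degree q = 0 is in scope: there X is a
    scalar, so phi(X^4) = phi(X^2)^2, and the limits in (2) are contradictory. *)

Section Complex.
Context {R : realType}.
Implicit Types (z w : R[i]) (a b : R).
Local Notation Re := (@complex.Re R).
Local Notation Im := (@complex.Im R).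

Lemma ReD z w : Re (z + w) = Re z + Re w. Proof. by case: z w => ? ? []. Qed.
Lemma ImD z w : Im (z + w) = Im z + Im w. Proof. by case: z w => ? ? []. Qed.
Lemma ReB z w : Re (z - w) = Re z - Re w. Proof. by case: z w => ? ? []. Qed.
Lemma ImB z w : Im (z - w) = Im z - Im w. Proof. by case: z w => ? ? []. Qed.
Lemma ReM z w : Re (z * w) = Re z * Re w - Im z * Im w.
Proof. by case: z w => ? ? []. Qed.
Lemma ImM z w : Im (z * w) = Re z * Im w + Im z * Re w.
Proof. by case: z w => ? ? []. Qed.
Lemma ReJ z : Re (z^*) = Re z. Proof. by case: z. Qed.
Lemma ImJ z : Im (z^*) = - Im z. Proof. by case: z. Qed.
Lemma eqC z w : Re z = Re w -> Im z = Im w -> z = w.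
Proof. by case: z w => ? ? [] ? ? /= -> ->. Qed.

Lemma normcE2 z : normc z ^+ 2 = sqmod z.
Proof. by case: z => a b /=; rewrite sqr_sqrtr// addr_ge0// sqr_ge0. Qed.

Lemma normc_ge0 z : 0 <= normc z. Proof. by case: z => ? ?; exact: sqrtr_ge0. Qed.

Lemma sqmod_ge0 z : 0 <= sqmod z. Proof. by rewrite addr_ge0 ?sqr_ge0. Qed.

Lemma mulCJ z : z * z^* = (sqmod z)%:C.
Proof. by apply: eqC; rewrite ?ReM ?ImM ReJ ImJ /sqmod/= ?expr2; ring. Qed.

Lemma sqmodM z w : sqmod (z * w) = sqmod z * sqmod w.
Proof. by rewrite /sqmod ReM ImM; ring. Qed.

Lemma sqmodJ z : sqmod (z^*) = sqmod z.
Proof. by rewrite /sqmod ReJ ImJ sqrrN. Qed.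

Lemma sqmodC a : sqmod a%:C = a ^+ 2.
Proof. by rewrite /sqmod/= expr0n addr0. Qed.

Lemma normc_real a : normc a%:C = `|a|.
Proof. by rewrite /= expr0n addr0 sqrtr_sqr. Qed.

Lemma normc_sqrt z : normc z = Num.sqrt (sqmod z).
Proof. by rewrite -normcE2 sqrtr_sqr ger0_norm ?normc_ge0. Qed.

Lemma normc_mul z w : normc (z * w) = normc z * normc w.
Proof. by rewrite !normc_sqrt sqmodM sqrtrM// sqmod_ge0. Qed.

Lemma Re_le_normc z : `|Re z| <= normc z.
Proof. by case: z => a b /=; rewrite -sqrtr_sqr ler_wsqrtr// lerDl sqr_ge0. Qed.
End Complex.

Section State.
Context {R : realType} {B : ncProbSpace R}.
Implicit Types (a b : B) (k : R[i]).

Lemma stateD a b : nc_state B (a + b) = nc_state B a + nc_state B b.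
Proof. exact: raddfD. Qed.
Lemma stateB a b : nc_state B (a - b) = nc_state B a - nc_state B b.
Proof. exact: raddfB. Qed.
Lemma state0 : nc_state B 0 = 0.
Proof. exact: raddf0. Qed.
Lemma stateZ k a : nc_state B (k *: a) = k * nc_state B a.
Proof. exact: linearZ_LR. Qed.
Lemma state_sum I (r : seq I) (P : pred I) (F : I -> B) :
  nc_state B (\sum_(i <- r | P i) F i) = \sum_(i <- r | P i) nc_state B (F i).
Proof. exact: raddf_sum. Qed.

End State.

(** * The L2 norm of a tracial state *)

Section TraceSpace.
Context {R : realType} {A : tracialWstarProbSpace R}.
Implicit Types (a b c x y : A) (k : R[i]).
Local Notation phi := (nc_state A).
Local Notation "a ^#" := (ws_adj a) (at level 2, format "a ^#").
Local Notation Re := (@complex.Re R).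
Local Notation Im := (@complex.Im R).

Lemma hs_dot_inj (H : hilbertSpace R) (y z : H) :
  (forall x : H, hs_dot H x y = hs_dot H x z) -> y = z.
Proof.
move=> h; apply/eqP; rewrite -subr_eq0 -(dnorm_eq0 (hs_dot H)).
by rewrite linearBr/= h subrr.
Qed.

(** The record only relates [ws_adj] to the inner product. Faithfulness of the action turns this
    into uniqueness, from which the algebraic laws of the adjoint follow. *)
Lemma ws_adj_unique a b :
  (forall x y : ws_hilb A, hs_dot (ws_hilb A) (ws_act a x) y =
               hs_dot (ws_hilb A) x (ws_act b y)) -> a^# = b.
Proof.
move=> h; apply: (@ws_act_inj _ A); apply/funext => y.
by apply: hs_dot_inj => x; rewrite -ws_adjP h.
Qed.

Lemma adjP k a b : (k *: a + b)^# = k^* *: a^# + b^#.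
Proof.
apply: ws_adj_unique => x y; rewrite !ws_act_lin linearDl linearZl_LR/=.
rewrite linearDr linearZr_LR/= !ws_adjP.
by congr (_ * _ + _); exact/esym/conjcK.
Qed.

Lemma adjM a b : (a * b)^# = b^# * a^#.
Proof. by apply: ws_adj_unique => x y; rewrite !ws_actM !ws_adjP. Qed.

Lemma adj1 : (1 : A)^# = 1.
Proof. by apply: ws_adj_unique => x y; rewrite !ws_act1. Qed.

Lemma adjK a : a^#^# = a.
Proof.
apply: ws_adj_unique => x y.
by rewrite hermC/= expr0 mul1r -ws_adjP [RHS]hermC/= expr0 mul1r.
Qed.

Lemma adj0 : (0 : A)^# = 0.
Proof. by have := adjP (-1) 1 1; rewrite scaleN1r addNr adj1 rmorphN rmorph1 scaleN1r addNr. Qed.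

Lemma adjD a b : (a + b)^# = a^# + b^#.
Proof. by rewrite -[a in LHS]scale1r adjP rmorph1 scale1r. Qed.

Lemma adjZ k a : (k *: a)^# = k^* *: a^#.
Proof. by rewrite -[_ *: _ in LHS]addr0 adjP adj0 addr0. Qed.

Lemma adjN a : (- a)^# = - a^#.
Proof. by rewrite -scaleN1r adjZ rmorphN rmorph1 scaleN1r. Qed.

Lemma adjB a b : (a - b)^# = a^# - b^#.
Proof. by rewrite adjD adjN. Qed.

Lemma adj_sum I (r : seq I) (P : pred I) (F : I -> A) :
  (\sum_(i <- r | P i) F i)^# = \sum_(i <- r | P i) (F i)^#.
Proof. by elim/big_rec2 : _ => [|i y1 y2 _ <-]; rewrite ?adj0// adjD. Qed.

Lemma adj_prod I (r : seq I) (F : I -> A) :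
  (\prod_(i <- r) F i)^# = \prod_(i <- rev r) (F i)^#.
Proof.
elim: r => [|i r IH]; first by rewrite !big_nil adj1.
by rewrite big_cons adjM IH rev_cons -cats1 big_cat/= big_seq1.
Qed.

(** Positivity of phi at [a + k *: 1] forces [k^* * phi a + k * phi a^#] to be real; k = i and k = 1
    compare the two components. *)
Lemma phiJ a : phi a^# = (phi a)^*.
Proof.
have h k : Im (k^* * phi a + k * phi a^#) = 0.
  have := @ger0_Im R _ (ws_state_ge0 (a + k *: 1)).
  rewrite adjD adjZ adj1 mulrDr !mulrDl !stateD !ImD.
  rewrite -!scalerAl -!scalerAr !mul1r !mulr1 !stateZ nc_state1.
  rewrite !(ger0_Im (ws_state_ge0 a)) !mulr1 !ImM ImJ ReJ.
  by move=> H; rewrite -[RHS]H; ring.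
apply: eqC; rewrite ?ReJ ?ImJ.
  have := h 'i; rewrite ImD !ImM/=; lra.
have := h 1; rewrite rmorph1 !mul1r ImD; lra.
Qed.

Definition sq a : R := Re (phi (a^# * a)).
Definition n2 a : R := Num.sqrt (sq a).

Lemma sqE a : phi (a^# * a) = (sq a)%:C.
Proof. by apply: eqC => //=; rewrite (ger0_Im (ws_state_ge0 a)). Qed.

Lemma sq_ge0 a : 0 <= sq a.
Proof. by rewrite -ler0c -sqE ws_state_ge0. Qed.

Lemma n2_ge0 a : 0 <= n2 a. Proof. exact: sqrtr_ge0. Qed.

Lemma n2E a : n2 a ^+ 2 = sq a.
Proof. by rewrite sqr_sqrtr// sq_ge0. Qed.

Lemma sq_adj a : sq a^# = sq a.
Proof. by rewrite /sq adjK ws_stateC. Qed.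

Lemma n2_adj a : n2 a^# = n2 a. Proof. by rewrite /n2 sq_adj. Qed.

Lemma sqZ k a : sq (k *: a) = sqmod k * sq a.
Proof.
rewrite /sq adjZ -scalerAl -scalerAr scalerA stateZ mulrC sqE mulrC.
by rewrite [k^* * k]mulrC mulCJ -rmorphM/=.
Qed.

Lemma n2Z k a : n2 (k *: a) = normc k * n2 a.
Proof.
by rewrite /n2 sqZ sqrtrM ?sqmod_ge0// -normcE2 sqrtr_sqr ger0_norm ?normc_ge0.
Qed.

Lemma n20 : n2 0 = 0.
Proof. by rewrite -(scale0r 1) n2Z normc0 mul0r. Qed.

Lemma n2N a : n2 (- a) = n2 a.
Proof. by rewrite -scaleN1r n2Z normcN normc1 mul1r. Qed.

Lemma n21 : n2 1 = 1.
Proof. by rewrite /n2 /sq adj1 mul1r nc_state1/= sqrtr1. Qed.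

Lemma n2_eq0 a : n2 a = 0 -> a = 0.
Proof.
move=> h; apply: (@ws_state_faithful _ A); rewrite sqE -n2E h expr0n//.
Qed.

Lemma sqD a b : sq (a + b) = sq a + sq b + 2 * Re (phi (b^# * a)).
Proof.
rewrite /sq adjD mulrDr !mulrDl !stateD !ReD.
rewrite -[in phi (a^# * b)](adjK b) -adjM phiJ ReJ; ring.
Qed.

Lemma cauchy_schwarz_phi a b : normc (phi (b^# * a)) <= n2 a * n2 b.
Proof.
have [b0|b0] := eqVneq (n2 b) 0.
  by rewrite (n2_eq0 b0) adj0 mul0r state0 normc0 mulr_ge0// n2_ge0.
have bgt0 : 0 < n2 b by rewrite lt_neqAle eq_sym b0 n2_ge0.
rewrite -(@ler_pXn2r _ 2) ?nnegrE ?mulr_ge0 ?normc_ge0 ?n2_ge0//.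
rewrite exprMn !n2E normcE2.
set p := phi _.
(* The component of a orthogonal to b, multiplied by [sq b] to avoid a division. *)
have := sq_ge0 ((sq b)%:C *: a + (- p) *: b).
rewrite sqD !sqZ adjZ -scalerAl -scalerAr !stateZ -/p.
have -> : Re ((- p)^* * ((sq b)%:C * p)) = - sq b * sqmod p.
  by rewrite !ReM !ImM/= /sqmod ReJ ImJ; case: (p) => u v /=; ring.
have -> : sqmod (- p) = sqmod p by rewrite /sqmod; case: (p) => u v /=; rewrite !sqrrN.
rewrite sqmodC => h.
have b2 : 0 < sq b by rewrite -n2E exprn_gt0.
rewrite -subr_ge0 -(pmulr_rge0 _ b2); move: h; congr (_ <= _); ring.
Qed.

Lemma n2D a b : n2 (a + b) <= n2 a + n2 b.
Proof.
rewrite -(@ler_pXn2r _ 2) ?nnegrE ?addr_ge0 ?n2_ge0// sqrrD !n2E sqD.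
have := cauchy_schwarz_phi a b; have := Re_le_normc (phi (b^# * a)).
rewrite ler_norml => /andP[_ h1] h2; have := le_trans h1 h2; lra.
Qed.

Lemma n2B a b : n2 (a - b) <= n2 a + n2 b.
Proof. by rewrite -(n2N b) n2D. Qed.

Lemma n2_sum I (r : seq I) (P : pred I) (F : I -> A) :
  n2 (\sum_(i <- r | P i) F i) <= \sum_(i <- r | P i) n2 (F i).
Proof.
elim/big_rec2 : _ => [|i y1 y2 _ h]; first by rewrite n20.
by rewrite (le_trans (n2D _ _))// lerD2l.
Qed.

Lemma normc_phi_le a : normc (phi a) <= n2 a.
Proof.
by have := cauchy_schwarz_phi a 1; rewrite adj1 mul1r n21 mulr1.
Qed.

Lemma phiM_le a b : normc (phi (a * b)) <= n2 a * n2 b.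
Proof. by have := cauchy_schwarz_phi b a^#; rewrite adjK n2_adj mulrC. Qed.

(** The operator norm is measured on L2(A, phi) and not on [ws_hilb A], because there it can be read
    off from moments. *)
Definition opbd (C : R) a := 0 <= C /\ forall b, n2 (a * b) <= C * n2 b.

Lemma opbd_le C D a : opbd C a -> C <= D -> opbd D a.
Proof.
move=> [C0 h] CD; split=> [|b]; first exact: le_trans C0 CD.
by rewrite (le_trans (h b))// ler_wpM2r// n2_ge0.
Qed.

Lemma opbdZ k C a : opbd C a -> opbd (normc k * C) (k *: a).
Proof.
move=> [C0 h]; split=> [|b]; first by rewrite mulr_ge0// normc_ge0.
by rewrite -scalerAl n2Z -mulrA ler_wpM2l// normc_ge0.
Qed.

(** L2 approximation of x says nothing directly about [x * a]. By traciality |(x - y) a|^2 is at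
    most |x - y| |(x - y) a a^#|, and the last factor stays bounded because y satisfies the bound
    C. *)
Lemma opbd_lim (C : R) x : 0 <= C ->
  (forall e : R, 0 < e -> exists2 y, opbd C y & n2 (x - y) <= e) -> opbd C x.
Proof.
move=> C0 h; split=> // a; rewrite leNgt; apply/negP => lt.
set p := n2 (x * a) - C * n2 a; have p0 : 0 < p by rewrite subr_gt0.
pose L := n2 (x * (a * a^#)) + C * n2 (a * a^#).
have L0 : 0 <= L by rewrite addr_ge0 ?mulr_ge0 ?n2_ge0.
(* With this tolerance the assumed excess p satisfies p^2 <= p^2 L / (L + 1), which is absurd. *)
have e0 : 0 < p ^+ 2 / (L + 1) by rewrite divr_gt0 ?exprn_gt0// ltr_wpDl.
have [y yC xy] := h _ e0.
have h1 : p <= n2 ((x - y) * a).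
  rewrite lerBlDr -{1}(subrK y x) mulrDl (le_trans (n2D _ _))// lerD2l.
  exact: yC.2.
have h2 : n2 ((x - y) * a) ^+ 2 <= n2 (x - y) * L.
  rewrite n2E /sq adjM -mulrA ws_stateC -!mulrA (le_trans (ler_norm _))//.
  rewrite (le_trans (Re_le_normc _))//.
  have -> : nc_state A ((x - y)^# * ((x - y) * (a * a^#))) =
            nc_state A ((x - y) * (a * a^# * (x - y)^#)).
    by rewrite ws_stateC -!mulrA.
  rewrite (le_trans (phiM_le _ _))// ler_wpM2l ?n2_ge0//.
  rewrite -n2_adj !adjM !adjK mulrBl (le_trans (n2B _ _))// lerD2l.
  exact: yC.2.
have : p ^+ 2 <= p ^+ 2 / (L + 1) * L.
  rewrite (le_trans _ (le_trans h2 _))// ?ler_wpM2r//.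
  by rewrite ler_pXn2r// nnegrE ?n2_ge0// ltW.
rewrite mulrAC ler_pdivlMr ?ltr_wpDl// leNgt => /negP; apply.
by rewrite ltr_pM2l ?exprn_gt0// ltrDl.
Qed.

(** The constant M disappears under 2^j-th roots. No root is taken: if u / v = 1 + d with d > 0,
    Bernoulli's inequality makes its powers exceed M. *)
Lemma le_pow2_root (u v M : R) : 0 <= u -> 0 <= v ->
  (forall j, u ^+ (2 ^ j) <= M * v ^+ (2 ^ j)) -> u <= v.
Proof.
move=> u0 v0 h; rewrite leNgt; apply/negP => vu.
have [v00|v_neq0] := eqVneq v 0.
  have := h 0%N; rewrite v00 expr1 mulr0 leNgt => /negP; apply.
  by rewrite -v00.
have vp : 0 < v by rewrite lt_neqAle eq_sym v_neq0.
have [d dE] : exists d, u / v = 1 + d by exists (u / v - 1); rewrite addrC subrK.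
have d0 : 0 < d by rewrite -(ltrD2l 1) addr0 -dE ltr_pdivlMr// mul1r.
have bern n : 1 + n%:R * d <= (1 + d) ^+ n.
  elim: n => [|n IH]; first by rewrite mul0r addr0.
  rewrite exprS (le_trans _ (ler_wpM2l _ IH)) ?addr_ge0 ?(ltW d0)//.
  have : 0 <= d * (n%:R * d) by rewrite !mulr_ge0// ltW.
  rewrite -natr1; lra.
have h' j : (1 + d) ^+ (2 ^ j) <= M.
  by have := h j; rewrite -ler_pdivrMr ?exprn_gt0// -expr_div_n dE.
have [n nM] : exists n : nat, M / d < n%:R.
  by exists (Num.truncn (M / d)).+1; exact: truncnS_gt.
have := h' n; rewrite leNgt => /negP; apply.
rewrite (lt_le_trans _ (bern _))//.
rewrite ltr_wpDl//.
rewrite ltr_pdivrMr// in nM; rewrite (lt_le_trans nM)// ler_wpM2r ?ltW//.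
by rewrite ltr_nat ltn_expl.
Qed.

Lemma adjX x n : (x ^+ n)^# = x^# ^+ n.
Proof. by elim: n => [|n IH]; rewrite ?adj1// exprS adjM IH -exprSr. Qed.

(* Iterating |x^i a|^2 <= |a| |x^(2i) a| bounds |x a| / |a| by the 2^j-th root
   of the 2^j-th moment, up to a constant. *)
Lemma opbd_moments (C : R) x : x^# = x -> 0 <= C ->
  (forall m, normc (phi (x ^+ m)) <= C ^+ m) -> opbd C x.
Proof.
move=> xsa C0 h; split=> // a.
have [a0|a0] := eqVneq (n2 a) 0.
  by rewrite (n2_eq0 a0) mulr0 n20 mulr0.
have ap : 0 < n2 a by rewrite lt_neqAle eq_sym a0 n2_ge0.
have u2 i : n2 (x ^+ i * a) ^+ 2 <= n2 a * n2 (x ^+ (i + i) * a).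
  rewrite n2E /sq adjM -mulrA [_ * (_ * a)]mulrA adjX xsa -exprD.
  rewrite (le_trans (ler_norm _))// (le_trans (Re_le_normc _))//.
  by rewrite mulrC cauchy_schwarz_phi.
(* Traciality separates a from the powers of x and leaves the moment of order 4i. *)
have uC i : n2 (x ^+ i * a) ^+ 2 <= C ^+ i ^+ 2 * n2 (a * a^#).
  rewrite n2E /sq adjM -mulrA [_ * (_ * a)]mulrA adjX xsa -exprD ws_stateC -mulrA.
  rewrite (le_trans (ler_norm _))// (le_trans (Re_le_normc _))//.
  rewrite (le_trans (phiM_le _ _))// ler_wpM2r ?n2_ge0//.
  rewrite -(@ler_pXn2r _ 2) ?nnegrE ?n2_ge0 ?exprn_ge0// n2E /sq adjX xsa -exprD.
  rewrite (le_trans (ler_norm _))// (le_trans (Re_le_normc _))// (le_trans (h _))//.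
  by rewrite -!exprM !muln2 -!addnn.
rewrite -ler_pdivrMr//.
apply: (@le_pow2_root _ _ (Num.sqrt (n2 (a * a^#)) / n2 a)) => //.
  by rewrite divr_ge0 ?n2_ge0.
move=> j; have h1 : (n2 (x * a) / n2 a) ^+ (2 ^ j) <= n2 (x ^+ (2 ^ j) * a) / n2 a.
  elim: j => [|j IH]; first by rewrite !expr1.
  rewrite expnS mul2n -addnn exprD -expr2.
  rewrite (@le_trans _ _ ((n2 (x ^+ (2 ^ j) * a) / n2 a) ^+ 2))//.
    by rewrite ler_pXn2r// nnegrE ?exprn_ge0 ?divr_ge0 ?n2_ge0.
  rewrite expr_div_n ler_pdivrMr ?exprn_gt0// (le_trans (u2 _))//.
  by rewrite expr2 mulrA divfK// [leLHS]mulrC.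
rewrite (le_trans h1)// mulrAC ler_wpM2r ?invr_ge0 ?n2_ge0//.
rewrite -(@ler_pXn2r _ 2) ?nnegrE ?n2_ge0 ?mulr_ge0 ?exprn_ge0 ?sqrtr_ge0//.
by rewrite (le_trans (uC _))// [leRHS]exprMn sqr_sqrtr ?n2_ge0// [leLHS]mulrC.
Qed.

End TraceSpace.

(** * Wick words *)

Section Words.
Context {T : eqType} (L : seq T) (uL : uniq L).
Implicit Types (u v w z : seq T).

Fixpoint words n : seq (seq T) :=
  if n is m.+1 then [seq i :: w | i <- L, w <- words m] else [:: [::]].

Lemma mem_words n w : (w \in words n) = (size w == n) && all (mem L) w.
Proof.
elim: n w => [|n IH] [|i w] //=; first by apply/negbTE/allpairsPdep => -[? [? []]].
rewrite eqSS andbCA -IH; apply/allpairsPdep/andP => [[j [z [jL zn [-> ->]]]]|[iL wn]].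
  by rewrite jL zn.
by exists i, w.
Qed.

Lemma words_uniq n : uniq (words n).
Proof.
elim: n => [//|n IH] /=; apply: allpairs_uniq => //.
by move=> [i w] [j z] _ _ /= [-> ->].
Qed.

Lemma big_words_cat (V : nmodType) m n (F : seq T -> V) :
  \sum_(w <- words (m + n)) F w =
  \sum_(u <- words m) \sum_(v <- words n) F (u ++ v).
Proof.
elim: m F => [|m IH] F; first by rewrite add0n /= big_seq1.
by rewrite addSn /= !big_allpairs_dep/=; apply: eq_bigr => i _; rewrite IH.
Qed.

Lemma big_words_rev (V : nmodType) n (F : seq T -> V) :
  \sum_(w <- words n) F (rev w) = \sum_(w <- words n) F w.
Proof.
rewrite -(big_map rev xpredT); apply: perm_big; apply: uniq_perm.
- by rewrite map_inj_uniq ?words_uniq//; exact: inv_inj revK.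
- exact: words_uniq.
move=> w; rewrite -{1}[w]revK mem_map; last exact: inv_inj revK.
by rewrite !mem_words size_rev all_rev.
Qed.

Lemma big_words_delta (V : nmodType) n (F : seq T -> V) z :
  \sum_(w <- words n) (if w == z then F w else 0) = if z \in words n then F z else 0.
Proof.
rewrite -big_mkcond/=; case: ifPn => zn; last first.
  by rewrite big_seq_cond big1// => w /andP[wn /eqP wz]; rewrite -wz wn in zn.
by rewrite (big_rem z)//= eqxx big_seq_cond big1 ?addr0// => w /andP[];
  rewrite (rem_filter _ (words_uniq n)) mem_filter/= => /andP[/negbTE->].
Qed.

Lemma size_words n w : w \in words n -> size w = n.
Proof. by rewrite mem_words => /andP[/eqP]. Qed.

End Words.

Section Wick.
Context {R : realType} {A : tracialWstarProbSpace R} {T : eqType}.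
Variables (s : T -> A) (L : seq T).
Implicit Types (u v w z : seq T).
Local Notation phi := (nc_state A).
Local Notation "a ^#" := (ws_adj a) (at level 2, format "a ^#").

(* For a semicircular family of variance 1 these are the products of Chebyshev
   polynomials that the vacuum representation sends to the basis tensors. *)
Fixpoint wick w : A :=
  if w is i :: w1 then
    s i * wick w1 -
    (if w1 is j :: w2 then if i == j then wick w2 else 0 else 0)
  else 1.

Lemma wick1 i : wick [:: i] = s i. Proof. by rewrite /= mulr1 subr0. Qed.

Lemma wick_cons2 i j w : wick [:: i, j & w] =
  s i * wick (j :: w) - (if i == j then wick w else 0).
Proof. by []. Qed.

(** Only the two letters at the junction interact. The recursion from the right, the adjoint, the
    product formula and orthonormality are all iterations of this identity. *)
Lemma wick_glue u i j v : wick (rcons u i) * wick (j :: v) =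
  wick (u ++ i :: j :: v) + (if i == j then wick u * wick v else 0).
Proof.
have [m um] := ubnP (size u).
elim: m u um => // m IH [|a [|b u]] um.
- by rewrite wick1 mul1r wick_cons2 subrK.
- rewrite [rcons _ _]/= ![_ ++ _]/= !wick_cons2 !wick1 mulrBl [wick [::]]/= -mulrA.
  move: (wick (j :: v)) (wick v) => W1 W2; rewrite [s a * (_ - _)]mulrBr.
  by case: (i == j); case: (a == i); rewrite ?mulr0 ?addr0 ?mul1r ?mul0r ?subr0// ?subrK// addrAC subrK.
rewrite [rcons _ _]/= ![_ ++ _]/= !wick_cons2 mulrBl -mulrA.
rewrite -rcons_cons IH//.
have E : (if a == b then wick (rcons u i) else 0) * wick (j :: v) =
    (if a == b then wick (u ++ i :: j :: v) else 0) +
    (if i == j then (if a == b then wick u else 0) * wick v else 0).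
  case: (a == b); last by rewrite !mul0r; case: ifP => _; rewrite addr0.
  by rewrite IH// -ltnS ltnW.
rewrite {}E cat_cons; clear.
move: (wick (b :: u)) (wick u) (wick v) (wick _) (wick _) => W1 W2 W3 W4 W5.
case: (i == j); case: (a == b);
  rewrite ?mul0r ?addr0 ?subr0 // mulrDr ?mulrBl ?opprD ?mulrA //.
by rewrite addrACA.
Qed.

Lemma wick_rcons2 u i j : wick (rcons (rcons u i) j) =
  wick (rcons u i) * s j - (if i == j then wick u else 0).
Proof.
rewrite -(wick1 j) (wick_glue u i j [::]) /= mulr1 addrK.
by rewrite -!cats1 -catA.
Qed.

Hypothesis sJ : forall i, (s i)^# = s i.

Lemma wick_adj w : (wick w)^# = wick (rev w).
Proof.
have [m wm] := ubnP (size w).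
elim: m w wm => // m IH [|i [|j w]] wm; first by rewrite adj1.
  by rewrite wick1 sJ -wick1.
rewrite wick_cons2 !rev_cons wick_rcons2 adjB adjM sJ IH// rev_cons eq_sym; congr (_ - _).
by case: ifP; rewrite ?adj0// IH// -ltnS ltnW.
Qed.

(** The k-th term contracts k pairs of letters outward from the junction. No condition [k <= size v]
    is imposed: for larger k the two compared words differ in length. *)
Lemma wick_mul u v : wick u * wick v =
  \sum_(k < (size u).+1) if rev (drop (size u - k) u) == take k v
    then wick (take (size u - k) u ++ drop k v) else 0.
Proof.
elim/last_ind: u v => [|u i IH] v.
  by rewrite big_ord_recl big_ord0 /= take0 drop0 eqxx addr0 mul1r.
rewrite size_rcons big_ord_recl subn0 [drop _ (rcons u i)]drop_oversize ?size_rcons//.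
rewrite [take _ (rcons u i)]take_oversize ?size_rcons//=.
rewrite take0 eqxx drop0.
have E (k : 'I_(size u).+1) :
    rev (drop ((size u).+1 - bump 0 k) (rcons u i)) = i :: rev (drop (size u - k) u) /\
    take ((size u).+1 - bump 0 k) (rcons u i) = take (size u - k) u.
  rewrite /bump leq0n add1n subSS -cats1 takel_cat ?leq_subr//; split=> //.
  rewrite drop_cat; case: ltnP => [_|h]; first by rewrite cats1 rev_rcons.
  have -> : (size u - k)%N = size u by apply/eqP; rewrite eqn_leq leq_subr h.
  by rewrite subnn drop_size.
under eq_bigr => k _ do rewrite (E k).1 (E k).2 /bump leq0n add1n.
case: v => [|j v].
  by rewrite mulr1 cats0 big1 ?addr0.
rewrite wick_glue -cats1 -catA; congr (_ + _).
case: ifP => [/eqP ->|ij]; last first.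
  by rewrite big1// => k _; rewrite /= eqseq_cons ij.
by rewrite IH; apply: eq_bigr => k _; rewrite /= eqseq_cons eqxx.
Qed.

(** This is where vanishing on the diagonals enters: without equal neighbours the recursion has no
    correction term. *)
Lemma wick_prod w : uniq w -> \prod_(i <- w) s i = wick w.
Proof.
elim: w => [|i w IH] /=; first by rewrite big_nil.
move=> /andP[iw uw]; rewrite big_cons IH//.
case: w iw {IH uw} => [|j w] iw; first by rewrite subr0.
by case: ifPn iw => [/eqP ->|_ _]; rewrite ?mem_head// subr0.
Qed.

Hypothesis phi_wick : forall w, all (mem L) w -> w != [::] -> phi (wick w) = 0.

Lemma phi_wickM u v : all (mem L) u -> all (mem L) v ->
  phi (wick u * wick v) = (v == rev u)%:R.
Proof.
elim/last_ind: u v => [|u i IH] v.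
  move=> _ vL; rewrite mul1r; case: eqVneq => [->|v0]; first exact: nc_state1.
  exact: phi_wick.
rewrite all_rcons rev_rcons => /andP[iL uL].
case: v => [|j v] vL.
  by rewrite mulr1 phi_wick// ?all_rcons ?iL//; case: (u).
have /andP[jL {}vL] : (j \in L) && all (mem L) v := vL.
rewrite wick_glue stateD phi_wick; last 2 first.
- by rewrite all_cat uL/= jL vL !andbT.
- by case: (u).
rewrite add0r eqseq_cons eq_sym; case: eqP => //= _; last exact: state0.
exact: IH.
Qed.

Hypothesis uL : uniq L.

(** A discrete multiple integral of order n. The kernel is given by its coordinates in an
    orthonormal basis, so no cell volumes appear. *)
Definition theta n (f : seq T -> R[i]) : A := \sum_(w <- words L n) f w *: wick w.

Definition tdot n (f g : seq T -> R[i]) : R[i] := \sum_(w <- words L n) f w * (g w)^*.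

Definition tsq n (f : seq T -> R[i]) : R := \sum_(w <- words L n) sqmod (f w).

Lemma tsq_ge0 n f : 0 <= tsq n f.
Proof. by apply: sumr_ge0 => w _; exact: sqmod_ge0. Qed.

Lemma theta_adj n f : (theta n f)^# = theta n (fun w => (f (rev w))^*).
Proof.
rewrite /theta adj_sum -[RHS]big_words_rev//; apply: eq_bigr => w _.
by rewrite adjZ wick_adj revK.
Qed.

Lemma eq_theta n f g : {in words L n, f =1 g} -> theta n f = theta n g.
Proof. by move=> fg; apply: eq_big_seq => w /fg ->. Qed.

Lemma eq_tsq n f g : {in words L n, f =1 g} -> tsq n f = tsq n g.
Proof. by move=> fg; apply: eq_big_seq => w /fg ->. Qed.

Lemma thetaD n f g : theta n (fun w => f w + g w) = theta n f + theta n g.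
Proof. by rewrite /theta -big_split; apply: eq_bigr => w _; rewrite scalerDl. Qed.

Lemma thetaZ n k f : theta n (fun w => k * f w) = k *: theta n f.
Proof. by rewrite /theta scaler_sumr; apply: eq_bigr => w _; rewrite scalerA. Qed.

Lemma phi_thetaM m n g f : phi ((theta m g)^# * theta n f) =
  if m == n then tdot n f g else 0.
Proof.
rewrite /theta adj_sum mulr_suml state_sum.
under eq_bigr => u _ do rewrite mulr_sumr state_sum.
have E u v : u \in words L m -> v \in words L n ->
    phi ((g u *: wick u)^# * (f v *: wick v)) = if v == u then f v * (g u)^* else 0.
  rewrite !mem_words => /andP[/eqP um uL'] /andP[/eqP vn vL].
  rewrite adjZ wick_adj -scalerAl -scalerAr !stateZ phi_wickM ?all_rev// revK.
  by case: eqP => _; rewrite ?mulr0// mulr1 mulrC.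
rewrite big_seq; under eq_bigr => u um.
  rewrite big_seq; under eq_bigr => v vn do rewrite E//.
  rewrite -big_seq big_words_delta//.
  over.
rewrite -big_seq; case: eqVneq => [<-|mn].
  by apply: eq_big_seq => u ->.
rewrite big_seq big1// => u; case: ifPn => // un um; move: mn.
by rewrite -(size_words um) -(size_words un) eqxx.
Qed.

Lemma sq_theta n f : sq (theta n f) = tsq n f.
Proof.
rewrite /sq phi_thetaM eqxx /tdot (eq_bigr (fun w => (sqmod (f w))%:C)); last first.
  by move=> w _; rewrite mulCJ.
by rewrite -rmorph_sum.
Qed.

Lemma sq_theta_sum (I : eqType) (r : seq I) (d : I -> nat) (f : I -> seq T -> R[i]) :
  uniq [seq d i | i <- r] ->
  sq (\sum_(i <- r) theta (d i) (f i)) = \sum_(i <- r) tsq (d i) (f i).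
Proof.
elim: r => [|i r IH]; first by rewrite !big_nil /sq adj0 mul0r state0.
rewrite !big_cons /= => /andP[ir ur]; rewrite sqD IH// sq_theta.
rewrite adj_sum mulr_suml state_sum [X in complex.Re X]big1_seq ?mulr0 ?addr0// => j /andP[_ jr].
rewrite phi_thetaM; case: eqP => // E; case/negP: ir; rewrite -E.
exact: map_f.
Qed.

(* The contraction of the last k legs of f with the first k legs of g, where f
   has degree p + k. *)
Definition contr p k (f g : seq T -> R[i]) (w : seq T) : R[i] :=
  \sum_(z <- words L k) f (take p w ++ rev z) * g (z ++ drop p w).

Lemma theta_mul q n f g : theta q f * theta n g =
  \sum_(k < q.+1 | (k <= n)%N) theta (q - k + (n - k)) (contr (q - k) k f g).
Proof.
rewrite /theta mulr_suml.
under eq_bigr => u _ do rewrite mulr_sumr.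
have E u v : u \in words L q -> (f u *: wick u) * (g v *: wick v) =
   \sum_(k < q.+1) if rev (drop (q - k) u) == take k v
    then (f u * g v) *: wick (take (q - k) u ++ drop k v) else 0.
  move=> /size_words uq; rewrite -scalerAl -scalerAr scalerA wick_mul uq scaler_sumr.
  by apply: eq_bigr => k _; case: ifP; rewrite ?scaler0.
rewrite big_seq; under eq_bigr => u um.
  under eq_bigr => v _ do rewrite E//.
  rewrite exchange_big; over.
rewrite -big_seq/= exchange_big [RHS]big_mkcond/=; apply: eq_bigr => k _.
have kq : (k <= q)%N by rewrite -ltnS.
case: ifPn => kn; last first.
  rewrite big_seq big1// => u /size_words uq; rewrite big_seq big1// => v /size_words vn.
  case: eqP => // /(congr1 size); rewrite size_rev size_drop uq subKn// take_oversize.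
    by rewrite vn => kE; rewrite kE leqnn in kn.
  by rewrite vn ltnW// ltnNge.
(* The first word is split as [a ++ rev z] and the second as [y ++ b]; the contraction condition
   becomes [z == y] and removes the sum over y. *)
rewrite -{1}(subnK kq) !big_words_cat//.
apply: eq_big_seq => a /size_words aq.
rewrite -big_words_rev//.
under eq_big_seq => z /size_words zk.
  rewrite -{1}(subnKC kn) big_words_cat//.
  under eq_big_seq => y /size_words yk.
    under eq_bigr => b _ do rewrite drop_size_cat// revK !take_size_cat// drop_size_cat//.
    rewrite (_ : \sum_(b <- _) _ = if y == z then
        \sum_(b <- words L (n - k)) (f (a ++ rev z) * g (y ++ b)) *: wick (a ++ b)
        else 0); last first.
      by rewrite eq_sym; case: ifP => // _; rewrite big1.
    over.
  rewrite big_words_delta// ; over.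
rewrite big_seq; under eq_bigr => z zk do rewrite zk.
rewrite -big_seq exchange_big/=; apply: eq_bigr => b _.
by rewrite -scaler_suml /contr take_size_cat// drop_size_cat.
Qed.

Definition tens p (f g : seq T -> R[i]) (w : seq T) : R[i] :=
  f (take p w) * g (drop p w).

Lemma tsq_tens p n f g : tsq (p + n) (tens p f g) = tsq p f * tsq n g.
Proof.
rewrite /tsq big_words_cat// mulr_suml; apply: eq_big_seq => u /size_words uq.
rewrite mulr_sumr; apply: eq_bigr => v _.
by rewrite /tens take_size_cat// drop_size_cat// sqmodM.
Qed.

Lemma contr0 p f g w : contr p 0 f g w = tens p f g w.
Proof. by rewrite /contr big_seq1 cats0. Qed.

(** A contraction of k legs stays inside the first tensor factor if that has at least k legs.
    Multiplication by X thus acts only on the first factor of a tensor power. *)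
Lemma contr_tens p k r f g h w :
  contr p k f (tens (k + r) g h) w = tens (p + r) (contr p k f g) h w.
Proof.
rewrite /tens /contr mulr_suml; apply: eq_big_seq => z /size_words zk.
rewrite take_cat drop_cat zk ltnNge leq_addr/= addKn drop_drop take_takel ?leq_addr//.
by rewrite mulrA take_drop [(r + p)%N]addnC.
Qed.

Lemma sum_cauchy_schwarz I (r : seq I) (F G : I -> R[i]) :
  sqmod (\sum_(i <- r) F i * G i) <=
  (\sum_(i <- r) sqmod (F i)) * (\sum_(i <- r) sqmod (G i)).
Proof.
have real_cs (a b p q x : R) : 0 <= p -> 0 <= q -> 0 <= a -> 0 <= b -> 0 <= x ->
    x <= p * q -> (a * b + x) ^+ 2 <= (a ^+ 2 + p ^+ 2) * (b ^+ 2 + q ^+ 2).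
  move=> p0 q0 a0 b0 x0 xpq.
  have : (a * b + x) ^+ 2 <= (a * b + p * q) ^+ 2.
    by rewrite ler_pXn2r ?nnegrE ?addr_ge0 ?mulr_ge0// lerD2l.
  have : 0 <= (a * q - b * p) ^+ 2 by exact: sqr_ge0.
  by rewrite !expr2; nra.
suff h : normc (\sum_(i <- r) F i * G i) <=
    Num.sqrt (\sum_(i <- r) sqmod (F i)) * Num.sqrt (\sum_(i <- r) sqmod (G i)).
  rewrite -normcE2 -[leRHS](@sqr_sqrtr R); last first.
    by rewrite mulr_ge0// sumr_ge0// => i _; exact: sqmod_ge0.
  rewrite ler_pXn2r ?nnegrE ?normc_ge0 ?sqrtr_ge0// sqrtrM//.
  by apply: sumr_ge0 => i _; exact: sqmod_ge0.
have S0 (H : I -> R[i]) (l : seq I) : 0 <= \sum_(i <- l) sqmod (H i).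
  by apply: sumr_ge0 => i _; exact: sqmod_ge0.
elim: r => [|i r IH]; first by rewrite !big_nil normc0 mulr_ge0// sqrtr_ge0.
rewrite !big_cons (le_trans (le_normcD _ _))//.
rewrite -(@ler_pXn2r _ 2) ?nnegrE ?addr_ge0 ?mulr_ge0 ?normc_ge0 ?sqrtr_ge0//.
rewrite [leRHS]exprMn !sqr_sqrtr; last 2 first.
- by rewrite addr_ge0 ?sqmod_ge0.
- by rewrite addr_ge0 ?sqmod_ge0.
rewrite normc_mul.
rewrite -!normcE2 -(sqr_sqrtr (S0 F r)) -(sqr_sqrtr (S0 G r)).
by apply: real_cs; rewrite ?sqrtr_ge0 ?normc_ge0.
Qed.

(** Cauchy-Schwarz in the k contracted letters, for fixed free letters. *)
Lemma tsq_contr p k n f g :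
  tsq (p + n) (contr p k f g) <= tsq (p + k) f * tsq (k + n) g.
Proof.
rewrite /tsq !big_words_cat// mulr_suml big_seq [leRHS]big_seq.
apply: ler_sum => a /size_words ap.
rewrite [X in _ * X]exchange_big mulr_sumr; apply: ler_sum => b _.
rewrite /contr take_size_cat// drop_size_cat//.
rewrite (le_trans (sum_cauchy_schwarz _ _ _))// ler_wpM2r//.
  by apply: sumr_ge0 => z _; exact: sqmod_ge0.
by rewrite (big_words_rev uL k (fun z => sqmod (f (a ++ z)))).
Qed.

End Wick.

(** * The fourth moment estimate on a chaos *)

(* [motzkin lambda m 0] is the m-th moment of the centered free Poisson law of
   rate lambda. In a noncrossing partition without singletons a point opens a
   block (up step, weight lambda), continues the innermost open block (level
   step) or closes it (down step), and h is the number of open blocks. *)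
Fixpoint motzkin (R : realType) (lambda : R) m h : R :=
  if m is m1.+1 then
    (if h is h1.+1 then motzkin lambda m1 h1 + motzkin lambda m1 h else 0) +
    lambda * motzkin lambda m1 h.+1
  else (h == 0)%:R.

Lemma motzkin_gt (R : realType) (lambda : R) m h :
  (m < h)%N -> motzkin lambda m h = 0.
Proof.
elim: m h => [|m IH] [|h] //= mh.
by rewrite !IH ?mulr0 ?addr0// (leq_trans _ (leqnSn _))// ltnW.
Qed.

(** The interface between free Brownian motion and the estimates: centering of all nonempty Wick
    words encodes both freeness and the semicircle law of the letters. *)
Record wick_system (R : realType) (A : tracialWstarProbSpace R) (T : eqType)
    (s : T -> A) (L : seq T) : Prop := WickSystem {
  ws_selfadjoint : forall i, ws_adj (s i) = s i;
  ws_centered : forall w, all (mem L) w -> w != [::] -> nc_state A (wick s w) = 0;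
  ws_uniq : uniq L }.

Section Chaos.
Context {R : realType} {A : tracialWstarProbSpace R} {T : eqType}.
Variables (s : T -> A) (L : seq T) (sL : wick_system s L).
Local Notation phi := (nc_state A).
Local Notation "a ^#" := (ws_adj a) (at level 2, format "a ^#").
Local Notation Re := (@complex.Re R).
Local Notation th := (theta s L).
Local Notation tsq := (tsq L).
Let sJ := ws_selfadjoint sL.
Let sphi := ws_centered sL.
Let uL := ws_uniq sL.

Variables (q : nat) (f : seq T -> R[i]).
Hypothesis fJ : {in words L q, forall w, f (rev w) = (f w)^*}.
Local Notation X := (th q f).

Lemma chaos_selfadjoint : X^# = X.
Proof.
rewrite (theta_adj sJ uL); apply: eq_theta => w /fJ ->.
by rewrite conjcK.
Qed.

Lemma sq_chaos : sq X = tsq q f.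
Proof. exact: (sq_theta sJ sphi uL). Qed.

Lemma n2_theta n g : n2 (th n g) = Num.sqrt (tsq n g).
Proof. by rewrite /n2 (sq_theta sJ sphi uL). Qed.

Lemma theta01 : th 0 (fun=> 1) = 1.
Proof. by rewrite /theta big_seq1 scale1r. Qed.

(* An element with a decomposition into chaoses whose norms add up to c. The
   decomposition has to be carried along because the norm of a product of two
   chaoses is only controlled degree by degree. *)
Inductive graded_bound : A -> R -> Prop :=
| graded_bound0 : graded_bound 0 0
| graded_boundD n g a c : graded_bound a c ->
    graded_bound (th n g + a) (Num.sqrt (tsq n g) + c).

Lemma graded_bound_n2 a c : graded_bound a c -> n2 a <= c.
Proof.
elim=> [|n g {}a {}c _ IH]; first by rewrite n20.
by rewrite (le_trans (n2D _ _))// n2_theta lerD2l.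
Qed.

Lemma graded_bound_add a b c d :
  graded_bound a c -> graded_bound b d -> graded_bound (a + b) (c + d).
Proof.
move=> ha hb; elim: ha => [|n g {}a {}c _ IH]; first by rewrite !add0r.
by rewrite -!addrA; exact: graded_boundD.
Qed.

Lemma graded_bound_sum I (r : seq I) (P : pred I) (d : I -> nat)
    (g : I -> seq T -> R[i]) :
  graded_bound (\sum_(i <- r | P i) th (d i) (g i))
               (\sum_(i <- r | P i) Num.sqrt (tsq (d i) (g i))).
Proof.
elim/big_rec2 : _ => [|i y1 y2 _ h]; first exact: graded_bound0.
exact: graded_boundD.
Qed.

(** The factor q + 1 is the number of possible contraction orders: each of them contributes one
    homogeneous part, bounded by [tsq_contr]. *)
Lemma graded_bound_mul a c : graded_bound a c ->
  exists2 d, graded_bound (X * a) d & d <= q.+1%:R * n2 X * c.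
Proof.
elim=> [|n g {}a {}c _ [d hd dc]].
  by exists 0; rewrite ?mulr0//; exact: graded_bound0.
eexists.
  rewrite mulrDr (theta_mul s uL); apply: graded_bound_add hd.
  exact: graded_bound_sum.
rewrite mulrDr lerD// -mulrA -n2_theta mulr_natl -[X in _ *+ X]card_ord.
rewrite -sumr_const big_mkcond/=; apply: ler_sum => k _.
rewrite !n2_theta; case: ifPn => kn; last by rewrite mulr_ge0// sqrtr_ge0.
rewrite -sqrtrM ?tsq_ge0// ler_wsqrtr// (le_trans (tsq_contr _ _ _ _ _ _))//.
have kq : (k <= q)%N by rewrite -ltnS.
by rewrite subnK// subnKC.
Qed.

(** A Haagerup inequality. Iterating the graded bound from 1 shows that the m-th moment is at most
    the m-th power of the constant, as [opbd_moments] requires. *)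
Lemma chaos_opbd : opbd (q.+1%:R * n2 X) X.
Proof.
have C0 : 0 <= q.+1%:R * n2 X by rewrite mulr_ge0// n2_ge0.
apply: opbd_moments => //; first exact: chaos_selfadjoint.
move=> m; suff [d hd dm] : exists2 d, graded_bound (X ^+ m) d & d <= (q.+1%:R * n2 X) ^+ m.
  by rewrite (le_trans (normc_phi_le _))// (le_trans (graded_bound_n2 hd)).
elim: m => [|m [d hd dm]].
  exists 1 => //; rewrite expr0 -theta01 -[X in graded_bound X]addr0.
  rewrite (_ : 1 = Num.sqrt (tsq 0 (fun=> 1)) + 0).
    by apply: graded_boundD; exact: graded_bound0.
  by rewrite -n2_theta theta01 n21 addr0.
rewrite !exprS; have [e he ed] := graded_bound_mul hd; exists e => //.
by rewrite (le_trans ed)// ler_wpM2l.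
Qed.

Fixpoint fpow h : seq T -> R[i] := if h is h1.+1 then tens q f (fpow h1) else fun=> 1.
Local Notation P h := (th (h * q) (fpow h)).

Lemma n2_fpow h : n2 (P h) = n2 X ^+ h.
Proof.
rewrite !n2_theta; elim: h => [|h IH].
  by rewrite mul0n -n2_theta theta01 n21.
by rewrite mulSn /= tsq_tens// sqrtrM ?tsq_ge0// IH exprS.
Qed.

Local Notation c k := (contr L (q - k) k f f).
Local Notation deg k := (q - k + (q - k))%N.

(* With P h the chaos of the h-th tensor power of f, X P (h + 1) is close to
   P (h + 2) + P (h + 1) + lambda P h when the middle contraction of f with
   itself is close to f, the other partial ones are close to 0, and |f|^2 is
   close to lambda. *)
Definition defect k w : R[i] := c k.+1 w - (if (k.+1 + k.+1 == q)%N then f w else 0).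

Hypotheses (q_gt0 : (0 < q)%N) (q_even : ~~ odd q).

(** For even q > 0 exactly one partial contraction of f with itself has degree q again. *)
Lemma sum_half (V : nmodType) (F : nat -> V) :
  \sum_(k < q.-1) (if (k.+1 + k.+1 == q)%N then F k.+1 else 0) = F q./2.
Proof.
have q2 : (q./2.-1 < q.-1)%N by have := odd_double_half q; lia.
have h2 : (q./2.-1.+1 = q./2)%N by have := odd_double_half q; lia.
rewrite (bigD1 (Ordinal q2))//= big1 => [|k].
  by rewrite addr0 h2 addnn even_halfK// eqxx.
rewrite -val_eqE/= => kq; case: eqP => // E; case/eqP: kq.
by have := odd_double_half q; lia.
Qed.

Lemma big_ord_ends (V : nmodType) (F : nat -> V) :
  \sum_(k < q.+1) F k = F 0%N + \sum_(k < q.-1) F k.+1 + F q.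
Proof.
suff h p : (0 < p)%N ->
  \sum_(k < p.+1) F k = F 0%N + \sum_(k < p.-1) F k.+1 + F p by exact: h.
by case: p => // p _; rewrite big_ord_recr big_ord_recl.
Qed.

(** The term without contraction is the next tensor power, full contraction with the first factor
    leaves |f|^2 times the previous power, and the partial contractions lie between. *)
Lemma chaos_fpowS h : X * P h.+1 =
  P h.+2 + \sum_(k < q.-1) th (deg k.+1 + h * q) (tens (deg k.+1) (c k.+1) (fpow h)) +
  (tsq q f)%:C *: P h.
Proof.
rewrite (theta_mul s uL) (eq_bigl xpredT); last first.
  by move=> k; rewrite mulSn (leq_trans (_ : k <= q)%N) ?leq_addr// -ltnS.
rewrite (big_ord_ends (fun k => th (q - k + (h.+1 * q - k)) (contr L (q - k) k f (fpow h.+1)))).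
rewrite !subn0; congr (_ + _ + _).
- rewrite mulSn; apply: eq_theta => w _.
  by rewrite contr0.
- apply: eq_bigr => k _.
  have kq : (k.+1 <= q)%N by rewrite -[in leqRHS](prednK q_gt0) ltnS ltnW.
  rewrite (_ : (q - k.+1 + (h.+1 * q - k.+1) = deg k.+1 + h * q)%N); last by rewrite mulSn; lia.
  by apply: eq_theta => w _; rewrite /= -contr_tens subnKC.
- rewrite subnn add0n mulSn addKn -thetaZ; apply: eq_theta => w _.
  have -> : fpow h.+1 = tens (q + 0) f (fpow h) by rewrite addn0.
  rewrite contr_tens /tens take0 addn0 drop0; congr (_ * _).
  rewrite /contr [in RHS]/tsq rmorph_sum; apply: eq_big_seq => z zq.
  by rewrite take0 drop0 cats0 cat0s fJ// mulrC mulCJ.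
Qed.

Lemma chaos_fpow0 : X * P 0 = P 1.
Proof.
rewrite theta01 mulr1 mul1n; apply: eq_theta => w /size_words wq.
by rewrite /= /tens mulr1 take_oversize// wq.
Qed.

Lemma fpow_defect lambda h :
  X * P h.+1 - (P h.+2 + P h.+1 + lambda%:C *: P h) =
  \sum_(k < q.-1) th (deg k.+1 + h * q) (tens (deg k.+1) (defect k) (fpow h)) +
  (tsq q f - lambda)%:C *: P h.
Proof.
(* [P h.+1] is written as a sum with the single nonzero term 2k = q, so that it can be subtracted
   termwise from the contractions. *)
have E : P h.+1 = \sum_(k < q.-1) (if (k.+1 + k.+1 == q)%N then
    th (deg k.+1 + h * q) (tens (deg k.+1) f (fpow h)) else 0).
  rewrite (sum_half (fun k => th (deg k + h * q) (tens (deg k) f (fpow h)))).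
  have -> : deg q./2 = q by have := odd_double_half q; lia.
  by rewrite -mulSn.
rewrite chaos_fpowS [in LHS]E rmorphB/= scalerBl.
rewrite (_ : \sum_(k < q.-1) th (deg k.+1 + h * q) (tens (deg k.+1) (defect k) (fpow h)) =
  \sum_(k < q.-1) th (deg k.+1 + h * q) (tens (deg k.+1) (c k.+1) (fpow h)) -
  \sum_(k < q.-1) (if (k.+1 + k.+1 == q)%N then
    th (deg k.+1 + h * q) (tens (deg k.+1) f (fpow h)) else 0)); last first.
  rewrite -sumrB; apply: eq_bigr => k _; rewrite /defect /tens.
  case: eqP => _; rewrite ?subr0; last by apply: eq_theta => w _; rewrite subr0.
  rewrite -scaleN1r -thetaZ -thetaD; apply: eq_theta => w _.
  by rewrite mulN1r mulrBl.
move: (th _ _) (\sum_(k < _) _) (\sum_(k < _) _) (_ *: _) (_ *: _) => x y z t u.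
by rewrite opprD addrACA opprD [x + z + _]addrACA subrr add0r.
Qed.

Lemma chaos_sqr : X * X = \sum_(k < q.+1) th (deg k) (c k).
Proof.
rewrite (theta_mul s uL) (eq_bigl xpredT)// => k.
by rewrite -ltnS ltn_ord.
Qed.

Lemma sq_chaos_sqr :
  sq (X * X) = tsq q f ^+ 2 + \sum_(k < q.-1) tsq (deg k.+1) (c k.+1) + tsq q f ^+ 2.
Proof.
rewrite chaos_sqr (sq_theta_sum sJ sphi uL); last first.
  rewrite map_inj_in_uniq ?index_enum_uniq// => i j _ _ ij; apply: val_inj => /=.
  by have := ltn_ord i; have := ltn_ord j; lia.
rewrite (big_ord_ends (fun k => tsq (deg k) (c k))) !subn0 subnn addn0.
congr (_ + _ + _).
  rewrite (eq_tsq (g := tens q f f)); last by move=> w _; rewrite contr0.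
  by rewrite tsq_tens.
rewrite {1}/tsq big_seq1 -sqmodC; congr sqmod.
rewrite /contr [in RHS]/tsq rmorph_sum; apply: eq_big_seq => z zq.
by rewrite cats0 fJ// mulrC mulCJ.
Qed.

(** Orthogonality of degrees: only the part of [X * X] of degree q pairs with X. *)
Lemma phi_chaos3 : phi (X ^+ 3) =
  \sum_(k < q.-1) (if (k.+1 + k.+1 == q)%N then tdot L q (c k.+1) f else 0).
Proof.
rewrite exprS expr2 -{1}chaos_selfadjoint chaos_sqr mulr_sumr state_sum.
rewrite (big_ord_ends (fun k => phi (X^# * th (deg k) (c k)))).
rewrite !(phi_thetaM sJ sphi uL) subn0 subnn.
have -> : (q == q + q)%N = false by lia.
have -> : (q == 0 + 0)%N = false by lia.
rewrite add0r addr0; apply: eq_bigr => k _; rewrite (phi_thetaM sJ sphi uL).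
have kq : (k.+1 < q)%N by rewrite -[ltnRHS](prednK q_gt0) ltnS.
case: eqVneq => [E|E].
  by rewrite -E; case: eqP => //; lia.
by case: eqP => //; move: E => /eqP; lia.
Qed.

(** The square is expanded at 2k = q. Its cross term is the third moment and its last term is |f|^2,
    while the two extreme contractions in the fourth moment account for 2 |f|^4. *)
Lemma sum_defect : \sum_(k < q.-1) tsq (deg k.+1) (defect k) =
  Re (phi (X ^+ 4)) - 2 * Re (phi (X ^+ 3)) + tsq q f - 2 * tsq q f ^+ 2.
Proof.
have -> : Re (phi (X ^+ 4)) = sq (X * X).
  by rewrite /sq adjM chaos_selfadjoint (exprD X 2 2) -!expr2.
rewrite sq_chaos_sqr phi_chaos3 (big_morph _ (@ReD R) (erefl : Re 0 = 0)).
rewrite -{3}(sum_half (fun=> tsq q f)).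
rewrite mulr_sumr.
transitivity (\sum_(k < q.-1) tsq (deg k.+1) (c k.+1) -
  \sum_(k < q.-1) 2 * Re (if (k.+1 + k.+1 == q)%N then tdot L q (c k.+1) f else 0) +
  \sum_(k < q.-1) (if (k.+1 + k.+1 == q)%N then tsq q f else 0)); last by ring.
rewrite -sumrB -big_split/=; apply: eq_bigr => k _; rewrite /defect.
case: eqP => E; last first.
  rewrite mulr0 subr0 addr0; apply: eq_tsq => w _; exact: subr0.
have -> : deg k.+1 = q by lia.
rewrite /theta /tsq /tdot (big_morph _ (@ReD R) (erefl : Re 0 = 0)) mulr_sumr.
rewrite -sumrB -big_split/=; apply: eq_bigr => w _.
by rewrite /sqmod ReB ImB ReM ReJ ImJ; ring.
Qed.

Lemma phi_fpow h : phi (P h) = (h == 0)%:R.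
Proof.
case: h => [|h]; first by rewrite mul0n theta01 nc_state1.
rewrite /theta state_sum big_seq big1// => w; rewrite mem_words => /andP[/eqP wh wL].
by rewrite stateZ sphi ?mulr0// -size_eq0 wh muln_eq0/= -lt0n.
Qed.

Section Remainder.
Variables (lambda M : R).
Hypothesis XM : n2 X <= M.
Local Notation mz := (motzkin lambda).

Definition defect_size : R :=
  \sum_(k < q.-1) Num.sqrt (tsq (deg k.+1) (defect k)) + `|tsq q f - lambda|.

(** The value that [X ^+ m] would have if every [D h] below were 0: the recursion of [motzkin] is
    then the action of X on the coefficients of the [P h]. *)
Let S m := \sum_(h < m.+1) (mz m h)%:C *: P h.
Let D h := X * P h.+1 - (P h.+2 + P h.+1 + lambda%:C *: P h).

Lemma n2_fpow_defect h : n2 (D h) <= defect_size * M ^+ h.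
Proof.
have M0 : 0 <= M := le_trans (n2_ge0 _) XM.
rewrite /D fpow_defect (le_trans (n2D _ _))// mulrDl lerD//; last first.
  rewrite n2Z n2_fpow normc_real ler_wpM2l// lerXn2r// nnegrE ?n2_ge0//.
rewrite (le_trans (n2_sum _ _ _))// mulr_suml ler_sum// => k _.
rewrite n2_theta tsq_tens// sqrtrM ?tsq_ge0// -[Num.sqrt (tsq (h * q) _)]n2_theta n2_fpow.
by rewrite ler_wpM2l ?sqrtr_ge0// lerXn2r// nnegrE ?n2_ge0.
Qed.

Lemma chaos_motzkin_sum m :
  X * S m = S m.+1 + \sum_(h < m) (mz m h.+1)%:C *: D h.
Proof.
(* The height is at most m, so the shifted sums extend to the ranges that occur in [S m.+1]. *)
have z1 : mz m m.+1 = 0 by rewrite motzkin_gt.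
have z2 : mz m m.+2 = 0 by rewrite motzkin_gt.
have S1 : \sum_(h < m) (mz m h.+1)%:C *: P h.+1 = \sum_(h < m.+1) (mz m h.+1)%:C *: P h.+1.
  by rewrite big_ord_recr/= z1 scale0r addr0.
have S0 : \sum_(h < m) (mz m h.+1)%:C *: P h =
    \sum_(h < m.+2) (mz m h.+1)%:C *: P h.
  by rewrite !big_ord_recr/= z1 z2 !scale0r !addr0.
have -> : \sum_(h < m) (mz m h.+1)%:C *: D h =
    \sum_(h < m) (mz m h.+1)%:C *: (X * P h.+1) -
    (\sum_(h < m) (mz m h.+1)%:C *: P h.+2 + \sum_(h < m) (mz m h.+1)%:C *: P h.+1 +
     lambda%:C *: \sum_(h < m) (mz m h.+1)%:C *: P h).
  rewrite scaler_sumr -!big_split -sumrB/=; apply: eq_bigr => h _.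
  by rewrite /D scalerBr !scalerDr !scalerA [lambda%:C * _]mulrC.
have -> : X * S m = (mz m 0)%:C *: P 1 + \sum_(h < m) (mz m h.+1)%:C *: (X * P h.+1).
  rewrite /S mulr_sumr big_ord_recl -scalerAr chaos_fpow0; congr (_ + _).
  by apply: eq_bigr => h _; rewrite -scalerAr.
rewrite S1 S0; set Y := \sum_(h < m) _ *: (_ * _).
have -> : S m.+1 = ((mz m 0)%:C *: P 1 + \sum_(h < m) (mz m h.+1)%:C *: P h.+2) +
    \sum_(h < m.+1) (mz m h.+1)%:C *: P h.+1 +
    lambda%:C *: \sum_(h < m.+2) (mz m h.+1)%:C *: P h.
  have -> : (mz m 0)%:C *: P 1 + \sum_(h < m) (mz m h.+1)%:C *: P h.+2 =
      \sum_(h < m.+1) (mz m h)%:C *: P h.+1.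
    by rewrite [RHS]big_ord_recl.
  rewrite scaler_sumr -big_split/= [X in _ + X]big_ord_recl/= addrCA -big_split/=.
  rewrite /S big_ord_recl/= add0r rmorphM scalerA; congr (_ + _).
  by apply: eq_bigr => h _; rewrite /= /bump leq0n add1n !rmorphD rmorphM !scalerDl scalerA.
set U := \sum_(h < m) _; set V := \sum_(h < m.+1) _; set W := lambda%:C *: _.
by rewrite -(addrA _ U V) -(addrA _ _ W) -[RHS]addrA [X in _ = _ + X]addrC subrK.
Qed.

(** One more factor X multiplies the old error by its operator bound (q + 1) M and adds new defects.
    The constant depends on f only through the bound M, hence is uniform along a bounded
    sequence. *)
Fixpoint remainder_const m : R := if m is m1.+1 then
    q.+1%:R * M * remainder_const m1 + \sum_(h < m1) `|mz m1 h.+1| * M ^+ h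
  else 0.

Lemma n2_chaos_remainder m : n2 (X ^+ m - S m) <= remainder_const m * defect_size.
Proof.
elim: m => [|m IH].
  rewrite /S big_ord_recl big_ord0 /= addr0 mul0n theta01 scale1r subrr n20.
  by rewrite mul0r.
have E : X ^+ m.+1 - S m.+1 = X * (X ^+ m - S m) + \sum_(h < m) (mz m h.+1)%:C *: D h.
  by rewrite mulrBr -exprS chaos_motzkin_sum opprD addrA subrK.
rewrite E (le_trans (n2D _ _))//= mulrDl lerD//.
  rewrite (le_trans (chaos_opbd.2 _))// -!mulrA ler_wpM2l//.
  by apply: ler_pM; rewrite ?n2_ge0.
rewrite (le_trans (n2_sum _ _ _))// mulr_suml ler_sum// => h _.
rewrite n2Z normc_real -mulrA ler_wpM2l// mulrC; exact: n2_fpow_defect.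
Qed.

Lemma chaos_moment m : normc (phi (X ^+ m) - (mz m 0)%:C) <= remainder_const m * defect_size.
Proof.
rewrite (le_trans _ (n2_chaos_remainder m))// (le_trans _ (normc_phi_le _))//.
rewrite stateB /S state_sum big_ord_recl stateZ phi_fpow mulr1 big1 ?addr0// => h _.
by rewrite stateZ phi_fpow mulr0.
Qed.

End Remainder.

(** The factor q counts the q - 1 partial contractions and the error of |f|^2. *)
Lemma defect_size_le lambda (e : R) : 0 <= e ->
  \sum_(k < q.-1) tsq (deg k.+1) (defect k) <= e ^+ 2 ->
  `|tsq q f - lambda| <= e -> defect_size lambda <= q%:R * e.
Proof.
move=> e0 h1 h2; rewrite /defect_size -(prednK q_gt0) -natr1 mulrDl mul1r /= prednK//.
rewrite lerD// -[X in X%:R]card_ord mulr_natl -sumr_const; apply: ler_sum => k _.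
rewrite -(ger0_norm e0) -sqrtr_sqr ler_wsqrtr// (le_trans _ h1)//.
rewrite (bigD1 k)//= lerDl; apply: sumr_ge0 => i _; exact: tsq_ge0.
Qed.

End Chaos.

(** * Increments of a free Brownian motion *)

Section Semicircle.
Context {R : realType} (t : R) (t_gt0 : 0 < t).
Local Notation mu := (@lebesgue_measure R).
Local Notation e := (2 * Num.sqrt t).
Implicit Types (j m : nat) (x : R).

Let e_gt0 : 0 < e. Proof. by rewrite mulr_gt0// sqrtr_gt0. Qed.

Let e2 : e ^+ 2 = 4 * t.
Proof. by rewrite exprMn sqr_sqrtr ?ltW//; ring. Qed.

(** A multiple of x^j (4t - x^2)^(3/2). It vanishes at both edges, and its derivative [slope j]
    combines the integrands of two moments, which gives the moment recursion. At j = 0 the truncated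
    exponent [j.-1] occurs with the factor 0. *)
Let primitive j x : R := (2 * pi * t)^-1 * (x ^+ j * ((4 * t - x ^+ 2) * Num.sqrt (4 * t - x ^+ 2))).

Let slope j x : R := 4 * t * j%:R * (x ^+ j.-1 * semicircle_density t x) -
  j.+3%:R * (x ^+ j.+1 * semicircle_density t x).

Lemma continuous_sqrt_radicand : continuous (fun x : R => Num.sqrt (4 * t - x ^+ 2)).
Proof.
move=> x; apply: continuous_comp; last exact: sqrt_continuous.
apply: cvgB; first exact: cvg_cst.
exact: exprn_continuous.
Qed.

Lemma continuous_semicircle_power m :
  continuous (fun x => x ^+ m * semicircle_density t x).
Proof.
move=> x; apply: cvgM; first exact: exprn_continuous.
by apply: cvgM; [exact: cvg_cst|exact: continuous_sqrt_radicand].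
Qed.

Let continuous_slope j : continuous (slope j).
Proof.
move=> x; apply: cvgB; apply: cvgM; try exact: cvg_cst;
  exact: continuous_semicircle_power.
Qed.

Let continuous_primitive j : continuous (primitive j).
Proof.
move=> x; apply: cvgM; first exact: cvg_cst.
apply: cvgM; first exact: exprn_continuous.
apply: cvgM; last exact: continuous_sqrt_radicand.
by apply: cvgB; [exact: cvg_cst|exact: exprn_continuous].
Qed.

Let is_derive_primitive j x : x \in `]- e, e[ -> is_derive x 1 (primitive j) (slope j x).
Proof.
rewrite in_itv/= => /andP[ex xe].
have h0 : 0 < 4 * t - x ^+ 2.
  rewrite subr_gt0 -e2 -ltr_sqrt ?exprn_gt0//.
  by rewrite !sqrtr_sqr (gtr0_norm e_gt0) ltr_norml ex.
pose h := fun x : R => 4 * t - x ^+ 2.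
have dh : is_derive x 1 h (- (2 * x)).
  apply: is_derive_eq.
  by rewrite /GRing.scale/=; ring.
have ds : is_derive x 1 (Num.sqrt \o h) ((2 * Num.sqrt (h x))^-1 * - (2 * x)).
  by apply: is_derive1_comp; apply: is_derive1_sqrt.
have dp : is_derive x 1 (fun x : R => x ^+ j) (j%:R * x ^+ j.-1).
  split; first exact: exprn_derivable.
  by rewrite exp_derive /GRing.scale/= mulr1.
have dM := is_deriveZ (2 * pi * t)^-1 (is_deriveM dp (is_deriveM dh ds)).
have -> : primitive j = (2 * pi * t)^-1 \*: ((fun x : R => x ^+ j) * (h * (Num.sqrt \o h))).
  by [].
apply: is_derive_eq dM _; rewrite /slope /semicircle_density/GRing.scale/= -/(h x).
have s0 : Num.sqrt (h x) != 0 by rewrite gt_eqF// sqrtr_gt0.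
have hs : h x = Num.sqrt (h x) ^+ 2 by rewrite sqr_sqrtr// ltW.
change ((h * (Num.sqrt \o h)) x) with (h x * Num.sqrt (h x)).
have h4 : 4 * t = h x + x ^+ 2 by rewrite subrK.
rewrite h4; move: (Num.sqrt (h x)) s0 hs => r r0 ->.
have -> : r ^+ 2 * ((2 * r)^-1 * - (2 * x)) = - (r * x) by field.
move: (2 * pi * t)^-1 => k.
by case: (j) => [|i]; rewrite /= ?exprS ?expr0 -?natr1; ring.
Qed.

Lemma integrable_semicircle_power m :
  mu.-integrable `[- e, e] (EFin \o (fun x => x ^+ m * semicircle_density t x)).
Proof.
apply: continuous_compact_integrable; first exact: segment_compact.
by apply: continuous_subspaceT; exact: continuous_semicircle_power.
Qed.

Lemma semicircle_moment_rec j :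
  4 * t * j%:R * (\int[mu]_(x in `[- e, e]) (x ^+ j.-1 * semicircle_density t x)) =
  j.+3%:R * (\int[mu]_(x in `[- e, e]) (x ^+ j.+1 * semicircle_density t x)).
Proof.
have ee : - e < e by rewrite (lt_trans _ e_gt0)// oppr_lt0.
have ftc : (\int[mu]_(x in `[(- e)%R, e]) (slope j x)%:E =
    (primitive j e)%:E - (primitive j (- e)%R)%:E)%E.
  apply: continuous_FTC2 => //.
  - by apply: continuous_subspaceT; exact: continuous_slope.
  - split=> [x xe||]; first by have D := is_derive_primitive j xe; exact: ex_derive.
    + by apply: cvg_at_right_filter; exact: continuous_primitive.
    + by apply: cvg_at_left_filter; exact: continuous_primitive.
  - move=> x xe; rewrite derive1E.
    by have D := is_derive_primitive j xe; exact: derive_val.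
have z x : x ^+ 2 = 4 * t -> primitive j x = 0.
  by rewrite /primitive => ->; rewrite subrr mul0r !mulr0.
rewrite !z ?sqrrN// sube0 in ftc.
have mI : measurable `[- e, e]%classic by exact: measurable_itv.
have I m := integrable_semicircle_power m.
apply/eqP; rewrite -subr_eq0 -!RintegralZl// -RintegralB//; last 2 first.
- by rewrite (_ : _ \o _ = fun x => ((4 * t * j%:R)%:E * (x ^+ j.-1 * semicircle_density t x)%:E)%E)//;
    apply: integrableZl => //; exact: I.
- by rewrite (_ : _ \o _ = fun x => ((j.+3%:R)%:E * (x ^+ j.+1 * semicircle_density t x)%:E)%E)//;
    apply: integrableZl => //; exact: I.
by rewrite /Rintegral -/(slope j) ftc.
Qed.
End Semicircle.

(** * Commutants and von Neumann subalgebras *)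

Section Operators.
Context {R : realType} {H : hilbertSpace R}.

Lemma bounded_operator_id : bounded_operator (@id H).
Proof. by split=> // x; exact: cvg_id. Qed.

Lemma bounded_operator_comp (T U : H -> H) :
  bounded_operator T -> bounded_operator U -> bounded_operator (T \o U).
Proof.
move=> [lT cT] [lU cU]; split=> [k x y|x] /=; first by rewrite lU lT.
by apply: continuous_comp; [exact: cU|exact: cT].
Qed.

Lemma bounded_operatorP k (T U : H -> H) :
  bounded_operator T -> bounded_operator U ->
  bounded_operator (fun x => k *: T x + U x).
Proof.
move=> [lT cT] [lU cU]; split=> [l x y|x] /=.
  by rewrite lU lT scalerDr !scalerA [k * l]mulrC scalerDr !scalerA addrACA.
by apply: cvgD; [apply: cvgZr; exact: cT|exact: cU].
Qed.

Lemma commutant_id (X : set (H -> H)) : commutant X id.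
Proof. by split; [exact: bounded_operator_id|]. Qed.

Lemma commutant_comp (X : set (H -> H)) T U :
  commutant X T -> commutant X U -> commutant X (T \o U).
Proof.
move=> [bT cT] [bU cU]; split; first exact: bounded_operator_comp.
by move=> V XV x /=; rewrite cU// cT.
Qed.

Lemma commutantP (X : set (H -> H)) k T U : X `<=` bounded_operator ->
  commutant X T -> commutant X U -> commutant X (fun x => k *: T x + U x).
Proof.
move=> bX [bT cT] [bU cU]; split; first exact: bounded_operatorP.
by move=> V XV x; rewrite cU// cT// (bX _ XV).1.
Qed.

End Operators.

Section VonNeumann.
Context {R : realType} {A : tracialWstarProbSpace R} (N : set A).
Hypothesis vN : vonNeumann_subalgebra N.

(** [vonNeumann_subalgebra] states the bicommutant identity and no closure under sums and products.
    These are inherited from the commutant and pulled back along the injective action. *)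
Let bicomm a : N a -> commutant (commutant (ws_act (t := A) @` N)) (ws_act a).
Proof. by move=> Na; rewrite vN.2; exists a. Qed.

Let of_bicomm a : commutant (commutant (ws_act (t := A) @` N)) (ws_act a) -> N a.
Proof. by rewrite vN.2 => -[b Nb /ws_act_inj <-]. Qed.

Lemma vN1 : N 1.
Proof.
apply: of_bicomm; rewrite (_ : ws_act 1 = id); first exact: commutant_id.
by apply/funext => x; exact: ws_act1.
Qed.

Lemma vNM a b : N a -> N b -> N (a * b).
Proof.
move=> /bicomm Na /bicomm Nb; apply: of_bicomm.
rewrite (_ : ws_act _ = ws_act a \o ws_act b); first exact: commutant_comp.
by apply/funext => x; exact: ws_actM.
Qed.

Lemma vNP k a b : N a -> N b -> N (k *: a + b).
Proof.
move=> /bicomm Na /bicomm Nb; apply: of_bicomm.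
rewrite (_ : ws_act _ = fun x => k *: ws_act a x + ws_act b x).
  by apply: commutantP => // T [].
by apply/funext => x; exact: ws_act_lin.
Qed.

Lemma vN0 : N 0.
Proof. by rewrite -(addNr 1) -scaleN1r; apply: vNP; exact: vN1. Qed.

Lemma vNZ k a : N a -> N (k *: a).
Proof. by move=> Na; rewrite -[_ *: _]addr0; apply: vNP => //; exact: vN0. Qed.

Lemma vNB a b : N a -> N b -> N (a - b).
Proof. by move=> Na Nb; rewrite addrC -scaleN1r; exact: vNP. Qed.

Lemma vN_wick (T : eqType) (s : T -> A) w :
  {in w, forall i, N (s i)} -> N (wick s w).
Proof.
have [m wm] := ubnP (size w); elim: m w wm => // m IH [|i [|j w]] wm h.
- exact: vN1.
- by rewrite wick1; apply: h; rewrite mem_head.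
rewrite wick_cons2; apply: vNB.
  apply: vNM; first by apply: h; rewrite mem_head.
  by apply: IH => // k kw; apply: h; rewrite inE kw orbT.
case: ifP => _; last exact: vN0.
apply: IH; first by rewrite -ltnS ltnW.
by move=> k kw; apply: h; rewrite !inE kw !orbT.
Qed.

End VonNeumann.

(** * Chebyshev polynomials of a semicircular element *)

Section HornerAlg.
Context {F : comNzRingType} {B : algType F} (a : B).
Implicit Types p r : {poly F}.

Lemma horner_algM p r : horner_alg a (p * r) = horner_alg a p * horner_alg a r.
Proof. exact: rmorphM. Qed.
Lemma horner_algB p r : horner_alg a (p - r) = horner_alg a p - horner_alg a r.
Proof. exact: rmorphB. Qed.
Lemma horner_algZ k p : horner_alg a (k *: p) = k *: horner_alg a p.
Proof. by rewrite -mul_polyC horner_algM horner_algC mulr_algl. Qed.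
Lemma horner_alg_Xn n : horner_alg a 'X^n = a ^+ n.
Proof. by elim: n => [|n IH]; rewrite ?rmorph1// !exprS horner_algM horner_algX IH. Qed.

End HornerAlg.

Section Chebyshev.
Context {R : realType} {A : tracialWstarProbSpace R} (v : R) (b : A).
Hypotheses (v_gt0 : 0 < v) (b_law : semicircular v b).
Variables (T : eqType) (s : T -> A) (i : T).
Hypothesis sE : s i = ((Num.sqrt v)^-1)%:C *: b.
Local Notation phi := (nc_state A).

Lemma semicircular_moment_rec j :
  j.+3%:R * phi (s i ^+ j.+1) = 4 * j%:R * phi (s i ^+ j.-1).
Proof.
have c0 : Num.sqrt v != 0 by rewrite gt_eqF// sqrtr_gt0.
set c := (Num.sqrt v)^-1.
have cv : c ^+ 2 * v = 1 by rewrite /c exprVn sqr_sqrtr ?ltW// mulVf// gt_eqF.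
rewrite sE !exprZn !stateZ !b_law -/c.
set I1 := (\int[_]_(x in _) _); set I2 := (\int[_]_(x in _) _).
have E : 4 * v * j%:R * I2 = j.+3%:R * I1 := semicircle_moment_rec v_gt0 j.
rewrite -!rmorphXn -!rmorphM/= -!(rmorph_nat (real_complex R)) -!rmorphM/=.
congr (_%:C); rewrite mulrCA -E.
case: (j) => [|k]; first by rewrite !(mulr0, mul0r).
rewrite -[in c ^+ _.+2]addn2 exprD.
have -> : c ^+ k * c ^+ 2 * (4 * v * k.+1%:R * I2) =
   (c ^+ 2 * v) * (4 * k.+1%:R * (c ^+ k * I2)) by ring.
by rewrite cv mul1r; congr (_ * _); exact/esym/natrM.
Qed.

(** The Chebyshev polynomials of the second kind U_n(X / 2), orthogonal for the semicircle law of
    variance 1. *)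
Fixpoint chebyshev n : {poly R[i]} :=
  if n is n1.+1 then 'X * chebyshev n1 - (if n1 is n2.+1 then chebyshev n2 else 0)
  else 1.

Lemma chebyshevSS n : chebyshev n.+2 = 'X * chebyshev n.+1 - chebyshev n.
Proof. by []. Qed.

Lemma chebyshev_wick n : wick s (nseq n i) = horner_alg (s i) (chebyshev n).
Proof.
have [m] := ubnP n; elim: m n => // m IH [|[|n]] nm.
- by rewrite rmorph1.
- by rewrite wick1 /= subr0 mulr1 horner_algX.
rewrite -[nseq n.+2 i]/[:: i, i & nseq n i] wick_cons2 eqxx.
by rewrite chebyshevSS horner_algB horner_algM horner_algX -(IH n.+1 nm) -(IH n (ltnW nm)).
Qed.

(** It eliminates the derivative when [phi_stein] is applied to a Chebyshev polynomial. *)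
Lemma chebyshev_deriv n : (4%:R - 'X ^+ 2) * (chebyshev n)^`() =
  n.+2%:R * 'X * chebyshev n - 2%:R * n.+1%:R * chebyshev n.+1.
Proof.
have [m] := ubnP n; elim: m n => // m IH [|[|n]] nm.
- by rewrite /= derivC; ring.
- by rewrite /= subr0 mulr1 derivX; ring.
have hb := IH n.+1 nm; have ha := IH n (ltnW nm).
rewrite [in LHS]chebyshevSS derivB derivM derivX mul1r.
rewrite (_ : _ * _ = (4%:R - 'X ^+ 2) * chebyshev n.+1 +
  'X * ((4%:R - 'X ^+ 2) * (chebyshev n.+1)^`()) -
  (4%:R - 'X ^+ 2) * (chebyshev n)^`()); last by ring.
rewrite hb ha [chebyshev n.+3]chebyshevSS !chebyshevSS.
move: (chebyshev n.+1) (chebyshev n) => x y; ring.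
Qed.

(* With 4 - X^2 as weight, Stein's identity of the semicircle law only involves
   polynomial test functions. It yields phi of Chebyshev polynomials through
   their differential equation. *)
Lemma phi_stein (p : {poly R[i]}) :
  phi (horner_alg (s i) ((4%:R - 'X ^+ 2) * p^`() - 3%:R * 'X * p)) = 0.
Proof.
have lin I (r : seq I) (F : I -> {poly R[i]}) : phi (horner_alg (s i) (\sum_(k <- r) F k)) =
    \sum_(k <- r) phi (horner_alg (s i) (F k)).
  by rewrite raddf_sum state_sum.
rewrite -[p]coefK poly_def raddf_sum/= !mulr_sumr -sumrB lin big1// => j _; move: (p`_j) (nat_of_ord j) => c k.
rewrite derivZ derivXn -!scalerAr -scalerBr horner_algZ stateZ.
rewrite (_ : _ - _ = (4 * k%:R) *: 'X^(k.-1) - k.+3%:R *: 'X^(k.+1)); last first.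
  rewrite -!mul_polyC !rmorphM !rmorph_nat.
  by case: k => [|k]; rewrite ?mulr0n /= ?exprS; ring.
rewrite horner_algB !horner_algZ !horner_alg_Xn stateB !stateZ.
by rewrite -semicircular_moment_rec subrr mulr0.
Qed.

Lemma phi_chebyshev n : phi (wick s (nseq n.+1 i)) = 0.
Proof.
(* The factor [k.-1] is 0 for k = 0 and for k = 1, which starts the induction in both parities. *)
have E k : k.+3%:R * phi (wick s (nseq k.+1 i)) =
    k.-1%:R * phi (wick s (nseq k.-1 i)).
  have := phi_stein (chebyshev k); rewrite chebyshev_deriv.
  rewrite !chebyshev_wick; case: k => [|k].
    rewrite (_ : _ - _ = (- 3%:R) *: chebyshev 1); last first.
      by rewrite -mul_polyC rmorphN rmorph_nat /=; ring.
    by rewrite horner_algZ stateZ mul0r mulNr => /eqP; rewrite oppr_eq0 => /eqP.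
  rewrite (_ : _ - _ = k%:R *: chebyshev k - k.+4%:R *: chebyshev k.+2); last first.
    rewrite -!mul_polyC !rmorph_nat chebyshevSS.
    by move: (chebyshev k.+1) (chebyshev k) => x y; ring.
  by rewrite horner_algB !horner_algZ stateB !stateZ => /eqP; rewrite subr_eq0 => /eqP.
have nz k : k.+3%:R != 0 :> R[i] by rewrite pnatr_eq0.
have [m nm] := ubnP n; elim: m n nm => // m IH [|[|n]] nm.
- by apply: (mulfI (nz 0%N)); rewrite E mul0r mulr0.
- by apply: (mulfI (nz 1%N)); rewrite E mul0r mulr0.
by apply: (mulfI (nz n.+2)); rewrite E IH ?mulr0// -ltnS ltnW.
Qed.

Lemma wick_unital_subalgebra n : unital_subalgebra_of b (wick s (nseq n i)).
Proof.
have [m nm] := ubnP n; elim: m n nm => // m IH [|[|n]] nm.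
- by exists 1 => //; rewrite rmorph1.
- exists (((Num.sqrt v)^-1)%:C *: 'X) => //.
  by rewrite horner_algZ horner_algX wick1 sE.
have [p _ pE] := IH n.+1 nm; have [r _ rE] := IH n (ltnW nm).
exists ((((Num.sqrt v)^-1)%:C *: 'X) * p - r) => //.
rewrite horner_algB horner_algM horner_algZ horner_algX -sE pE rE.
by rewrite -[nseq n.+2 i]/[:: i, i & nseq n i] wick_cons2 eqxx.
Qed.

End Chebyshev.

(** * Alternating decomposition of words *)

Section Runs.
Context {T : eqType} (p : pred T).
Implicit Types (w : seq T) (r : seq (bool * seq T)).

(** Freeness speaks of alternating products only, so a word is cut into maximal pieces on which p is
    constant. *)
Fixpoint runs w : seq (bool * seq T) :=
  if w is i :: w1 then
    if runs w1 is (b, u) :: r then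
      if p i == b then (b, i :: u) :: r else (p i, [:: i]) :: (b, u) :: r
    else [:: (p i, [:: i])]
  else [::].

Definition run_ok (x : bool * seq T) := (x.2 != [::]) && all (fun i => p i == x.1) x.2.

Lemma flatten_runs w : flatten [seq x.2 | x <- runs w] = w.
Proof.
elim: w => //= i w; case: (runs w) => [|[b u] r] /= IH; first by rewrite -IH.
by case: eqP => _ /=; rewrite IH.
Qed.

Lemma runs_ok w : all run_ok (runs w).
Proof.
elim: w => //= i w; case: (runs w) => [|[b u] r] /=.
  by rewrite /run_ok /= eqxx.
move=> /andP[/andP[/= u0 ub] rok]; case: eqP => [pib|_] /=; rewrite /run_ok/= rok ub.
  by rewrite pib eqxx.
by rewrite u0 eqxx.
Qed.

Lemma runs_sorted w : sorted (fun x y => x.1 != y.1) (runs w).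
Proof.
elim: w => //= i w; case: (runs w) => [|[b u] r] //=.
case: eqP => [pib|/eqP pib] /=; last by rewrite pib.
by case: r.
Qed.

Lemma runs_nil w : (runs w == [::]) = (w == [::]).
Proof.
by case: w => //= i w; case: (runs w) => [|[b u] r] //; case: ifP.
Qed.

End Runs.

Section WickCat.
Context {R : realType} {A : tracialWstarProbSpace R} {T : eqType} (s : T -> A).

(** At a boundary between runs exactly one of the two letters satisfies p, so they differ and
    nothing contracts. *)
Lemma wick_flatten (p : pred T) (r : seq (bool * seq T)) :
  all (run_ok p) r -> sorted (fun x y => x.1 != y.1) r ->
  wick s (flatten [seq x.2 | x <- r]) = \prod_(x <- r) wick s x.2.
Proof.
elim: r => [|x [|y r] IH]; first by rewrite big_nil.
  by rewrite big_seq1 /= cats0.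
move=> /= /andP[xok yok] /andP[xy rs]; rewrite big_cons -IH//=.
case/andP: xok => x0 xp; case/andP: yok => /andP[y0 yp] _.
case: y yp y0 xy {IH rs} => b [|j y] // /andP[/eqP pj _] _ xy /=.
case: (lastP x.2) x0 xp => // u i _; rewrite all_rcons => /andP[/eqP pi _].
rewrite wick_glue ifF ?addr0 ?cat_rcons//.
by apply/negbTE; apply: contra xy => /eqP ij; rewrite -pi ij pj.
Qed.

End WickCat.

Section Increments.
Context {R : realType} {A : tracialWstarProbSpace R}.
Variables (F : R -> set A) (S : R -> A) (hS : free_brownian_motion F S).
Variable (t : nat -> R).
Hypotheses (t_ge0 : 0 <= t 0) (t_lt : forall i, t i < t i.+1).
Local Notation phi := (nc_state A).

Definition increment i : A :=
  ((Num.sqrt (t i.+1 - t i))^-1)%:C *: (S (t i.+1) - S (t i)).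

Lemma grid_lt i j : (i < j)%N -> t i < t j.
Proof. exact: (homo_ltn lt_trans t_lt). Qed.

Let t0 i : 0 <= t i.
Proof.
by rewrite (le_trans t_ge0)//; case: i => // i; rewrite ltW// grid_lt.
Qed.

Lemma increment_selfadjoint i : ws_adj (increment i) = increment i.
Proof.
by rewrite adjZ adjB !(fbm_selfadjoint hS)//; congr (_ *: _); exact: conjc_real.
Qed.

Lemma increment_law i : semicircular (t i.+1 - t i) (S (t i.+1) - S (t i)).
Proof.
(* An increment that starts at time 0 is governed by [fbm_law] and [fbm0]. *)
have [ti|ti] := eqVneq (t i) 0.
  rewrite ti (fbm0 hS) !subr0; apply: (fbm_law hS).
  by rewrite -ti.
by apply: (fbm_increment_law hS) => //; rewrite lt_neqAle eq_sym ti t0.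
Qed.

Lemma increment_in i k : (i < k)%N -> F (t k) (increment i).
Proof.
move=> ik; have vN := fbm_vN hS (t0 k).
have St j : (j <= k)%N -> F (t k) (S (t j)).
  move=> jk; apply: (fbm_filtration hS (t0 j)); last exact: (fbm_adapted hS).
  by move: jk; rewrite leq_eqVlt => /predU1P[->//|jk]; rewrite ltW// grid_lt.
by apply: (vNZ vN); apply: (vNB vN); apply: St => //; exact: ltnW.
Qed.

Lemma phi_wick_top i n : phi (wick increment (nseq n.+1 i)) = 0.
Proof.
apply: (@phi_chebyshev _ _ (t i.+1 - t i) (S (t i.+1) - S (t i))) => //.
  by rewrite subr_gt0.
exact: increment_law.
Qed.

(** Induction on a bound for the letters. The runs of the top letter k are Chebyshev polynomials in
    the latest increment, the other runs lie in [F (t k)] and are centered by induction, and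
    freeness applies to the alternating product. *)
Lemma phi_wick_increment w : w != [::] -> phi (wick increment w) = 0.
Proof.
have [k wk] : exists k, all (fun i => i < k)%N w.
  exists (\max_(i <- w) i).+1; apply/allP => i iw; rewrite ltnS.
  by rewrite (big_rem i)//= leq_maxl.
elim: k w wk => [|k IH] w wk w0.
  by case: w wk w0 => //= i w; rewrite ltn0.
have [wall|wn] := boolP (all (pred1 k) w).
  by move: w0; rewrite (all_pred1P _ _ wall); case: (size w) => // n _; exact: phi_wick_top.
(* [fbm_increment_free] requires a positive starting time; for k = 0 the word would repeat the
   single letter 0. *)
have k0 : (0 < k)%N.
  case: k wk wn {IH} => // wk /negP[]; apply: sub_all wk => i /=.
  by rewrite ltnS leqn0.
rewrite -(flatten_runs (pred1 k) w) (wick_flatten _ (runs_ok _ _) (runs_sorted _ _)).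
rewrite -(big_map (fun x : bool * seq nat => (x.1, wick increment x.2)) xpredT (fun x : bool * A => x.2)).
apply: (fbm_increment_free hS (s := t k) (t := t k.+1)) => //.
- by rewrite (le_lt_trans t_ge0)// grid_lt.
- by rewrite -size_eq0 size_map size_eq0 runs_nil.
- by rewrite sorted_map; exact: runs_sorted.
move=> _ /mapP[[b u] bu ->] /=.
have /allP/(_ _ bu)/andP[/= u0 ub] := runs_ok (pred1 k) w.
have uw i : i \in u -> i \in w.
  move=> iu; rewrite -(flatten_runs (pred1 k) w); apply/flattenP; exists u => //.
  by apply/mapP; exists (b, u).
case: b ub {bu} => ub.
  have /all_pred1P -> : all (pred1 k) u by apply: sub_all ub => i; rewrite eqb_id.
  split; last first.
    by move: u0; rewrite -size_eq0; case: (size u) => // n _; exact: phi_wick_top.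
  exact: wick_unital_subalgebra.
have uk : all (fun i => i < k)%N u.
  apply/allP => i iu; have := allP wk _ (uw _ iu); have := allP ub _ iu.
  by rewrite eqbF_neg ltnS leq_eqVlt /= => /negbTE ->.
split; last exact: IH.
apply: (vN_wick (fbm_vN hS (t0 k))) => i iu; apply: increment_in.
exact: (allP uk).
Qed.

Lemma wick_system_increment N : wick_system increment (iota 0 N).
Proof.
split; [exact: increment_selfadjoint|by move=> w _; exact: phi_wick_increment|].
exact: iota_uniq.
Qed.

End Increments.

(** * The multiple integral *)

Section Grid.
Context {R : realType}.
Implicit Types (t : nat -> R) (x y : R * R) (u v : seq (R * R)) (w : seq nat).

Lemma exists_grid (pts : seq R) : {in pts, forall a, 0 <= a} ->
  exists (t : nat -> R) (N : nat), [/\ 0 <= t 0, forall i, t i < t i.+1 &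
    {in pts, forall a, exists2 i, (i <= N)%N & t i = a}].
Proof.
move=> pts0; pose ts := sort <=%R (undup (0 :: pts)).
have ts_lt : sorted <%R ts by rewrite sort_lt_sorted undup_uniq.
have ts_mem a : (a \in ts) = (a \in 0 :: pts) by rewrite mem_sort mem_undup.
(* Past the last point the grid continues with unit steps, which makes [t] strictly increasing on
   all of nat. *)
pose t i := if (i < size ts)%N then nth 0 ts i else last 0 ts + (i - (size ts).-1)%:R.
exists t, (size ts); split.
- rewrite /t; case: ifP => [h|]; last first.
    have : 0 \in ts by rewrite ts_mem mem_head.
    by case: (ts).
  have := mem_nth 0 h; rewrite ts_mem inE => /predU1P[->//|]; exact: pts0.
- move=> i; rewrite /t; case: (ltnP i.+1 (size ts)) => [h|h].
    by rewrite ltnW//; exact: (sortedP 0 ts_lt).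
  case: ltnP => [h'|h'].
    have -> : i = (size ts).-1 by lia.
    by rewrite nth_last ltrDl ltr0n; lia.
  by rewrite ltrD2l ltr_nat; lia.
- move=> a ain; have ats : a \in ts by rewrite ts_mem inE ain orbT.
  exists (index a ts); first exact: index_size.
  by rewrite /t index_mem ats nth_index.
Qed.

Section FixedGrid.
Variables (t : nat -> R) (N : nat).
Hypotheses (t_ge0 : 0 <= t 0) (t_lt : forall i, t i < t i.+1).
Local Notation L := (iota 0 N).

Lemma grid_le_mono : {mono t : i j / (i <= j)%N >-> i <= j}.
Proof. by apply: le_mono => i j; exact: (grid_lt t_lt). Qed.

Lemma grid_telescope (V : zmodType) (G : nat -> V) j k : (k <= N)%N ->
  \sum_(i <- L) (if (t j <= t i) && (t i.+1 <= t k) then G i.+1 - G i else 0) =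
  if (j < k)%N then G k - G j else 0.
Proof.
move=> kN; rewrite -{1}[N]subn0 -/(index_iota 0 N).
under eq_bigr => i _ do rewrite !grid_le_mono.
case: ltnP => jk; last first.
  by rewrite big1// => i _; case: ifP => //; lia.
rewrite (@big_cat_nat _ _ _ j)/= ?(leq_trans (ltnW jk))//.
rewrite (@big_cat_nat _ _ _ k j N)/= ?(ltnW jk)//.
rewrite big_nat_cond big1 ?add0r; last first.
  by move=> i /andP[/andP[_ ij] _]; case: ifP => //; lia.
rewrite [X in _ + X]big_nat_cond [X in _ + X]big1 ?addr0; last first.
  by move=> i /andP[/andP[ki _] _]; case: ifP => //; lia.
rewrite -(telescope_sumr _ (ltnW jk)) !big_nat; apply: eq_bigr => i /andP[ji ik].
by rewrite ji ik.
Qed.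

Definition on_grid x := exists j k, [/\ (j < k)%N, (k <= N)%N, x.1 = t j & x.2 = t k].

(** The coordinate of the indicator of x along the normalized indicator of the i-th cell, hence the
    square root. *)
Definition cell_coef x i : R :=
  if (x.1 <= t i) && (t i.+1 <= x.2) then Num.sqrt (t i.+1 - t i) else 0.

Fixpoint box_coef u w : R :=
  match u, w with
  | x :: u1, i :: w1 => cell_coef x i * box_coef u1 w1
  | [::], [::] => 1
  | _, _ => 0
  end.

Lemma cell_coef_neq0 x i : cell_coef x i != 0 -> (x.1 <= t i) && (t i.+1 <= x.2).
Proof. by rewrite /cell_coef; case: ifP => //; rewrite eqxx. Qed.

Lemma box_coefE u w x0 i0 : size w = size u ->
  box_coef u w = \prod_(j < size u) cell_coef (nth x0 u j) (nth i0 w j).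
Proof.
elim: u w => [|x u IH] [|i w] //=; first by rewrite big_ord0.
by move=> [wu]; rewrite big_ord_recl IH.
Qed.

(** A repeated letter would put the midpoint of its cell into two of the disjoint intervals. *)
Lemma box_coef_uniq q (u : q.-tuple (R * R)) w : size w = q ->
  trivIset setT (fun j => `](tnth u j).1, (tnth u j).2[%classic) ->
  box_coef u w != 0 -> uniq w.
Proof.
move=> wq tu; rewrite (box_coefE (0, 0) 0%N) ?size_tuple//.
rewrite prodf_seq_neq0 => /allP h; apply/(uniqP 0%N) => j k; rewrite !inE wq => jq kq E.
have mid l (lq : (l < q)%N) :
    ((t (nth 0%N w l) + t (nth 0%N w l).+1) / 2) \in `](tnth u (Ordinal lq)).1, (tnth u (Ordinal lq)).2[.
  have := h (Ordinal lq) (mem_index_enum _); rewrite /= => /cell_coef_neq0/andP[h1 h2].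
  rewrite !(tnth_nth (0, 0)) in_itv/=.
  have tl := t_lt (nth 0%N w l); apply/andP; split; lra.
suff /(congr1 val) : Ordinal jq = Ordinal kq by [].
apply: tu => //; exists ((t (nth 0%N w j) + t (nth 0%N w j).+1) / 2); split; first exact: mid.
by rewrite E; exact: mid.
Qed.

Definition overlap x y : R := Num.max 0 (Num.min x.2 y.2 - Num.max x.1 y.1).

Lemma sum_cell_coef x y : on_grid x -> on_grid y ->
  \sum_(i <- L) cell_coef x i * cell_coef y i = overlap x y.
Proof.
move=> [j [k [jk kN x1 x2]]] [l [m [lm mN y1 y2]]].
have tmax a b : Num.max (t a) (t b) = t (maxn a b).
  case: (leqP a b) => ab; first by rewrite max_r// grid_le_mono.
  by rewrite max_l// grid_le_mono ltnW.
have tmin a b : Num.min (t a) (t b) = t (minn a b).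
  case: (leqP a b) => ab; first by rewrite min_l// grid_le_mono.
  by rewrite min_r// grid_le_mono ltnW.
rewrite /overlap x1 x2 y1 y2 tmax tmin.
transitivity (\sum_(i <- L) (if (t (maxn j l) <= t i) && (t i.+1 <= t (minn k m))
    then t i.+1 - t i else 0)).
  apply: eq_bigr => i _; rewrite /cell_coef x1 x2 y1 y2 -tmax -tmin ge_max le_min.
  have ti : 0 <= t i.+1 - t i by rewrite subr_ge0 ltW.
  case: (t j <= t i); case: (t i.+1 <= t k); case: (t l <= t i); case: (t i.+1 <= t m);
    rewrite /= ?mulr0 ?mul0r//.
  by rewrite -expr2 sqr_sqrtr.
rewrite (grid_telescope t); last by rewrite geq_min kN.
case: ltnP => h; first by rewrite max_r// subr_ge0 grid_le_mono ltnW.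
by rewrite max_l// subr_le0 grid_le_mono.
Qed.

Lemma sum_box_coef q (u v : q.-tuple (R * R)) :
  (forall j, on_grid (tnth u j)) -> (forall j, on_grid (tnth v j)) ->
  \sum_(w <- words L q) box_coef u w * box_coef v w =
  \prod_(j < q) overlap (tnth u j) (tnth v j).
Proof.
elim: q u v => [|q IH] u v hu hv.
  by rewrite big_ord0 /= big_seq1 (tuple0 u) (tuple0 v) /= mulr1.
case/tupleP: u hu => x u hu; case/tupleP: v hv => y v hv.
rewrite /= big_allpairs_dep/= big_ord_recl !tnth0.
rewrite -sum_cell_coef; [|by have := hu ord0; rewrite tnth0|by have := hv ord0; rewrite tnth0].
rewrite mulr_suml; apply: eq_bigr => i _.
under eq_bigr => w _ do rewrite mulrACA.
rewrite -mulr_sumr IH; last 2 first.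
- by move=> j; have := hu (lift ord0 j); rewrite tnthS.
- by move=> j; have := hv (lift ord0 j); rewrite tnthS.
by congr (_ * _); apply: eq_bigr => j _; rewrite !tnthS.
Qed.

End FixedGrid.
End Grid.

(** * Step functions on a common grid *)

Section StepGrid.
Context {R : realType} {A : tracialWstarProbSpace R}.
Variables (F : R -> set A) (S : R -> A) (hS : free_brownian_motion F S).
Implicit Types (x y : R * R).

Section FixedGrid.
Variables (t : nat -> R) (N : nat).
Hypotheses (t_ge0 : 0 <= t 0) (t_lt : forall i, t i < t i.+1).
Local Notation L := (iota 0 N).
Local Notation inc := (increment S t).

Lemma interval_expand x : on_grid t N x ->
  S x.2 - S x.1 = \sum_(i <- L) (cell_coef t x i)%:C *: inc i.
Proof.
move=> [j [k [jk kN x1 x2]]]; rewrite x1 x2.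
have := grid_telescope t_ge0 t_lt (fun i => S (t i)) j kN; rewrite jk => <-.
apply: eq_bigr => i _; rewrite /cell_coef x1 x2; case: ifP => _; last by rewrite scale0r.
rewrite /increment scalerA -rmorphM/= divff ?scale1r//.
by rewrite gt_eqF// sqrtr_gt0 subr_gt0.
Qed.

Lemma box_expand (u : seq (R * R)) : {in u, forall x, on_grid t N x} ->
  \prod_(x <- u) (S x.2 - S x.1) =
  \sum_(w <- words L (size u)) (box_coef t u w)%:C *: \prod_(i <- w) inc i.
Proof.
elim: u => [|x u IH] hu; first by rewrite big_nil /= big_seq1 big_nil scale1r.
rewrite big_cons IH; last by move=> y yu; apply: hu; rewrite inE yu orbT.
rewrite (interval_expand (hu _ (mem_head _ _))) /= big_allpairs_dep/= mulr_suml.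
apply: eq_bigr => i _; rewrite mulr_sumr; apply: eq_bigr => w _.
by rewrite big_cons -scalerAl -scalerAr scalerA rmorphM.
Qed.

End FixedGrid.

Definition step_coef (t : nat -> R) q (s : seq (R[i] * q.-tuple (R * R))) (w : seq nat) : R[i] :=
  \sum_(u <- s) u.1 * (box_coef t u.2 w)%:C.

(** The grid refines all endpoints. The last clause no longer mentions the grid, and
    [L2norm2_step_fun] reaches the same expression by integration; the isometry follows by comparing
    the two. *)
Lemma step_integral_grid q (s : seq (R[i] * q.-tuple (R * R))) : off_diagonal_step s ->
  exists (t : nat -> R) (N : nat), [/\ 0 <= t 0, forall i, t i < t i.+1,
    step_integral S s = theta (increment S t) (iota 0 N) q (step_coef t s) &
    (tsq (iota 0 N) q (step_coef t s))%:C = \sum_(u <- s) \sum_(v <- s)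
       u.1 * v.1^* * (\prod_(j < q) overlap (tnth u.2 j) (tnth v.2 j))%:C].
Proof.
move=> hs.
pose pts := flatten (map (fun u : R[i] * q.-tuple (R * R) =>
  flatten [seq [:: x.1; x.2] | x <- u.2]) s).
have ptsP u j : u \in s -> (tnth u.2 j).1 \in pts /\ (tnth u.2 j).2 \in pts.
  move=> us.
  have mp a : a \in [:: (tnth u.2 j).1; (tnth u.2 j).2] -> a \in pts.
    move=> ha; apply/flattenP; eexists; first by apply/mapP; exists u.
    apply/flattenP; exists [:: (tnth u.2 j).1; (tnth u.2 j).2] => //.
    by apply/mapP; exists (tnth u.2 j) => //; exact: mem_tnth.
  by split; apply: mp; rewrite !inE eqxx ?orbT.
have pts0 : {in pts, forall a, 0 <= a}.
  move=> a /flattenP[_ /mapP[u us ->]] /flattenP[_ /mapP[x xu ->]].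
  have /tnthP[j xE] := xu; have /andP[h1 h2] := (hs u us).1 j.
  by rewrite !inE xE => /orP[] /eqP -> //; rewrite (le_trans h1)// ltW.
have [t [N [t0 tlt tP]]] := exists_grid pts0.
have og u j : u \in s -> on_grid t N (tnth u.2 j).
  move=> us; have [p1 p2] := ptsP u j us.
  have [k kN tk] := tP _ p1; have [l lN tl] := tP _ p2.
  exists k, l; split=> //; have /andP[_] := (hs u us).1 j.
  by rewrite -tk -tl ltNge grid_le_mono// -ltnNge.
exists t, N; split=> //.
- rewrite /step_integral /theta /step_coef.
  under [RHS]eq_bigr => w _ do rewrite scaler_suml.
  rewrite exchange_big; apply: eq_big_seq => u us.
  rewrite -(big_tuple _ _ u.2 xpredT (fun x => S x.2 - S x.1)) (@box_expand t N)//; last first.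
    by move=> x /tnthP[j ->]; exact: og.
  rewrite size_tuple scaler_sumr; apply: eq_big_seq => w /size_words wq.
  (* A word with nonzero coefficient has distinct letters, so its product of increments is a Wick
     word. *)
  rewrite scalerA; have [->|nz] := eqVneq (box_coef t u.2 w) 0.
    by rewrite mulr0 !scale0r.
  by rewrite wick_prod// (box_coef_uniq tlt wq (hs u us).2 nz).
rewrite /tsq rmorph_sum/=.
rewrite (eq_bigr (fun w => \sum_(u <- s) \sum_(v <- s)
    u.1 * (box_coef t u.2 w)%:C * (v.1 * (box_coef t v.2 w)%:C)^*)); last first.
  move=> w _; rewrite -mulCJ /step_coef rmorph_sum mulr_suml.
  by apply: eq_bigr => u _; rewrite mulr_sumr.
rewrite exchange_big; apply: eq_big_seq => u us.
rewrite exchange_big; apply: eq_big_seq => v vs.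
rewrite -(sum_box_coef t0 tlt (fun j => og u j us) (fun j => og v j vs)).
rewrite rmorph_sum mulr_sumr; apply: eq_bigr => w _.
move: (box_coef t u.2 w) (box_coef t v.2 w) => a b.
transitivity (u.1 * a%:C * (v.1^* * b%:C)).
  congr (_ * _); rewrite rmorphM; congr (_ * _); exact: conjc_real.
by rewrite mulrACA; congr (_ * _); exact/esym/rmorphM.
Qed.

End StepGrid.

(** * Lebesgue measure of boxes and norms of step functions *)

Section Boxes.
Context {R : realType}.
Local Notation Rn q := (q.-tuple (measurableTypeR R)).
Local Notation mu q := (@lebesgue_tuple R q).

Definition box q (E : 'I_q -> set R) : set (Rn q) := [set t | forall i, E i (tnth t i)].

Lemma measurable_box q (E : 'I_q -> set (measurableTypeR R)) :
  (forall i, measurable (E i)) -> measurable (box E).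
Proof.
move=> mE; rewrite (_ : box E = \bigcap_(i in [set: 'I_q]) ((fun t => tnth t i) @^-1` E i)).
  apply: fin_bigcap_measurable => // i _.
  by rewrite -[X in measurable X]setTI; exact: measurable_tnth.
by apply/seteqP; split=> [t h i _|t h i]; [exact: h|exact: (h i)].
Qed.

Lemma measurable_orthant q : measurable (@orthant R q).
Proof.
have -> : @orthant R q = box (fun=> `[0, +oo[%classic).
  by apply/seteqP; split=> t h i; have := h i; rewrite /= in_itv/= andbT.
by apply: measurable_box => i; exact: measurable_itv.
Qed.

Lemma setI_box q (E F : 'I_q -> set R) : box E `&` box F = box (fun i => E i `&` F i).
Proof.
apply/seteqP; split=> [t [h1 h2] i|t h]; first by split; [exact: h1|exact: h2].
by split=> i; have [] := h i.
Qed.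

Lemma prod_indic_box q (E : 'I_q -> set R) (t : Rn q) :
  \prod_(i < q) \1_(E i) (tnth t i : R) = \1_(box E) t :> R.
Proof.
rewrite !indicE; have [h|h] := pselect (box E t).
  by rewrite mem_set// big1// => i _; rewrite indicE mem_set.
rewrite memNset//; have [i hi] : exists i, ~ E i (tnth t i) by exact/existsNP.
by rewrite (bigD1 i)//= indicE memNset// mul0r.
Qed.

Definition interval_box q (u : q.-tuple (R * R)) : set (Rn q) :=
  box (fun j => `](tnth u j).1, (tnth u j).2[%classic).

Lemma lebesgue_overlap (x y : R * R) :
  lebesgue_measure (`]x.1, x.2[ `&` `]y.1, y.2[ : set R) = (overlap x y)%:E.
Proof.
have -> : `]x.1, x.2[%classic `&` `]y.1, y.2[%classic =
    `](Num.max x.1 y.1), (Num.min x.2 y.2)[%classic :> set R.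
  apply/seteqP; split=> r /=; rewrite !in_itv/= gt_max lt_min.
    by move=> [/andP[-> ->] /andP[-> ->]].
  by move=> /andP[/andP[-> ->] /andP[-> ->]].
rewrite lebesgue_measure_itv/= lte_fin /overlap; case: ltP => h.
  have h0 : 0 <= Num.min x.2 y.2 - Num.max x.1 y.1 by rewrite subr_ge0 ltW.
  by rewrite (max_r h0) EFinB.
have h0 : Num.min x.2 y.2 - Num.max x.1 y.1 <= 0 by rewrite subr_le0.
by rewrite (max_l h0).
Qed.

Lemma lebesgue_interval_box q (u v : q.-tuple (R * R)) :
  mu q (interval_box u `&` interval_box v) =
  (\prod_(j < q) overlap (tnth u j) (tnth v j))%:E.
Proof.
rewrite setI_box; have h := @lebesgue_tuple_box R q
   (fun i => `](tnth u i).1, (tnth u i).2[%classic `&` `](tnth v i).1, (tnth v i).2[%classic).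
rewrite h; last by move=> i; apply: measurableI; exact: measurable_itv.
rewrite (eq_bigr (fun i => (overlap (tnth u i) (tnth v i))%:E)); last first.
  by move=> i _; rewrite lebesgue_overlap.
by rewrite -(big_morph EFin EFinM (erefl : 1%:E = 1%E)).
Qed.

Lemma measurable_interval_box q (u : q.-tuple (R * R)) : measurable (interval_box u).
Proof. by apply: measurable_box => i; exact: measurable_itv. Qed.

Lemma interval_box_orthant q (u : q.-tuple (R * R)) :
  (forall j, 0 <= (tnth u j).1) -> interval_box u `<=` orthant (q := q).
Proof.
move=> h t ut i; have := ut i; rewrite /= in_itv/= => /andP[h1 _].
by rewrite (le_trans (h i))// ltW.
Qed.

Lemma step_funE q (s : seq (R[i] * q.-tuple (R * R))) t :
  step_fun s t = \sum_(u <- s) u.1 * (\1_(interval_box u.2) t)%:C.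
Proof.
apply: eq_bigr => u _; congr (_ * _).
by rewrite -prod_indic_box rmorph_prod.
Qed.

Lemma L2norm2_step_fun q (s : seq (R[i] * q.-tuple (R * R))) : off_diagonal_step s ->
  (L2norm2 (step_fun s) = (complex.Re (\sum_(u <- s) \sum_(v <- s)
     u.1 * v.1^* * (\prod_(j < q) overlap (tnth u.2 j) (tnth v.2 j))%:C))%:E)%E.
Proof.
move=> hs; rewrite /L2norm2.
pose k (p : (R[i] * q.-tuple (R * R)) * (R[i] * q.-tuple (R * R))) :=
  complex.Re (p.1.1 * p.2.1^*).
pose B (p : (R[i] * q.-tuple (R * R)) * (R[i] * q.-tuple (R * R))) :=
  interval_box p.1.2 `&` interval_box p.2.2.
have ReC (z : R[i]) (x : R) : complex.Re (z * x%:C) = complex.Re z * x.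
  by rewrite ReM /= mulr0 subr0.
have mB p : measurable (B p) by apply: measurableI; exact: measurable_interval_box.
rewrite (eq_integral (fun t => (\sum_(p <- [seq (u, v) | u <- s, v <- s])
    (k p)%:E * (\1_(B p) t)%:E)%E)); last first.
  move=> t _; under eq_bigr => p _ do rewrite -EFinM.
  rewrite sumEFin; congr (_%:E).
  rewrite -[LHS]/(complex.Re (sqmod (step_fun s t))%:C) -mulCJ step_funE.
  rewrite rmorph_sum mulr_suml (big_morph _ (@ReD R) (erefl : complex.Re 0 = 0)).
  rewrite big_allpairs_dep/=; apply: eq_bigr => u _.
  rewrite mulr_sumr (big_morph _ (@ReD R) (erefl : complex.Re 0 = 0)).
  apply: eq_bigr => v _; rewrite rmorphM/= mulrACA.
  transitivity (complex.Re (u.1 * v.1^* * (\1_(B (u, v)) t)%:C)); last exact: ReC.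
  rewrite /B indicI; congr (complex.Re (_ * _)).
  by rewrite [RHS]rmorphM; congr (_ * _); exact: conjc_real.
have Bfin p : (mu q (B p) < +oo)%E by rewrite lebesgue_interval_box ltry.
have Iint p : (mu q).-integrable (orthant (q := q)) (fun t => (\1_(B p) t)%:E).
  apply: (integrableS measurableT) => //; first exact: measurable_orthant.
  apply/integrableP; split; first exact/measurable_EFinP/measurable_indic.
  rewrite (eq_integral (fun t => (\1_(B p) t)%:E)); last first.
    by move=> t _; rewrite gee0_abs// lee_fin.
  by rewrite integral_indic// setIT; exact: Bfin.
have Bint p : (mu q).-integrable (orthant (q := q)) (fun t => (k p)%:E * (\1_(B p) t)%:E)%E.
  by apply: integrableZl; [exact: measurable_orthant|exact: Iint].
rewrite integral_sum//; last exact: measurable_orthant.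
rewrite (eq_big_seq (fun p => (k p * \prod_(j < q) overlap (tnth p.1.2 j) (tnth p.2.2 j))%:E)).
  rewrite sumEFin big_allpairs_dep/= (big_morph _ (@ReD R) (erefl : complex.Re 0 = 0)).
  congr (_%:E); apply: eq_bigr => u _.
  rewrite (big_morph _ (@ReD R) (erefl : complex.Re 0 = 0)).
  by apply: eq_bigr => v _; rewrite ReC.
move=> _ /allpairsPdep[u [v [us vs ->]]].
rewrite integralZl//; last exact: measurable_orthant.
rewrite integral_indic//; last exact: measurable_orthant.
have BO : B (u, v) `<=` orthant (q := q).
  move=> t [h _]; apply: interval_box_orthant h => j.
  by have /andP[] := (hs u us).1 j.
by rewrite setIidl// EFinM; congr (_ * _)%E; exact: lebesgue_interval_box.
Qed.

End Boxes.

(** * The norm of square integrable functions *)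

Section L2.
Context {R : realType} {q : nat}.
Local Notation Rn := (q.-tuple (measurableTypeR R)).
Local Notation mu := (@lebesgue_tuple R q).
Local Notation O := (@orthant R q).
Local Notation Re := (@complex.Re R).
Local Notation Im := (@complex.Im R).
Implicit Types (f g : Rn -> R[i]) (k : R[i]).

Definition measurableC f := measurable_fun O (fun t => Re (f t)) /\
  measurable_fun O (fun t => Im (f t)).

Lemma measurableC_lin k f g : measurableC f -> measurableC g ->
  measurableC (fun t => f t + k * g t).
Proof.
move=> [f1 f2] [g1 g2]; split.
  rewrite (_ : (fun _ => _) = (fun t => Re (f t) + (Re k * Re (g t) - Im k * Im (g t)))); last first.
    by apply/funext => t; rewrite ReD ReM.
  apply: measurable_funD => //; apply: measurable_funB; apply: measurable_funM => //.
rewrite (_ : (fun _ => _) = (fun t => Im (f t) + (Re k * Im (g t) + Im k * Re (g t)))); last first.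
  by apply/funext => t; rewrite ImD ImM.
by apply: measurable_funD => //; apply: measurable_funD; apply: measurable_funM.
Qed.

Lemma measurable_sqmod f : measurableC f -> measurable_fun O (fun t => sqmod (f t)).
Proof.
by move=> [f1 f2]; apply: measurable_funD; apply: measurable_funX.
Qed.

Lemma measurable_Esqmod f : measurableC f -> measurable_fun O (fun t => (sqmod (f t))%:E).
Proof. by move=> mf; apply/measurable_EFinP; exact: measurable_sqmod. Qed.

Lemma measurableC_step_fun s : measurableC (step_fun s).
Proof.
rewrite (_ : step_fun s = fun t => \sum_(u <- s) u.1 * (\1_(interval_box u.2) t)%:C); last first.
  by apply/funext => t; exact: step_funE.
elim: s => [|u s IH].
  rewrite (_ : (fun _ => _) = cst 0); first by split; exact: measurable_cst.
  by apply/funext => t; rewrite big_nil.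
rewrite (_ : (fun _ => _) = (fun t => \sum_(v <- s) v.1 * (\1_(interval_box v.2) t)%:C +
    u.1 * (\1_(interval_box u.2) t)%:C)); last first.
  by apply/funext => t; rewrite big_cons addrC.
apply: measurableC_lin => //; split; last exact: measurable_cst.
by apply: measurable_indic; exact: measurable_interval_box.
Qed.

Lemma L2norm2_ge0 f : (0 <= L2norm2 f)%E.
Proof. by apply: integral_ge0 => t _; rewrite lee_fin sqmod_ge0. Qed.

Lemma square_integrableE f :
  square_integrable f <-> measurableC f /\ (L2norm2 f < +oo)%E.
Proof. by split=> [[]|[[]]]. Qed.

Definition L2n f : R := Num.sqrt (fine (L2norm2 f)).

Lemma L2n_ge0 f : 0 <= L2n f. Proof. exact: sqrtr_ge0. Qed.

Lemma L2norm2E f : (L2norm2 f < +oo)%E -> L2norm2 f = (L2n f ^+ 2)%:E.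
Proof.
move=> foo; have f0 := L2norm2_ge0 f.
rewrite sqr_sqrtr ?fine_ge0// fineK//.
by rewrite ge0_fin_numE.
Qed.

(** The difference is a multiple of a sum of squares. The free parameter e replaces a Cauchy-Schwarz
    inequality for integrals: set to the ratio of the norms, it gives the triangle inequality. *)
Lemma sqmodD_le (z w : R[i]) (e : R) : 0 < e ->
  sqmod (z + w) <= (1 + e) * sqmod z + (1 + e^-1) * sqmod w.
Proof.
move=> e0; rewrite -subr_ge0.
have -> : (1 + e) * sqmod z + (1 + e^-1) * sqmod w - sqmod (z + w) =
    e^-1 * ((e * Re z - Re w) ^+ 2 + (e * Im z - Im w) ^+ 2).
  by rewrite /sqmod ReD ImD; field; rewrite gt_eqF.
by rewrite mulr_ge0 ?invr_ge0 ?(ltW e0)// addr_ge0 ?sqr_ge0.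
Qed.

Lemma L2norm2D_le f g (e : R) : 0 < e -> measurableC f -> measurableC g ->
  (L2norm2 (fun t => f t + g t)%R <=
   (1 + e)%:E * L2norm2 f + (1 + e^-1)%:E * L2norm2 g)%E.
Proof.
move=> e0 mf mg; have mO := @measurable_orthant R q.
have e1 : 0 <= 1 + e by rewrite addr_ge0// ltW.
have e2 : 0 <= 1 + e^-1 by rewrite addr_ge0// invr_ge0 ltW.
rewrite /L2norm2 -!ge0_integralZl_EFin//; last 4 first.
- by move=> t _; rewrite lee_fin sqmod_ge0.
- exact: measurable_Esqmod.
- by move=> t _; rewrite lee_fin sqmod_ge0.
- exact: measurable_Esqmod.
rewrite -ge0_integralD//; last 4 first.
- by move=> t _; rewrite -EFinM lee_fin mulr_ge0// sqmod_ge0.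
- by apply: measurable_funeM; exact: measurable_Esqmod.
- by move=> t _; rewrite -EFinM lee_fin mulr_ge0// sqmod_ge0.
- by apply: measurable_funeM; exact: measurable_Esqmod.
apply: ge0_le_integral => //.
- by move=> t _; rewrite lee_fin sqmod_ge0.
- apply: measurable_Esqmod; rewrite (_ : (fun _ => _) = (fun t => f t + 1 * g t)).
    exact: measurableC_lin.
  by apply/funext => t; rewrite mul1r.
- by apply: emeasurable_funD; apply: measurable_funeM; exact: measurable_Esqmod.
- by move=> t _; rewrite -!EFinM -EFinD lee_fin sqmodD_le.
Qed.

Lemma L2norm2Z k f : measurableC f ->
  (L2norm2 (fun t => k * f t)%R = (sqmod k)%:E * L2norm2 f)%E.
Proof.
move=> mf; rewrite /L2norm2 -ge0_integralZl_EFin ?sqmod_ge0//; last 3 first.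
- exact: measurable_orthant.
- by move=> t _; rewrite lee_fin sqmod_ge0.
- exact: measurable_Esqmod.
by apply: eq_integral => t _; rewrite sqmodM EFinM.
Qed.

End L2.

(** * Limits of complex sequences *)

Section ComplexLimits.
Context {R : realType}.
Implicit Types (u v : nat -> R[i]) (k l : R[i]).

(** The norm of [R[i]^o] takes its values in [R[i]]; this is the passage to real estimates. *)
Lemma cvgC_normc u l :
  cvgC u l <-> forall e : R, 0 < e -> \forall n \near \oo, normc (u n - l) <= e.
Proof.
have E := @cvgrPdist_le R[i] R[i]^o nat \oo _ (u : nat -> R[i]^o) l.
rewrite /cvgC; split=> [/E h e e0|h].
  have e0' : 0 < e%:C by rewrite ltcR.
  near=> n; rewrite -lecR -normcN opprB.
  by near: n; exact: h.
apply/E => e; rewrite ltcE/= => /andP[/eqP e1 e2].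
near=> n; rewrite -normrN opprB lecE/= e1 eqxx /=.
near: n; exact: h.
Unshelve. all: by end_near. Qed.

Lemma cvgC_squeeze u l (v : nat -> R) : v @ \oo --> 0 ->
  (\forall n \near \oo, normc (u n - l) <= v n) -> cvgC u l.
Proof.
move=> /cvgr0Pnorm_le v0 uv; apply/cvgC_normc => e e0; near=> n.
have h1 : normc (u n - l) <= v n by near: n.
have h2 : `|v n| <= e by near: n; exact: v0.
by rewrite (le_trans h1)// (le_trans (ler_norm _)).
Unshelve. all: by end_near. Qed.

Lemma cvgC_dist0 u l : cvgC u l -> (fun n => normc (u n - l)) @ \oo --> 0.
Proof.
move=> /cvgC_normc h; apply/cvgr0Pnorm_le => e e0; near=> n.
by rewrite ger0_norm ?normc_ge0//; near: n; exact: h.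
Unshelve. all: by end_near. Qed.

Lemma cvgC_Re u l : cvgC u l -> (fun n => complex.Re (u n)) @ \oo --> complex.Re l.
Proof.
move=> /cvgC_normc h; apply/cvgrPdist_le => e e0; near=> n.
rewrite -normrN opprB -ReB (le_trans (Re_le_normc _))//; near: n; exact: h.
Unshelve. all: by end_near. Qed.

Lemma cvgC_sub0 u v l : cvgC v l -> (fun n => normc (u n - v n)) @ \oo --> 0 -> cvgC u l.
Proof.
move=> /cvgC_dist0 vl uv.
apply: (@cvgC_squeeze _ _ (fun n => normc (u n - v n) + normc (v n - l))).
  by rewrite -[0](addr0 0); exact: cvgD.
near=> n; rewrite (le_trans _ (le_normcD _ _))// addrA subrK.
Unshelve. all: by end_near. Qed.

End ComplexLimits.

Section Minkowski.
Context {R : realType} {q : nat}.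
Local Notation Rn := (q.-tuple (measurableTypeR R)).
Local Notation mu := (@lebesgue_tuple R q).
Local Notation O := (@orthant R q).
Implicit Types (f g : Rn -> R[i]) (k : R[i]).

Lemma L2norm2_le f g (a b : R) : measurableC f -> measurableC g -> 0 <= a -> 0 <= b ->
  (L2norm2 f <= (a ^+ 2)%:E)%E -> (L2norm2 g <= (b ^+ 2)%:E)%E ->
  (L2norm2 (fun t => f t + g t)%R <= ((a + b) ^+ 2)%:E)%E.
Proof.
move=> mf mg a0 b0 fa gb.
(* The slack e keeps the ratio (b + e) / (a + e) positive and defined when a or b is 0. *)
suff h e : 0 < e -> (L2norm2 (fun t => f t + g t)%R <= ((a + e + (b + e)) ^+ 2)%:E)%E.
  have foo : (L2norm2 (fun t => f t + g t)%R < +oo)%E.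
    by rewrite (le_lt_trans (h 1 ltr01))// ltry.
  rewrite L2norm2E// lee_fin ler_pXn2r ?nnegrE ?L2n_ge0 ?addr_ge0//.
  apply/ler_addgt0Pr => e e0; have e2 : 0 < e / 2 by rewrite divr_gt0.
  have := h _ e2; rewrite L2norm2E// lee_fin ler_pXn2r ?nnegrE ?L2n_ge0 ?addr_ge0// ?(ltW e2)//.
  by move=> /le_trans -> //; lra.
move=> e0; have ae : 0 < a + e by rewrite ltr_wpDl.
have be : 0 < b + e by rewrite ltr_wpDl.
have r0 : 0 < (b + e) / (a + e) by rewrite divr_gt0.
rewrite (le_trans (L2norm2D_le r0 mf mg))//.
have -> : ((a + e + (b + e)) ^+ 2)%:E = ((1 + (b + e) / (a + e))%:E * ((a + e) ^+ 2)%:E +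
    (1 + ((b + e) / (a + e))^-1)%:E * ((b + e) ^+ 2)%:E)%E.
  by rewrite -!EFinM -EFinD; congr (_%:E); field; rewrite !gt_eqF.
have sqr_le (c d : R) : 0 <= c -> 0 < d -> c ^+ 2 <= (c + d) ^+ 2.
  by move=> c0 d0; rewrite ler_pXn2r ?nnegrE ?addr_ge0 ?(ltW d0)// lerDl ltW.
apply: leeD; apply: lee_wpmul2l.
- by rewrite lee_fin addr_ge0// ltW.
- by rewrite (le_trans fa)// lee_fin sqr_le.
- by rewrite lee_fin addr_ge0// invr_ge0 ltW.
- by rewrite (le_trans gb)// lee_fin sqr_le.
Qed.

End Minkowski.

(** * The integral through its step approximations *)

Section FreeIntegral.
Context {R : realType} {A : tracialWstarProbSpace R}.
Variables (F : R -> set A) (S : R -> A) (hS : free_brownian_motion F S).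
Context {q : nat}.
Local Notation Rn := (q.-tuple (measurableTypeR R)).
Local Notation steps := (seq (R[i] * q.-tuple (R * R))).
Implicit Types (f g : Rn -> R[i]) (k : R[i]) (x y : A) (s : steps).

(** The epsilon form of [is_free_integral]: one step function serves both limits, and approximations
    of two functions can be concatenated. *)
Definition approx_integral f x := forall e : R, 0 < e -> exists s : steps,
  [/\ off_diagonal_step s,
      (L2norm2 (fun t => f t - step_fun s t)%R <= (e ^+ 2)%:E)%E &
      n2 (x - step_integral S s) <= e].

Lemma is_free_integral_approx f x : is_free_integral S f x -> approx_integral f x.
Proof.
move=> [s [s_off /fine_cvgP[ffin fcvg] xcvg]] e e0.
have e2 : 0 < e ^+ 2 by rewrite exprn_gt0.
near \oo => n.
exists (s n); split=> //.
  have Ffin : L2norm2 (fun t => f t - step_fun (s n) t) \is a fin_num by near: n.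
  rewrite -(fineK Ffin) lee_fin (le_trans (ler_norm _))//.
  near: n; exact: (@cvgr0_norm_le _ _ _ _ _ _ fcvg).
rewrite -(@ler_pXn2r _ 2) ?nnegrE ?n2_ge0 ?(ltW e0)// n2E.
rewrite -[sq _]ger0_norm ?sq_ge0// -normc_real -sqE -[X in normc X]subr0.
near: n; move/cvgC_normc : xcvg; exact.
Unshelve. all: by end_near. Qed.

Lemma step_isometry s : off_diagonal_step s ->
  L2norm2 (step_fun s) = (sq (step_integral S s))%:E.
Proof.
move=> so; rewrite L2norm2_step_fun//.
have [t [N [t0 tlt -> E]]] := step_integral_grid S so.
have sys := wick_system_increment hS t0 tlt N.
rewrite -E /= (sq_theta (ws_selfadjoint sys) _ (ws_uniq sys))//.
exact: ws_centered sys.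
Qed.

Lemma step_fun_cat s1 s2 t : step_fun (s1 ++ s2) t = step_fun s1 t + step_fun s2 t.
Proof. by rewrite /step_fun big_cat. Qed.

Lemma step_integral_cat s1 s2 :
  step_integral S (s1 ++ s2) = step_integral S s1 + step_integral S s2.
Proof. by rewrite /step_integral big_cat. Qed.

Definition scale_step k s : steps := [seq (k * u.1, u.2) | u <- s].

Lemma step_fun_scale k s t : step_fun (scale_step k s) t = k * step_fun s t.
Proof.
by rewrite /step_fun big_map mulr_sumr; apply: eq_bigr => u _; rewrite mulrA.
Qed.

Lemma step_integral_scale k s : step_integral S (scale_step k s) = k *: step_integral S s.
Proof.
by rewrite /step_integral big_map scaler_sumr; apply: eq_bigr => u _; rewrite scalerA.
Qed.

Lemma off_diagonal_scale k s : off_diagonal_step s -> off_diagonal_step (scale_step k s).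
Proof. by move=> so _ /mapP[u us ->]; exact: (so u us). Qed.

Lemma off_diagonal_cat s1 s2 :
  off_diagonal_step s1 -> off_diagonal_step s2 -> off_diagonal_step (s1 ++ s2).
Proof. by move=> h1 h2 u; rewrite mem_cat => /orP[/h1|/h2]. Qed.

Lemma measurableC_sub_step f s : measurableC f ->
  measurableC (fun t => f t - step_fun s t).
Proof.
move=> mf; rewrite (_ : (fun _ => _) = (fun t => f t + (-1) * step_fun s t)).
  by apply: measurableC_lin => //; exact: measurableC_step_fun.
by apply/funext => t; rewrite mulN1r.
Qed.

Lemma approx_isometry f x : measurableC f -> approx_integral f x ->
  L2norm2 f = (sq x)%:E.
Proof.
move=> mf fx.
have h1 e : 0 < e -> (L2norm2 f <= ((n2 x + 2 * e) ^+ 2)%:E)%E.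
  move=> e0; have [s [so fs xs]] := fx e e0.
  have mfs := measurableC_sub_step s mf.
  have := L2norm2_le mfs (measurableC_step_fun s) (ltW e0) (n2_ge0 (step_integral S s)) fs.
  rewrite step_isometry// n2E lexx => /(_ isT).
  rewrite (_ : (fun t => _) = f); last by apply/funext => t; rewrite subrK.
  move=> /le_trans -> //; rewrite lee_fin ler_pXn2r ?nnegrE ?addr_ge0 ?mulr_ge0 ?n2_ge0 ?(ltW e0)//.
  have : n2 (step_integral S s) <= n2 x + e.
    rewrite -[step_integral S s](subrK x) addrC (le_trans (n2D _ _))// lerD2l.
    by rewrite -n2N opprB.
  lra.
have foo : (L2norm2 f < +oo)%E by rewrite (le_lt_trans (h1 1 ltr01))// ltry.
rewrite L2norm2E// -n2E; congr ((_ ^+ 2)%:E); apply/eqP; rewrite eq_le; apply/andP; split.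
  apply/ler_addgt0Pr => e e0; have e2 : 0 < e / 2 by rewrite divr_gt0.
  have := h1 _ e2; rewrite L2norm2E// lee_fin ler_pXn2r ?nnegrE ?L2n_ge0 ?addr_ge0 ?mulr_ge0 ?n2_ge0 ?(ltW e0)//.
  by move=> /le_trans -> //; lra.
apply/ler_addgt0Pr => e e0; have e2 : 0 < e / 2 by rewrite divr_gt0.
have [s [so fs xs]] := fx _ e2.
have mfs : measurableC (fun t => (-1) * (f t - step_fun s t)).
  rewrite (_ : (fun _ => _) = (fun t => step_fun s t + (-1) * f t)).
    by apply: measurableC_lin => //; exact: measurableC_step_fun.
  by apply/funext => t; rewrite mulrBr !mulN1r opprK addrC.
have fs' : (L2norm2 (fun t => (-1) * (f t - step_fun s t))%R <= ((e / 2) ^+ 2)%:E)%E.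
  rewrite L2norm2Z; last exact: measurableC_sub_step.
  by rewrite (_ : sqmod (-1) = 1) ?mul1e// /sqmod /= oppr0 expr0n addr0 sqrrN expr1n.
have := L2norm2_le mfs mf (ltW e2) (L2n_ge0 f) fs'.
rewrite -L2norm2E// lexx => /(_ isT).
rewrite (_ : (fun t => _) = step_fun s); last first.
  by apply/funext => t; rewrite mulN1r opprB subrK.
rewrite step_isometry// -n2E lee_fin ler_pXn2r ?nnegrE ?addr_ge0 ?L2n_ge0 ?n2_ge0 ?(ltW e2)// => h.
rewrite -[x](subrK (step_integral S s)) (le_trans (n2D _ _))//; lra.
Qed.

Lemma approx_lin k f g x y : measurableC f -> measurableC g ->
  approx_integral f x -> approx_integral g y ->
  approx_integral (fun t => f t + k * g t) (x + k *: y).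
Proof.
move=> mf mg fx gy e e0.
have k1 : 0 < 1 + normc k by rewrite ltr_wpDr// normc_ge0.
have e2 : 0 < e / 2 by rewrite divr_gt0.
have ek : 0 < e / 2 / (1 + normc k) by rewrite divr_gt0.
have [s [so fs xs]] := fx _ e2; have [r [ro gr yr]] := gy _ ek.
have kle : normc k * (e / 2 / (1 + normc k)) <= e / 2.
  rewrite mulrCA ler_piMr ?(ltW e2)// ler_pdivrMr// mul1r lerDr//.
exists (s ++ scale_step k r); split.
- by apply: off_diagonal_cat => //; exact: off_diagonal_scale.
- rewrite (_ : (fun t => _) = (fun t => (f t - step_fun s t) + k * (g t - step_fun r t))); last first.
    by apply/funext => t; rewrite step_fun_cat step_fun_scale mulrBr opprD addrACA.
  rewrite [e]splitr; apply: L2norm2_le => //.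
  + exact: measurableC_sub_step.
  + rewrite (_ : (fun _ => _) = fun t => 0 + k * (g t - step_fun r t)); last first.
      by apply/funext => t; rewrite add0r.
    apply: measurableC_lin; last exact: measurableC_sub_step.
    by split; exact: measurable_cst.
  + exact: ltW.
  + exact: ltW.
  + rewrite L2norm2Z; last exact: measurableC_sub_step.
    rewrite (le_trans (lee_wpmul2l _ gr)) ?lee_fin ?sqmod_ge0//.
    rewrite -normcE2 -exprMn ler_pXn2r// nnegrE ?(ltW e2)//.
    by rewrite mulr_ge0 ?normc_ge0 ?(ltW ek).
- rewrite step_integral_cat step_integral_scale opprD addrACA -scalerBr.
  rewrite (le_trans (n2D _ _))// [e]splitr lerD// n2Z.
  by rewrite (le_trans _ kle)// ler_wpM2l ?normc_ge0.
Qed.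

(** By linearity x - y is an integral of 0, and the isometry gives it norm 0. *)
Lemma approx_unique f x y : measurableC f ->
  approx_integral f x -> approx_integral f y -> x = y.
Proof.
move=> mf fx fy; have := approx_isometry _ (approx_lin (-1) mf mf fx fy).
rewrite (_ : (fun t => _) = cst 0); last by apply/funext => t; rewrite mulN1r subrr.
have m0 : @measurableC R q (cst 0) by split; exact: measurable_cst.
move=> /(_ m0); rewrite /L2norm2 integral0_eq; last first.
  by move=> t _; rewrite /sqmod/= expr0n addr0.
move=> [h]; apply/eqP; rewrite -subr_eq0; apply/eqP/n2_eq0.
by rewrite /n2 -scaleN1r -h sqrtr0.
Qed.

End FreeIntegral.

Section Polarization.
Context {R : realType} {A : tracialWstarProbSpace R}.
Variables (F : R -> set A) (S : R -> A) (hS : free_brownian_motion F S).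
Context {q : nat}.
Local Notation Rn := (q.-tuple (measurableTypeR R)).
Local Notation mu := (@lebesgue_tuple R q).
Local Notation O := (@orthant R q).
Local Notation Re := (@complex.Re R).
Local Notation Im := (@complex.Im R).

(** Polarization reduces inner products to the norms of f + k g, which the isometry already covers:
    k = 1, -1 give the real part and k = i, -i the imaginary part. *)
Lemma L2dot_phi (f g : Rn -> R[i]) (x y : A) : measurableC f -> measurableC g ->
  approx_integral S f x -> approx_integral S g y ->
  L2dot f g = nc_state A (ws_adj y * x).
Proof.
move=> mf mg fx gy; have mO := @measurable_orthant R q.
pose N k t := sqmod (f t + k * g t).
have mN k : measurableC (fun t => f t + k * g t) by exact: measurableC_lin.
have isoN k : (\int[mu]_(t in O) (N k t)%:E)%E = (sq (x + k *: y))%:E.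
  by apply: (approx_isometry hS (mN k)); exact: approx_lin.
have intN k : mu.-integrable O (EFin \o N k).
  apply/integrableP; split; first exact: measurable_Esqmod.
  rewrite (eq_integral (fun t => (N k t)%:E)); last first.
    by move=> t _; rewrite /= ger0_norm// sqmod_ge0.
  by rewrite isoN ltry.
have RN k : \int[mu]_(t in O) N k t = sq (x + k *: y) by rewrite /Rintegral isoN.
have pol k l : \int[mu]_(t in O) (4^-1 * (N k t - N l t)) =
    4^-1 * (sq (x + k *: y) - sq (x + l *: y)).
  rewrite RintegralZl//; first by rewrite RintegralB// !RN.
  rewrite (_ : _ \o _ = (fun t => (N k t)%:E - (N l t)%:E)%E)//.
  by apply: integrableB => //; exact: intN.
have sqN k : sq (x + k *: y) = sq x + sqmod k * sq y + 2 * Re (k^* * nc_state A (ws_adj y * x)).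
  by rewrite sqD sqZ adjZ -scalerAl stateZ.
rewrite /L2dot; apply: eqC => /=.
- under eq_Rintegral => t _.
    rewrite (_ : Re _ = 4^-1 * (N 1 t - N (-1) t)); last first.
      by rewrite /N /sqmod !ReD !ImD !ReM !ImM ReJ ImJ /=; field.
    over.
  rewrite pol !sqN; case: (nc_state A _) => a b.
  by rewrite /sqmod !ReM /=; field.
- under eq_Rintegral => t _.
    rewrite (_ : Im _ = 4^-1 * (N 'i t - N (- 'i) t)); last first.
      by rewrite /N /sqmod !ReD !ImD !ReM !ImM ReJ ImJ /=; field.
    over.
  rewrite pol !sqN; case: (nc_state A _) => a b.
  by rewrite /sqmod !ReM /=; field.
Qed.

End Polarization.

(** * Invariance of Lebesgue measure under reversal of coordinates *)

Section Reversal.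
Context {R : realType} {q : nat}.
Local Notation Rn := (q.-tuple (measurableTypeR R)).
Local Notation mu := (@lebesgue_tuple R q).
Local Notation O := (@orthant R q).

Definition rev_tup (t : Rn) : Rn := [tuple of rev t].

Lemma tnth_rev_tup (t : Rn) i : tnth (rev_tup t) i = tnth t (rev_ord i).
Proof.
by rewrite !(tnth_nth 0) /= nth_rev size_tuple.
Qed.

Lemma measurable_rev_tup : measurable_fun [set: Rn] rev_tup.
Proof.
apply/measurable_fun_tnthP => i.
rewrite (_ : _ \o _ = (fun t => tnth t (rev_ord i))); first exact: measurable_tnth.
by apply/funext => t; rewrite /= tnth_rev_tup.
Qed.

Lemma preimage_rev_box (E : 'I_q -> set R) :
  rev_tup @^-1` box E = box (fun i => E (rev_ord i)).
Proof.
apply/seteqP; split=> t h i; have := h (rev_ord i); rewrite /= tnth_rev_tup rev_ordK//.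
Qed.

Lemma preimage_rev_orthant : rev_tup @^-1` O = O.
Proof.
apply/seteqP; split=> t h i; last by rewrite tnth_rev_tup; exact: h.
by have := h (rev_ord i); rewrite tnth_rev_tup rev_ordK.
Qed.

Definition boxes : set (set Rn) :=
  [set B | exists2 E : 'I_q -> set (measurableTypeR R), (forall i, measurable (E i)) & B = box E].

Lemma measurable_boxes : @measurable _ Rn = <<s boxes >>.
Proof.
apply/seteqP; split.
  apply: smallest_sub; first exact: smallest_sigma_algebra.
  move=> B; elim/big_ind : _ => //.
    by move=> X Y hX hY [/hX|/hY].
  move=> i _ [C mC <-]; apply: sub_sigma_algebra.
  exists (fun j => if j == i then C else setT).
    by move=> j; case: ifP.
  apply/seteqP; split=> [t [_ h] j|t h].
    by case: eqP => // ->.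
  by split=> //; have := h i; rewrite eqxx.
apply: smallest_sub; first exact: sigma_algebra_measurable.
by move=> _ [E mE ->]; exact: measurable_box.
Qed.

(** Both measures give a box the product of its side measures. Boxes form a generating pi-system,
    and the cubes of side 2k exhaust the space with finite measure. *)
Lemma lebesgue_tuple_rev (B : set Rn) : measurable B -> mu (rev_tup @^-1` B) = mu B.
Proof.
pose mixin := isMeasurableFun.Build _ _ _ _ _ measurable_rev_tup.
pose rho : {mfun Rn >-> Rn} := HB.pack rev_tup mixin.
move=> mB; have boxE (E : 'I_q -> set (measurableTypeR R)) : (forall i, measurable (E i)) ->
    mu (box E) = (\prod_(i < q) lebesgue_measure (E i))%E.
  exact: lebesgue_tuple_box.
have mI (k : nat) : measurable (`](- k%:R), k%:R[%classic : set R) by exact: measurable_itv.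
apply/esym; apply: (@measure_unique _ _ _ boxes
  (fun k : nat => box (fun=> `](- k%:R), k%:R[%classic)) _ _ _ _ mu
  (pushforward mu rho : {measure set _ -> \bar R})) => //.
- exact: measurable_boxes.
- move=> _ _ [E1 m1 ->] [E2 m2 ->]; exists (fun i => E1 i `&` E2 i).
    by move=> i; exact: measurableI.
  exact: setI_box.
- by move=> k; exists (fun=> `](- k%:R), k%:R[%classic) => // i; exact: mI.
- apply/seteqP; split=> // t _; pose m : R := \sum_(i < q) `|tnth t i : R|.
  exists (Num.truncn m).+1 => // i; rewrite /= in_itv/= -ltr_norml.
  rewrite (le_lt_trans _ (truncnS_gt m))// /m (bigD1 i)//= lerDl.
  by apply: sumr_ge0 => j _.
- move=> _ [E mE ->]; rewrite [RHS]/(mu (rev_tup @^-1` box E)) preimage_rev_box.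
  apply: etrans (boxE E mE) _; rewrite (reindex_inj rev_ord_inj).
  by apply: esym; apply: (boxE (fun i => E (rev_ord i))) => i; exact: mE.
- move=> k; apply: (eq_ind_r (fun z => (z < +oo)%E) _
    (boxE (fun=> `](- k%:R), k%:R[%classic) (fun=> mI k))).
  rewrite (eq_bigr (fun=> (Num.max 0 (k%:R - - k%:R) : R)%:E)).
    by rewrite -(big_morph EFin EFinM (erefl : 1%:E = 1%E)) ltry.
  move=> i _; rewrite lebesgue_measure_itv/= lte_fin; case: ltP => h.
    have h0 : 0 <= k%:R - - k%:R :> R by rewrite subr_ge0 ltW.
    by rewrite (max_r h0) EFinB.
  have h0 : k%:R - - k%:R <= 0 :> R by rewrite subr_le0.
  by rewrite (max_l h0).
Qed.

Lemma L2norm2_rev (f : Rn -> R[i]) : measurableC f ->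
  L2norm2 (fun t => f (rev_tup t)) = L2norm2 f.
Proof.
move=> mf; have mO := @measurable_orthant R q.
have mF := measurable_Esqmod mf.
rewrite /L2norm2 -{1}preimage_rev_orthant.
rewrite -[LHS]/(\int[mu]_(t in rev_tup @^-1` O) ((fun t => (sqmod (f t))%:E) \o rev_tup) t)%E.
rewrite -(ge0_integral_pushforward measurable_rev_tup)//; last first.
  by move=> t _; rewrite lee_fin sqmod_ge0.
pose mixin := isMeasurableFun.Build _ _ _ _ _ measurable_rev_tup.
pose rho : {mfun Rn >-> Rn} := HB.pack rev_tup mixin.
apply: (@eq_measure_integral _ _ _ _ mu (pushforward mu rho : {measure set _ -> \bar R})).
by move=> B mB _; exact: lebesgue_tuple_rev.
Qed.

Lemma measurableC_rev (f : Rn -> R[i]) : measurableC f -> measurableC (fun t => f (rev_tup t)).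
Proof.
move=> [f1 f2]; have mO := @measurable_orthant R q.
have comp (g : Rn -> R) : measurable_fun O g -> measurable_fun O (g \o rev_tup).
  move=> mg; apply: (measurable_comp mO) => //.
    by move=> _ [t Ot <-] i; rewrite tnth_rev_tup; exact: Ot.
  by apply: measurable_funTS; exact: measurable_rev_tup.
by split; [exact: (comp _ f1)|exact: (comp _ f2)].
Qed.

End Reversal.

Section SelfAdjoint.
Context {R : realType} {A : tracialWstarProbSpace R}.
Variables (F : R -> set A) (S : R -> A) (hS : free_brownian_motion F S).
Context {q : nat}.
Local Notation Rn := (q.-tuple (measurableTypeR R)).
Local Notation mu := (@lebesgue_tuple R q).
Local Notation O := (@orthant R q).
Local Notation steps := (seq (R[i] * q.-tuple (R * R))).

Definition mirror_step (s : steps) : steps :=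
  map (fun u : R[i] * q.-tuple (R * R) => (u.1^*, [tuple of rev u.2])) s.

Lemma tnth_rev_intervals (u : q.-tuple (R * R)) j :
  tnth [tuple of rev u] j = tnth u (rev_ord j).
Proof. by rewrite !(tnth_nth (0, 0)) /= nth_rev size_tuple. Qed.

Lemma off_diagonal_mirror s : off_diagonal_step s -> off_diagonal_step (mirror_step s).
Proof.
move=> so _ /mapP[u us ->]; split=> [j|]; first by rewrite tnth_rev_intervals; exact: (so u us).1.
move=> i j _ _; rewrite !tnth_rev_intervals => h.
by apply: rev_ord_inj; exact: (so u us).2.
Qed.

Lemma step_fun_mirror s t : step_fun (mirror_step s) t = (step_fun s (rev_tup t))^*.
Proof.
rewrite !step_funE big_map rmorph_sum; apply: eq_bigr => u _.
rewrite [RHS]rmorphM; congr (_ * _).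
have -> : \1_(interval_box u.2) (rev_tup t) = \1_(interval_box [tuple of rev u.2]) t :> R.
  rewrite !indicE; congr (_%:R); congr nat_of_bool.
  apply/idP/idP => /set_mem h; apply/mem_set => i.
    by have := h (rev_ord i); rewrite tnth_rev_tup rev_ordK -tnth_rev_intervals.
  by have := h (rev_ord i); rewrite tnth_rev_tup tnth_rev_intervals rev_ordK.
exact/esym/conjc_real.
Qed.

Lemma step_integral_mirror s : off_diagonal_step s ->
  step_integral S (mirror_step s) = ws_adj (step_integral S s).
Proof.
move=> so; rewrite /step_integral big_map adj_sum; apply: eq_big_seq => u us.
rewrite adjZ; congr (_ *: _).
rewrite -(big_tuple _ _ [tuple of rev u.2] xpredT (fun x => S x.2 - S x.1)).
rewrite -(big_tuple _ _ u.2 xpredT (fun x => S x.2 - S x.1)) adj_prod.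
apply: eq_big_seq => x; rewrite mem_rev => /tnthP[j ->].
have /andP[h1 h2] := (so u us).1 j.
by rewrite adjB !(fbm_selfadjoint hS)// (le_trans h1)// ltW.
Qed.

(** The mirrored step functions approximate the mirror image of f, hence f, and their integrals are
    the adjoints. Both x and its adjoint are thus integrals of f. *)
Lemma approx_selfadjoint (f : Rn -> R[i]) x : measurableC f -> mirror_symmetric f ->
  approx_integral S f x -> ws_adj x = x.
Proof.
move=> mf f_sym fx; apply: (approx_unique hS mf _ fx) => e e0.
have [s [so fs xs]] := fx e e0.
exists (mirror_step s); split; first exact: off_diagonal_mirror.
  have mg := measurableC_sub_step s mf.
  rewrite (le_trans _ fs)// -(L2norm2_rev mg).
  rewrite le_eqVlt; apply/orP; left; apply/eqP; rewrite /L2norm2.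
  have mO := @measurable_orthant R q.
  apply: ge0_ae_eq_integral => //.
  - by apply: measurable_Esqmod; exact: measurableC_sub_step.
  - by apply: measurable_Esqmod; exact: measurableC_rev mg.
  - by move=> t _; rewrite lee_fin sqmod_ge0.
  - by move=> t _; rewrite lee_fin sqmod_ge0.
  apply: filterS f_sym => t h Ot; congr (_%:E).
  by rewrite h// step_fun_mirror /mirror -rmorphB/= sqmodJ.
by rewrite step_integral_mirror// -adjB n2_adj.
Qed.

End SelfAdjoint.

(** * Limits of chaos elements *)

Section ProductLimits.
Context {R : realType} {A : tracialWstarProbSpace R}.
Local Notation phi := (nc_state A).

Lemma n2_cvg0_phi (X Y : nat -> A) : (fun n => n2 (X n - Y n)) @ \oo --> 0 ->
  (fun n => normc (phi (X n) - phi (Y n))) @ \oo --> 0.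
Proof.
move=> h; apply: (squeeze_cvgr (f := fun=> 0) (h := fun n => n2 (X n - Y n))) => //; last exact: cvg_cst.
by apply: nearW => n; rewrite normc_ge0 -stateB normc_phi_le.
Qed.

Lemma prod_dist_cvg (I : Type) (chi : seq I) (X Y : nat -> I -> A) :
    (forall n i, ws_adj (X n i) = X n i) ->
    (forall i, exists C : R, \forall n \near \oo, opbd C (X n i) /\ opbd C (Y n i)) ->
    (forall i, (fun n => n2 (X n i - Y n i)) @ \oo --> 0) ->
  (fun n => n2 (\prod_(i <- chi) X n i - \prod_(i <- chi) Y n i)) @ \oo --> 0.
Proof.
move=> Xsa XC XY.
(* Replacing one factor leaves a product of the X on its right, so the induction carries a bound for
   right multiplication; self-adjointness derives it from the left bounds. *)
suff [_ //] : (exists2 C : R, 0 <= C & \forall n \near \oo,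
      forall a, n2 (a * \prod_(i <- chi) X n i) <= C * n2 a) /\
    (fun n => n2 (\prod_(i <- chi) X n i - \prod_(i <- chi) Y n i)) @ \oo --> 0.
elim: chi => [|i chi [[C C0 hC] IH]].
  split; first by exists 1 => //; apply: nearW => n a; rewrite big_nil mulr1 mul1r.
  by under eq_fun do rewrite !big_nil subrr n20; exact: cvg_cst.
have [D hD] := XC i; split.
  exists (C * `|D|); first by rewrite mulr_ge0.
  near=> n => a.
  have [[D0 hX] _] : opbd D (X n i) /\ opbd D (Y n i) by near: n.
  have hCn : forall a, n2 (a * \prod_(i <- chi) X n i) <= C * n2 a by near: n.
  rewrite big_cons mulrA (le_trans (hCn _))// -mulrA ler_wpM2l// ger0_norm//.
  by rewrite -n2_adj adjM Xsa -(n2_adj a).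
pose v n := C * n2 (X n i - Y n i) +
  `|D| * n2 (\prod_(i <- chi) X n i - \prod_(i <- chi) Y n i).
apply: (squeeze_cvgr (f := fun=> 0) (h := v)); last 2 first.
- exact: cvg_cst.
- rewrite /v -[0](addr0 0) -{1}(mulr0 C) -{2}(mulr0 `|D|).
  by apply: cvgD; apply: cvgM => //; exact: cvg_cst.
near=> n; rewrite n2_ge0 /= !big_cons.
have [_ [D0 hY]] : opbd D (X n i) /\ opbd D (Y n i) by near: n.
have hCn : forall a, n2 (a * \prod_(i <- chi) X n i) <= C * n2 a by near: n.
rewrite (_ : _ - _ = (X n i - Y n i) * \prod_(i <- chi) X n i +
    Y n i * (\prod_(i <- chi) X n i - \prod_(i <- chi) Y n i)); last first.
  by rewrite mulrBl mulrBr addrA subrK.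
by rewrite (le_trans (n2D _ _))// lerD// ger0_norm.
Unshelve. all: by end_near. Qed.

End ProductLimits.

Section ChaosLimits.
Context {R : realType} {A : tracialWstarProbSpace R}.
Local Notation phi := (nc_state A).
Local Notation Re := (@complex.Re R).
Implicit Types x y : A.

(** The grid is existential: different elements live on unrelated grids, and only estimates with
    uniform constants connect them. *)
Definition chaos_element q x := exists (s : nat -> A) (L : seq nat) (g : seq nat -> R[i]),
  [/\ wick_system s L, {in words L q, forall w, g (rev w) = (g w)^*} & x = theta s L q g].

Definition chaos_limit q x := forall e : R, 0 < e ->
  exists2 y, chaos_element q y & n2 (x - y) <= e.

Lemma chaos_element_selfadjoint q x : chaos_element q x -> ws_adj x = x.
Proof. by move=> [s [L [g [sL gJ ->]]]]; exact: chaos_selfadjoint. Qed.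

Lemma chaos_element_opbd q x : chaos_element q x -> opbd (q.+1%:R * n2 x) x.
Proof. by move=> [s [L [g [sL gJ ->]]]]; exact: chaos_opbd. Qed.

Lemma chaos_limit_opbd q x : chaos_limit q x -> opbd (q.+1%:R * (n2 x + 1)) x.
Proof.
move=> hx; apply: opbd_lim; first by rewrite mulr_ge0// addr_ge0// n2_ge0.
(* Accuracy 1 keeps the norm of the approximation below [n2 x + 1], which gives a bound independent
   of e. *)
move=> e e0; have m0 : 0 < Num.min e 1 by rewrite lt_min e0 ltr01.
have [y yc xy] := hx _ m0.
exists y; last by rewrite (le_trans xy)// ge_min lexx.
apply: opbd_le (chaos_element_opbd yc) _; rewrite ler_wpM2l//.
rewrite -[y](subrK x) addrC (le_trans (n2D _ _))// lerD2l -n2N opprB.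
by rewrite (le_trans xy)// ge_min lexx orbT.
Qed.

(** The right side of [sum_defect] written with moments of x only, so that it passes to L2
    limits. *)
Definition fourth_defect x : R :=
  Re (phi (x ^+ 4)) - 2 * Re (phi (x ^+ 3)) + sq x - 2 * sq x ^+ 2.

Lemma chaos_element_moment q (lambda M : R) m x : (0 < q)%N -> ~~ odd q ->
  chaos_element q x -> n2 x <= M ->
  normc (phi (x ^+ m) - (motzkin lambda m 0)%:C) <=
  remainder_const q lambda M m *
    (q%:R * (Num.sqrt `|fourth_defect x| + `|sq x - lambda|)).
Proof.
move=> q0 q_even [s [L [g [sL gJ ->]]]] xM.
apply: le_trans (chaos_moment sL gJ q0 q_even lambda xM m) _.
apply: ler_wpM2l.
  elim: m => //= m IH; rewrite addr_ge0//; last first.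
    by apply: sumr_ge0 => h _; rewrite mulr_ge0// exprn_ge0// (le_trans (n2_ge0 _) xM).
  by rewrite !mulr_ge0// (le_trans (n2_ge0 _) xM).
have E : fourth_defect (theta s L q g) =
    \sum_(k < q.-1) tsq L (q - k.+1 + (q - k.+1)) (defect L q g k).
  by rewrite (sum_defect sL gJ q0 q_even) /fourth_defect sq_chaos.
apply: defect_size_le => //.
- rewrite -E (le_trans (ler_norm _))//.
  rewrite -[leLHS](@sqr_sqrtr R)// ler_pXn2r ?nnegrE ?addr_ge0 ?sqrtr_ge0//.
  by rewrite lerDl.
- by rewrite (sq_chaos sL) lerDr sqrtr_ge0.
Qed.

(** A chaos of degree 0 is a scalar; this rules out q = 0 below. *)
Lemma chaos_element0_moment x : chaos_element 0 x -> phi (x ^+ 4) = phi (x ^+ 2) ^+ 2.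
Proof.
move=> [s [L [g [_ _ ->]]]]; rewrite /theta big_seq1 /=.
by rewrite !exprZn !expr1n !stateZ nc_state1 !mulr1 -exprM.
Qed.

Lemma sq_selfadjoint x : ws_adj x = x -> phi (x ^+ 2) = (sq x)%:C.
Proof. by move=> xsa; rewrite -sqE xsa. Qed.

Lemma chaos_limit_cvg q (y : nat -> A) :
  (forall n, chaos_limit q (y n)) -> (forall n, ws_adj (y n) = y n) ->
  exists2 x : nat -> A, (forall n, chaos_element q (x n)) &
    (fun n => n2 (y n - x n)) @ \oo --> 0.
Proof.
move=> yc ysa.
have h n : exists x, chaos_element q x /\ n2 (y n - x) <= n.+1%:R^-1.
  by have [|x xc yx] := yc n n.+1%:R^-1; rewrite ?invr_gt0 ?ltr0n//; exists x.
have [x xP] := choice h; exists x => [n|]; first by have [] := xP n.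
apply: (squeeze_cvgr (f := fun=> 0) (h := fun n => n.+1%:R^-1)); last 2 first.
- exact: cvg_cst.
- exact: cvg_harmonic.
by apply: nearW => n; rewrite n2_ge0; have [] := xP n.
Qed.

Section Single.
Variables (q : nat) (lambda : R) (y : nat -> A).
Hypotheses (lambda_gt0 : 0 < lambda) (q_even : ~~ odd q).
Hypotheses (yc : forall n, chaos_limit q (y n)) (ysa : forall n, ws_adj (y n) = y n).
Hypothesis y2 : cvgC (fun n => phi (y n ^+ 2)) lambda%:C.
Hypothesis y3 : cvgC (fun n => phi (y n ^+ 3)) lambda%:C.
Hypothesis y4 : cvgC (fun n => phi (y n ^+ 4)) (2 * lambda ^+ 2 + lambda)%:C.

Lemma n2_bounded_of_cvg (x : nat -> A) (l : R) : (forall n, ws_adj (x n) = x n) ->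
  cvgC (fun n => phi (x n ^+ 2)) l%:C -> \forall n \near \oo, n2 (x n) <= l + 2.
Proof.
move=> xsa /cvgC_Re/= x2; near=> n.
have h : sq (x n) <= l + 1.
  have -> : sq (x n) = Re (phi (x n ^+ 2)) by rewrite sq_selfadjoint.
  near: n; apply: (cvgr_le _ x2); by rewrite ltrDl.
(* A square root in the bound is avoided: (n2 - 1)^2 >= 0 gives 2 n2 <= l + 2. *)
rewrite -n2E in h; have := sqr_ge0 (n2 (x n) - 1); rewrite sqrrB1.
have := n2_ge0 (x n); nra.
Unshelve. all: by end_near. Qed.

Lemma pow_dist_cvg (x : nat -> A) m : (forall n, chaos_element q (x n)) ->
  (fun n => n2 (y n - x n)) @ \oo --> 0 ->
  (fun n => n2 (y n ^+ m - x n ^+ m)) @ \oo --> 0.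
Proof.
move=> xc yx.
have E (z : A) : z ^+ m = \prod_(i <- iota 0 m) z.
  by rewrite -[m in iota _ m]subn0 -/(index_iota 0 m) prodr_const_nat subn0.
under eq_fun do rewrite !E.
apply: (@prod_dist_cvg R A nat (iota 0 m) (fun n _ => y n) (fun n _ => x n)) => // _.
exists (q.+1%:R * (lambda + 4)).
have yb := n2_bounded_of_cvg ysa y2.
have yx1 : \forall n \near \oo, n2 (y n - x n) <= 1.
  by move/cvgr0Pnorm_le : yx => /(_ 1 ltr01); apply: filterS => n; rewrite ger0_norm ?n2_ge0.
near=> n.
have h1 : n2 (y n) <= lambda + 2 by near: n.
have h2 : n2 (y n - x n) <= 1 by near: n.
split; [apply: opbd_le (chaos_limit_opbd (yc n)) _|apply: opbd_le (chaos_element_opbd (xc n)) _];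
  rewrite ler_wpM2l//; first by lra.
rewrite -[x n](subrK (y n)) (le_trans (n2D _ _))// -n2N opprB; lra.
Unshelve. all: by end_near. Qed.

Lemma chaos_limit_moments m : cvgC (fun n => phi (y n ^+ m)) (motzkin lambda m 0)%:C.
Proof.
have [x xc yx] := chaos_limit_cvg yc ysa.
have xy m' := n2_cvg0_phi (pow_dist_cvg m' xc yx).
have tr m' l : cvgC (fun n => phi (y n ^+ m')) l -> cvgC (fun n => phi (x n ^+ m')) l.
  move=> h; apply: cvgC_sub0 h _.
  by under eq_fun do rewrite -normcN opprB; exact: xy.
have x2 := tr _ _ y2; have x3 := tr _ _ y3; have x4 := tr _ _ y4.
have xsa n := chaos_element_selfadjoint (xc n).
apply: (cvgC_sub0 _ (xy m)).
have sqx : (fun n => sq (x n)) @ \oo --> lambda.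
  by have := cvgC_Re x2; under eq_fun do rewrite sq_selfadjoint//.
(* For q = 0 the fourth moment would tend both to lambda^2 and to 2 lambda^2 + lambda. *)
have [q0|q0] := posnP q.
  have E n : phi (x n ^+ 4) = phi (x n ^+ 2) ^+ 2.
    by apply: chaos_element0_moment; rewrite -q0.
  have := cvgC_Re x4 => /=.
  under eq_fun do rewrite E sq_selfadjoint// -rmorphXn/=.
  move=> h; have h' : (fun n => sq (x n) ^+ 2) @ \oo --> lambda ^+ 2.
    by rewrite expr2; under eq_fun do rewrite expr2; exact: cvgM.
  have gtl : lambda ^+ 2 < 2 * lambda ^+ 2 + lambda.
    by rewrite mulr_natl mulr2n -addrA ltrDl addr_gt0// exprn_gt0.
  exfalso; move/negP: (negbT (gt_eqF gtl)); apply; apply/eqP.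
  exact: etrans (esym (cvg_lim (@Rhausdorff R) h)) (cvg_lim (@Rhausdorff R) h').
have xb := n2_bounded_of_cvg xsa x2.
pose K := remainder_const q lambda (lambda + 2) m.
apply: (@cvgC_squeeze _ _ _ (fun n =>
   K * (q%:R * (Num.sqrt `|fourth_defect (x n)| + `|sq (x n) - lambda|)))).
  (* The prescribed second, third and fourth moments cancel in [fourth_defect]. *)
  have d0 : (fun n => fourth_defect (x n)) @ \oo --> 0.
    have -> : 0 = 2 * lambda ^+ 2 + lambda - 2 * lambda + lambda - 2 * lambda ^+ 2 by ring.
    apply: cvgB; last first.
      apply: cvgM; first exact: cvg_cst.
      by rewrite expr2; under eq_fun do rewrite expr2; exact: cvgM.
    apply: cvgD => //; apply: cvgB; first exact: (cvgC_Re x4).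
    by apply: cvgM; [exact: cvg_cst|exact: (cvgC_Re x3)].
  rewrite -(mulr0 K) -(mulr0 (q%:R : R)) -(addr0 0).
  apply: cvgM; first exact: cvg_cst.
  apply: cvgM; first exact: cvg_cst.
  apply: cvgD.
    rewrite -(@sqrtr0 R); apply: continuous_cvg; first exact: sqrt_continuous.
    by rewrite -(@normr0 R R); exact: cvg_norm.
  rewrite -(@normr0 R R) -(subrr lambda); apply: cvg_norm.
  by apply: cvgB => //; exact: cvg_cst.
near=> n; apply: chaos_element_moment => //.
by near: n.
Unshelve. all: by end_near. Qed.

End Single.
End ChaosLimits.

Section ChaosApproximation.
Context {R : realType} {A : tracialWstarProbSpace R}.
Implicit Types x y : A.

Lemma chaos_elementZ q (c : R) x : chaos_element q x -> chaos_element q (c%:C *: x).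
Proof.
move=> [s [L [g [sL gJ ->]]]]; exists s, L, (fun w => c%:C * g w); split=> //.
  by move=> w wL; rewrite gJ// rmorphM; congr (_ * _); exact/esym/conjc_real.
by rewrite thetaZ.
Qed.

Lemma chaos_limitZ q (c : R) x : chaos_limit q x -> chaos_limit q (c%:C *: x).
Proof.
move=> hx e e0; have c0 : 0 < `|c| + 1 by rewrite ltr_wpDl.
have [y yc xy] := hx (e / (`|c| + 1)) (divr_gt0 e0 c0).
exists (c%:C *: y); first exact: chaos_elementZ.
rewrite -scalerBr n2Z normc_real; apply: le_trans (ler_wpM2l (normr_ge0 c) xy) _.
by rewrite mulrCA ler_piMr ?(ltW e0)// ler_pdivrMr// mul1r lerDl.
Qed.

Variables (F : R -> set A) (S : R -> A).
Hypothesis hS : free_brownian_motion F S.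

(** A step approximation of a symmetric kernel need not be symmetric. Averaging its integral with
    the adjoint makes it so and does not increase the distance to the self-adjoint x. *)
Lemma approx_chaos_limit q (f : q.-tuple (measurableTypeR R) -> R[i]) x :
  approx_integral S f x -> ws_adj x = x -> chaos_limit q x.
Proof.
move=> fx xsa e e0; have [s [so _ xs]] := fx e e0.
have [t [N [t0 tlt sE _]]] := step_integral_grid S so.
set g := step_coef t s in sE; set X := step_integral S s in sE xs.
pose h w := 2^-1%:C * (g w + (g (rev w))^*).
have hE : theta (increment S t) (iota 0 N) q h = 2^-1%:C *: (X + ws_adj X).
  by rewrite thetaZ thetaD sE theta_adj//; [exact: (increment_selfadjoint hS t0 tlt)|exact: iota_uniq].
exists (theta (increment S t) (iota 0 N) q h).
  exists (increment S t), (iota 0 N), h; split=> //.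
    exact: (wick_system_increment hS t0 tlt).
  move=> w _; rewrite /h revK rmorphM rmorphD /= conjcK [g (rev w) + _]addrC.
  by congr (_ * _); exact/esym/conjc_real.
rewrite hE.
have -> : x - 2^-1%:C *: (X + ws_adj X) = 2^-1%:C *: ((x - X) + ws_adj (x - X)).
  rewrite adjB xsa addrACA -opprD scalerBr; congr (_ - _).
  rewrite scalerDr -scalerDl -rmorphD/= (_ : 2^-1 + 2^-1 = 1) ?scale1r//.
  by rewrite -div1r -splitr.
rewrite n2Z normc_real ger0_norm ?invr_ge0//.
have := n2D (x - X) (ws_adj (x - X)); rewrite n2_adj; lra.
Qed.

End ChaosApproximation.

(** * Noncrossing partitions without singletons *)

Section NoncrossingZip.
Variable N : nat.
Local Open Scope set_scope.
Implicit Types (P Q : {set {set 'I_N}}) (V W : {set 'I_N}) (s t : seq 'I_N) (x y : 'I_N).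
Local Notation lt := (fun i j : 'I_N => (i < j)%N).

Definition crossing V W := exists i j k l, [/\ i \in V, j \in W, k \in V & l \in W] /\
  [/\ (i < j)%N, (j < k)%N & (k < l)%N].

(* A noncrossing partition of the points rev s ++ t. Read from the left, the
   points of s have been visited; each point of t stands for the future of one
   block that is still open. *)
Record nc_zip s t P : Prop := NcZip {
  zip_partition : finset.partition P [set z in catrev s t];
  zip_nc : forall V W, V \in P -> W \in P -> V != W -> ~ crossing V W;
  zip_gt1 : forall V, V \in P -> (1 < #|V|)%N;
  zip_sep : forall V u v, V \in P -> u \in t -> v \in t -> u \in V -> v \in V -> u = v }.

Lemma crossing_sub V W V' W' : V' \subset V -> W' \subset W -> crossing V' W' -> crossing V W.
Proof.
move=> /fintype.subsetP VV /fintype.subsetP WW [i [j [k [l [[iV jW kV lW] o]]]]].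
by exists i, j, k, l; split=> //; split; auto.
Qed.

Lemma zip_block s t P V W z : nc_zip s t P -> V \in P -> W \in P -> z \in V -> z \in W -> V = W.
Proof.
move=> h VP WP zV zW; have tP := finset.partition_trivIset (zip_partition h).
by rewrite -(finset.def_pblock tP VP zV) (finset.def_pblock tP WP zW).
Qed.

Lemma zip_mem s t P V z : nc_zip s t P -> V \in P -> z \in V -> (z \in s) || (z \in t).
Proof.
move=> h VP zV; have := fintype.subsetP (finset.partitionS (zip_partition h) VP) z zV.
by rewrite inE catrevE mem_cat mem_rev.
Qed.

Lemma zip_pblock s t P z : nc_zip s t P -> (z \in s) || (z \in t) ->
  finset.pblock P z \in P /\ z \in finset.pblock P z.
Proof.
move=> h zD; have c : z \in finset.cover P.
  by rewrite (finset.cover_partition (zip_partition h)) inE catrevE mem_cat mem_rev.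
by rewrite finset.pblock_mem// finset.mem_pblock.
Qed.

Lemma zip_order s x t : pairwise lt (catrev s (x :: t)) ->
  (forall z, z \in s -> (z < x)%N) /\ (forall z, z \in t -> (x < z)%N).
Proof.
rewrite catrevE pairwise_cat /= => /and3P[/allrelP h _ /andP[/allP h' _]].
by split=> z zs; [apply: h; rewrite ?mem_rev ?mem_head|exact: h'].
Qed.

Section Pair.
Variables (x y : 'I_N) (s t : seq 'I_N).
Hypothesis xy_sorted : pairwise lt (catrev s [:: x, y & t]).

Let s_x z : z \in s -> (z < x)%N. Proof. exact: (zip_order xy_sorted).1. Qed.
Let x_y : (x < y)%N. Proof. by apply: (zip_order xy_sorted).2; exact: mem_head. Qed.
Let y_t z : z \in t -> (y < z)%N.
Proof. exact: (@zip_order (x :: s) y t xy_sorted).2. Qed.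

Let xs : x \notin s. Proof. by apply/negP => /s_x; rewrite ltnn. Qed.
Let ys : y \notin s. Proof. by apply/negP => /s_x; rewrite ltnNge ltnW. Qed.
Let xt : x \notin t. Proof. by apply/negP => /y_t; rewrite ltnNge ltnW. Qed.
Let yt : y \notin t. Proof. by apply/negP => /y_t; rewrite ltnn. Qed.
Let xy : (x == y) = false. Proof. by apply/eqP => e; have := x_y; rewrite e ltnn. Qed.

Let no_between z : (z \in s) || (z \in t) -> (x < z)%N -> (z < y)%N -> False.
Proof.
by case/orP => [/s_x h1 h2 _|/y_t h1 _ h2]; have := ltn_trans h1 h2; rewrite ltnn.
Qed.

(** The block of y has a second point z, which lies in s by [zip_sep]. If x shared a block with a
    later v but not with y, then z < x < y < v would cross. *)
Lemma zip_tied P V v : nc_zip (x :: s) (y :: t) P -> V \in P -> x \in V ->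
  v \in y :: t -> v \in V -> y \in V.
Proof.
move=> h VP xV; rewrite inE => /orP[/eqP->//|vt] vV.
have [WP yW] : finset.pblock P y \in P /\ y \in finset.pblock P y.
  by apply: zip_pblock h _; rewrite mem_head orbT.
set W := finset.pblock P y in WP yW.
have [->//|VW] := eqVneq V W.
have [z zW zy] : exists2 z, z \in W & z != y.
  have /card_gt1P[a [b [aW bW ab]]] := zip_gt1 h WP.
  by have [ay|] := eqVneq a y; [exists b; rewrite // -ay eq_sym|exists a].
have zx : z != x by apply: contraNneq VW => zx; apply/eqP/(zip_block h VP WP xV); rewrite -zx.
have := zip_mem h WP zW; rewrite !inE (negPf zx) (negPf zy) /= => /orP[zs|zt].
  case: (zip_nc h WP VP _); first by rewrite eq_sym.
  by exists z, x, y, v; split; split=> //; [exact: s_x|exact: y_t].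
have := zip_sep h WP (mem_head _ _) _ yW zW; rewrite inE zt orbT => /(_ isT) yz.
by rewrite yz eqxx in zy.
Qed.

(** Here x opened the innermost open block, whose future is y. Undoing the visit of x removes the
    block; [zip_pairU] is the inverse. *)
Lemma zip_pairD P : nc_zip (x :: s) (y :: t) P -> [set x; y] \in P ->
  nc_zip s t (P :\ [set x; y]).
Proof.
move=> h BP; split.
- have := finset.partitionD1 (zip_partition h) BP.
  rewrite (_ : _ :\: _ = [set z in catrev s t])//; apply/finset.setP => z.
  rewrite !inE !catrevE !mem_cat !mem_rev !inE.
  have [->|_] := eqVneq z x; first by rewrite (negPf xs) (negPf xt).
  by have [->|_] := eqVneq z y; first by rewrite (negPf ys) (negPf yt).
- by move=> V W /finset.setD1P[_ VP] /finset.setD1P[_ WP]; exact (zip_nc h VP WP).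
- by move=> V /finset.setD1P[_ VP]; exact (zip_gt1 h VP).
- by move=> V u v /finset.setD1P[_ VP] ut vt; apply: (zip_sep h VP); rewrite inE ?ut ?vt orbT.
Qed.

Lemma zip_pairU Q : nc_zip s t Q ->
  nc_zip (x :: s) (y :: t) ([set x; y] |: Q) /\ [set x; y] \notin Q.
Proof.
move=> h.
have xQ V : V \in Q -> x \in V = false.
  by move=> VQ; apply/negP => /(zip_mem h VQ); rewrite (negPf xs) (negPf xt).
have yQ V : V \in Q -> y \in V = false.
  by move=> VQ; apply/negP => /(zip_mem h VQ); rewrite (negPf ys) (negPf yt).
split; last by apply/negP => /xQ; rewrite !inE eqxx.
split.
- have := finset.partitionU1 (zip_partition h) (B := [set x; y]).
  rewrite [[set x; y] :|: _](_ : _ = [set z in catrev (x :: s) (y :: t)]); last first.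
    apply/finset.setP => z; rewrite !inE !catrevE !mem_cat !mem_rev !inE.
    by case: (z == x); case: (z == y); rewrite ?orbT.
  apply; first by apply/finset.set0Pn; exists x; rewrite !inE eqxx.
  rewrite finset.disjoints_subset; apply/fintype.subsetP => z; rewrite !inE catrevE mem_cat mem_rev.
  by case/orP => /eqP->; rewrite ?(negPf xs) ?(negPf xt) ?(negPf ys) ?(negPf yt).
- move=> V W /finset.setU1P[->|VQ] /finset.setU1P[->|WQ] VW.
  + by rewrite eqxx in VW.
  + move=> [i [j [k [l [[iV jW kV lW] [ij jk kl]]]]]].
    apply: (no_between (zip_mem h WQ jW)).
      move: iV; rewrite !inE => /orP[/eqP<-//|/eqP iy].
      by rewrite iy in ij; exact: ltn_trans x_y ij.
    move: kV; rewrite !inE => /orP[/eqP kx|/eqP<-//].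
    by rewrite kx in jk; exact: ltn_trans jk x_y.
  + move=> [i [j [k [l [[iV jW kV lW] [ij jk kl]]]]]].
    apply: (no_between (zip_mem h VQ kV)).
      move: jW; rewrite !inE => /orP[/eqP<-//|/eqP iy].
      by rewrite iy in jk; exact: ltn_trans x_y jk.
    move: lW; rewrite !inE => /orP[/eqP kx|/eqP<-//].
    by rewrite kx in kl; exact: ltn_trans kl x_y.
  + exact (zip_nc h VQ WQ VW).
- by move=> V /finset.setU1P[->|/(zip_gt1 h)//]; rewrite cards2 xy.
- move=> V u v /finset.setU1P[->|VQ]; rewrite !inE.
    move=> ut vt /orP[/eqP ux|/eqP->] /orP[/eqP vx|/eqP->] //;
    by [move: ut; rewrite ux xy (negPf xt)|move: vt; rewrite vx xy (negPf xt)].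
  case/orP => [/eqP->|ut]; first by rewrite yQ.
  by case/orP => [/eqP->|vt uV]; [rewrite yQ|exact (zip_sep h VQ ut vt uV)].
Qed.

(** Here x continued the innermost open block. As the block is not {x, y}, a third point remains
    beside y and no singleton arises; [zip_grow] is the inverse. *)
Lemma zip_shrink P V : nc_zip (x :: s) (y :: t) P -> V \in P -> x \in V -> y \in V ->
  [set x; y] \notin P -> nc_zip s (y :: t) ((V :\ x) |: (P :\ V)).
Proof.
move=> h VP xV yV BP.
have yVx : y \in V :\ x by rewrite !inE eq_sym xy.
have sub W : W \in (V :\ x) |: (P :\ V) -> exists2 W', W' \in P & W \subset W'.
  by case/finset.setU1P => [->|/finset.setD1P[_ WP]]; [exists V; rewrite // finset.subD1set|exists W].
split.
- have := finset.partitionU1 (finset.partitionD1 (zip_partition h) VP) (B := V :\ x).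
  rewrite [(V :\ x) :|: _](_ : _ = [set z in catrev s (y :: t)]); last first.
    apply/finset.setP => z; rewrite !inE !catrevE !mem_cat !mem_rev !inE.
    have [->|zx] /= := eqVneq z x; first by rewrite xV/= xy (negPf xs) (negPf xt).
    case zV: (z \in V) => //=.
    by have := zip_mem h VP zV; rewrite !inE (negPf zx)/= => ->.
  apply; first by apply/finset.set0Pn; exists y.
  by rewrite finset.disjoints_subset; apply/fintype.subsetP => z; rewrite !inE => /andP[_ ->].
- move=> U W /finset.setU1P[->|/finset.setD1P[UV UP]] /finset.setU1P[->|/finset.setD1P[WV WP]] UW cr.
  + by rewrite eqxx in UW.
  + apply: (zip_nc h VP WP); first by rewrite eq_sym.
    by apply: crossing_sub cr; rewrite ?finset.subD1set.
  + apply: (zip_nc h UP VP) => //.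
    by apply: crossing_sub cr; rewrite ?finset.subD1set.
  + exact (zip_nc h UP WP UW cr).
- move=> W /finset.setU1P[->|/finset.setD1P[_ /(zip_gt1 h)//]].
  have [z zV zxy] : exists2 z, z \in V & z \notin [set x; y].
    apply/subsetPn; apply: contra BP => sVB.
    suff <- : V = [set x; y] by [].
    apply/eqP; rewrite finset.eqEsubset sVB; apply/fintype.subsetP => z.
    by rewrite !inE => /orP[] /eqP->.
  move: zxy; rewrite !inE => /norP[zx zy].
  by apply/card_gt1P; exists y, z; split=> //; rewrite ?inE ?zx// eq_sym.
- move=> W u v /sub[W' WP /fintype.subsetP WW] ut vt uW vW.
  by apply: (zip_sep h WP ut vt); exact: WW.
Qed.

Lemma zip_grow Q V : nc_zip s (y :: t) Q -> V \in Q -> y \in V ->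
  nc_zip (x :: s) (y :: t) ((x |: V) |: (Q :\ V)).
Proof.
move=> h VQ yV.
have xQ W : W \in Q -> x \in W = false.
  by move=> WQ; apply/negP => /(zip_mem h WQ); rewrite inE (negPf xs) (negPf xt) xy.
pose r z := if z == x then y else z.
have rV z : z \in x |: V -> r z \in V.
  by rewrite /r !inE; case: eqP => //= _.
(* x and y are adjacent, hence a crossing that uses x yields one that uses y. *)
have r_lt1 W a b : W \in Q :\ V -> a \in x |: V -> b \in W -> (a < b)%N -> (r a < b)%N.
  case/finset.setD1P => WV WQ aV bW ab; rewrite /r; case: eqP => // ax.
  rewrite ltnNge leq_eqVlt; apply/negP => /orP[/eqP/val_inj bY|bY].
    by move/eqP: WV; apply; apply: (zip_block h WQ VQ bW); rewrite bY.
  rewrite ax in ab; apply: (@no_between b) => //.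
  have := zip_mem h WQ bW; rewrite inE; case/or3P => [->//|/eqP bY'|->]; last by rewrite orbT.
  by rewrite bY' ltnn in bY.
have r_lt2 (a b : 'I_N) : (a < b)%N -> (a < r b)%N.
  by rewrite /r; case: eqP => // -> ax; exact: ltn_trans ax x_y.
split.
- have := finset.partitionU1 (finset.partitionD1 (zip_partition h) VQ) (B := x |: V).
  rewrite [(x |: V) :|: _](_ : _ = [set z in catrev (x :: s) (y :: t)]); last first.
    apply/finset.setP => z; rewrite !inE !catrevE !mem_cat !mem_rev !inE.
    have [->|zx] //= := eqVneq z x.
    case zV: (z \in V) => //=.
    by have := zip_mem h VQ zV; rewrite !inE => ->.
  apply; first by apply/finset.set0Pn; exists y; rewrite !inE yV orbT.
  rewrite finset.disjoints_subset; apply/fintype.subsetP => z; rewrite !inE catrevE mem_cat mem_rev inE.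
  by case/orP => [/eqP->|->//]; rewrite (negPf xs) (negPf xt) xy andbF.
- move=> U W /finset.setU1P[->|UQ] /finset.setU1P[->|WQ] UW.
  + by rewrite eqxx in UW.
  + move=> [i [j [k [l [[iV jW kV lW] [ij jk kl]]]]]].
    have /finset.setD1P[WV WQ'] := WQ.
    apply: (zip_nc h VQ WQ'); first by rewrite eq_sym.
    exists (r i), j, (r k), l; split; split=> //; try exact: rV.
      exact: r_lt1 WQ iV jW ij.
      exact: r_lt2.
      exact: r_lt1 WQ kV lW kl.
  + move=> [i [j [k [l [[iV jW kV lW] [ij jk kl]]]]]].
    have /finset.setD1P[UV UQ'] := UQ.
    apply: (zip_nc h UQ' VQ) => //.
    exists i, (r j), k, (r l); split; split=> //; try exact: rV.
      exact: r_lt2.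
      exact: r_lt1 UQ jW kV jk.
      exact: r_lt2.
  + move: UQ WQ => /finset.setD1P[_ UQ] /finset.setD1P[_ WQ]; exact (zip_nc h UQ WQ UW).
- move=> W /finset.setU1P[->|/finset.setD1P[_ /(zip_gt1 h)//]].
  by apply: leq_trans (zip_gt1 h VQ) _; apply/subset_leq_card/finset.subsetUr.
- move=> W u v /finset.setU1P[->|/finset.setD1P[_ WQ]]; last exact (zip_sep h WQ).
  have xyt z : z \in y :: t -> z \in x |: V -> z \in V.
    by rewrite !inE => zt /orP[/eqP zx|//]; move: zt; rewrite zx xy (negPf xt).
  by move=> ut vt uV vV; apply: (zip_sep h VQ ut vt); exact: xyt.
Qed.

End Pair.

Lemma big_bij (V : nmodType) (I J : finType) (p : pred I) (p' : pred J) (h : J -> I) (h' : I -> J)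
    (F : I -> V) :
  (forall i, p i -> p' (h' i) /\ h (h' i) = i) -> (forall j, p' j -> p (h j) /\ h' (h j) = j) ->
  \sum_(i | p i) F i = \sum_(j | p' j) F (h j).
Proof.
move=> hi hj; rewrite (reindex_onto h h'); last by move=> i /hi[].
apply: eq_bigl => j; apply/andP/idP => [[/hi[+ _] /eqP e]|/hj[-> ->]//]; by rewrite e.
Qed.

Variables (R : realType) (lambda : R).

Definition zip_sum s t : R := \sum_(P | `[< nc_zip s t P >]) lambda ^+ #|P|.

Lemma zip_sum0 t : zip_sum [::] t = (size t == 0%N)%:R.
Proof.
case: t => [|y t]; rewrite /zip_sum.
  rewrite (bigD1 finset.set0) ?cards0 ?expr0 ?big1/= ?addr0//.
    move=> P /andP[/asboolP h P0].
    have /finset.set0Pn[V VP] := P0; have /ltnW/card_gt0P[z zV] := zip_gt1 h VP.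
    by have := zip_mem h VP zV.
  apply/asboolP; split; do ?by move=> V; rewrite finset.in_set0.
  by rewrite (_ : [set z in _] = finset.set0) ?finset.partition_set0.
rewrite big1// => P /asboolP h.
have [VP yV] : finset.pblock P y \in P /\ y \in finset.pblock P y.
  by apply: zip_pblock h _; rewrite mem_head orbT.
have /card_gt1P[a [b [aV bV ab]]] := zip_gt1 h VP.
have := zip_sep h VP (zip_mem h VP aV) (zip_mem h VP bV) aV bV.
by move=> e; rewrite e eqxx in ab.
Qed.

Definition tied t x P := [exists V in P, (x \in V) && has (mem V) t].

(** An untied x closes its block; before its visit it is the future of a block that is still open,
    so it becomes the first point of t. *)
Lemma zip_untied s t x P : x \notin t ->
  nc_zip (x :: s) t P /\ ~~ tied t x P <-> nc_zip s (x :: t) P.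
Proof.
move=> xt; split=> [[h nt]|h].
  have tie V v : V \in P -> x \in V -> v \in t -> v \in V -> False.
    move=> VP xV vt vV; move/negP: nt; apply; apply/existsP; exists V.
    by rewrite VP xV /=; apply/hasP; exists v.
  split; [exact (zip_partition h)|exact (zip_nc h)|exact (zip_gt1 h)|].
  move=> V u v VP; rewrite !inE => /orP[/eqP->|ut] /orP[/eqP->|vt] // uV vV.
  - by case: (tie _ _ VP uV vt vV).
  - by case: (tie _ _ VP vV ut uV).
  - exact (zip_sep h VP ut vt uV vV).
split; last first.
  apply/existsP => -[V /and3P[VP xV /hasP[v vt vV]]].
  have xv : x = v by apply: (zip_sep h VP _ _ xV vV); rewrite inE ?eqxx ?vt ?orbT.
  by rewrite xv vt in xt.
split; [exact (zip_partition h)|exact (zip_nc h)|exact (zip_gt1 h)|].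
by move=> V u v VP ut vt; apply: (zip_sep h VP); rewrite inE ?ut ?vt orbT.
Qed.

(* The last point x of s either belongs to the block of no point of t, and then
   joins t, or by [zip_tied] it belongs to the block of the first point y of t,
   and then it is deleted, together with y if the block is {x, y}. *)
Lemma zip_sumS s t x : pairwise lt (catrev (x :: s) t) ->
  zip_sum (x :: s) t = zip_sum s (x :: t) +
    (if t is y :: t' then zip_sum s t + lambda * zip_sum s t' else 0).
Proof.
move=> srt; have xt : x \notin t.
  by apply/negP => /(zip_order (s := s) (t := t) srt).2; rewrite ltnn.
rewrite [LHS]/zip_sum (bigID (tied t x)) [RHS]addrC /=; congr (_ + _); last first.
  apply: eq_bigl => P; apply/andP/asboolP => [[/asboolP h1 h2]|/(zip_untied _ _ xt)[h1 h2]].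
    exact/(zip_untied _ _ xt).
  by split=> //; exact/asboolP.
case: t srt xt => [|y t] srt xt.
  by rewrite big1// => P /andP[_ /existsP[V /and3P[]]].
have xy : x != y by move: xt; rewrite inE => /norP[].
have tiedE V P : V \in P -> x \in V -> y \in V -> tied (y :: t) x P.
  by move=> VP xV yV; apply/existsP; exists V; rewrite VP xV /= yV.
rewrite (bigID (fun P => [set x; y] \in P)) [RHS]addrC /=; congr (_ + _); last first.
  (* The level step: the number of blocks, hence the weight, does not change. *)
  pose h Q := (x |: finset.pblock Q y) |: (Q :\ finset.pblock Q y).
  pose h' P := (finset.pblock P y :\ x) |: (P :\ finset.pblock P y).
  rewrite (big_bij (p' := fun Q => `[< nc_zip s (y :: t) Q >]) (h := h) (h' := h')).
  - apply: eq_bigr => Q /asboolP hQ; congr (_ ^+ _).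
    have [VQ yV] : finset.pblock Q y \in Q /\ y \in finset.pblock Q y.
      by apply: zip_pblock hQ _; rewrite mem_head orbT.
    rewrite /h cardsU1 [in RHS](cardsD1 (finset.pblock Q y)) VQ; congr (_ + _)%N.
    suff /negbTE-> : (x |: finset.pblock Q y) \notin Q :\ finset.pblock Q y by [].
    apply/negP => /finset.setD1P[/eqP VV xVQ]; apply: VV.
    by apply: (zip_block hQ xVQ VQ _ yV); rewrite !inE yV orbT.
  - move=> P /andP[/andP[/asboolP hP /existsP[V /and3P[VP xV /hasP[v vt vV]]]] BP].
    have yV : y \in V := zip_tied srt hP VP xV vt vV.
    have VE := finset.def_pblock (finset.partition_trivIset (zip_partition hP)) VP yV.
    have hz := zip_shrink srt hP VP xV yV BP.
    split; first by apply/asboolP; rewrite /h' VE.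
    have yVx : y \in V :\ x by rewrite !inE eq_sym xy.
    have VE' : finset.pblock (h' P) y = V :\ x.
      rewrite /h' VE.
      apply: (finset.def_pblock (finset.partition_trivIset (zip_partition hz))) yVx.
      exact: finset.setU11.
    rewrite /h VE' /h' VE (finset.setD1K xV) finset.setU1K ?finset.setD1K//.
    apply/negP => /finset.setD1P[/eqP VV VxP]; apply: VV.
    exact: (zip_block hP VxP VP yVx yV).
  - move=> Q /asboolP hQ.
    have [VQ yV] : finset.pblock Q y \in Q /\ y \in finset.pblock Q y.
      by apply: zip_pblock hQ _; rewrite mem_head orbT.
    set V := finset.pblock Q y in VQ yV.
    have hz := zip_grow srt hQ VQ yV; rewrite -/V -/(h Q) in hz.
    have xV : x \notin V.
      apply/negP => /(zip_mem hQ VQ); rewrite inE (negPf xy) /= => /orP[|xt'].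
        by move=> /(zip_order (s := s) (t := y :: t) srt).1; rewrite ltnn.
      by move: xt; rewrite inE xt' orbT.
    have xVh : x |: V \in h Q := finset.setU11 _ _.
    have yxV : y \in x |: V by rewrite !inE yV orbT.
    have VE := finset.def_pblock (finset.partition_trivIset (zip_partition hz)) xVh yxV.
    split.
      apply/andP; split; first apply/andP; first split; first exact/asboolP.
        by apply: tiedE xVh _ yxV; exact: finset.setU11.
      apply/negP => BP.
      have BV : [set x; y] = x |: V.
        by apply: (zip_block hz BP xVh _ yxV); rewrite !inE eqxx orbT.
      have := zip_gt1 hQ VQ; have -> : V = [set y]; last by rewrite cards1.
      by rewrite -(finset.setU1K xV) -BV finset.setU1K// inE.
    rewrite /h' VE finset.setU1K// /h -/V finset.setU1K ?finset.setD1K//.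
    apply/negP => /finset.setD1P[/eqP VV xVQ]; apply: VV.
    exact: (zip_block hQ xVQ VQ yxV yV).
(* The remaining case is a whole block {x, y}; removing it yields the factor lambda. *)
rewrite (big_bij (p' := fun Q => `[< nc_zip s t Q >]) (h := fun Q => [set x; y] |: Q)
  (h' := fun P => P :\ [set x; y])).
- rewrite /zip_sum mulr_sumr; apply: eq_bigr => Q /asboolP /(zip_pairU srt)[_ BQ].
  by rewrite cardsU1 BQ exprS.
- move=> P /andP[/andP[/asboolP hP _] BP]; rewrite finset.setD1K//.
  by split=> //; apply/asboolP; exact: zip_pairD.
- move=> Q /asboolP /(zip_pairU srt)[hz BQ]; rewrite finset.setU1K// finset.setU11 andbT.
  split=> //; apply/andP; split; first exact/asboolP.
  by apply: (tiedE [set x; y]); rewrite ?finset.setU11 ?inE ?eqxx ?orbT.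
Qed.

(** Read backwards over s, [zip_sum] charges lambda when the opening point of a block is removed,
    [motzkin] when the height rises. The power of lambda settles the difference for the blocks of t
    that are still open. *)
Lemma zip_sum_motzkin s t : pairwise lt (catrev s t) ->
  zip_sum s t = lambda ^+ size t * motzkin lambda (size s) (size t).
Proof.
elim: s t => [|x s IH] t srt.
  by rewrite zip_sum0 /=; case: t {srt} => [|y t]; rewrite ?expr0 ?mulr1 ?mulr0.
rewrite zip_sumS// IH//; case: t srt => [|y t] srt /=.
  by rewrite expr0 expr1 addr0 add0r mul1r.
rewrite !IH /=; first by rewrite !exprS; ring.
  apply: subseq_pairwise srt; rewrite /= !catrevE; apply: cat_subseq => //.
  exact: subseq_trans (subseq_cons t y) (subseq_cons _ x).
by apply: subseq_pairwise srt; rewrite /= !catrevE; apply: cat_subseq => //; exact: subseq_cons.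
Qed.

End NoncrossingZip.

Section NoncrossingSum.
Local Open Scope set_scope.

Lemma nc_zip_noncrossing n (P : {set {set 'I_n}}) :
  `[< nc_zip (rev (enum 'I_n)) [::] P >] = noncrossing P && [forall V in P, (1 < #|V|)%N].
Proof.
have D : [set z in catrev (rev (enum 'I_n)) [::]] = [set: 'I_n].
  by apply/finset.setP => z; rewrite !inE catrevE revK cats0 mem_enum.
apply/asboolP/andP => [h|[/andP[hP /forall_inP hnc] /forall_inP h1]].
  split; last by apply/forall_inP => V VP; exact (zip_gt1 h VP).
  rewrite /noncrossing -D (zip_partition h); apply/forall_inP => V VP.
  apply/forall_inP => W WP; apply/implyP => VW; apply/negP.
  move=> /exists_inP[i iV /exists_inP[j jW /exists_inP[k kV /exists_inP[l lW /and3P[ij jk kl]]]]].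
  by apply: (zip_nc h VP WP VW); exists i, j, k, l.
split=> //; first by rewrite D.
move=> V W VP WP VW [i [j [k [l [[iV jW kV lW] [ij jk kl]]]]]].
have /forall_inP/(_ W WP)/implyP/(_ VW)/negP := hnc V VP; apply.
apply/exists_inP; exists i => //; apply/exists_inP; exists j => //.
by apply/exists_inP; exists k => //; apply/exists_inP; exists l => //; rewrite ij jk.
Qed.

Lemma noncrossing_sum (R : realType) (lambda : R) n :
  \sum_(P : {set {set 'I_n}} | noncrossing P)
    \prod_(V in P) (if #|V| == 1%N then 0 else lambda) = motzkin lambda n 0.
Proof.
rewrite (bigID (fun P : {set {set 'I_n}} => [forall V in P, (1 < #|V|)%N])) /=.
rewrite [X in _ + X]big1 ?addr0; last first.
  move=> P /andP[ncP /forall_inPn[V VP V1]]; rewrite (bigD1 V)//=.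
  by rewrite eqn_leq (noncrossing_block_gt0 ncP VP) leqNgt V1 mul0r.
have srt : pairwise (fun i j : 'I_n => (i < j)%N) (catrev (rev (enum 'I_n)) [::]).
  rewrite catrevE revK cats0 -(pairwise_map val ltn) val_enum_ord.
  by rewrite -sorted_pairwise ?iota_ltn_sorted//; exact: ltn_trans.
have := zip_sum_motzkin lambda srt.
rewrite size_rev size_enum_ord expr0 mul1r => <-.
rewrite /zip_sum; apply: eq_big => [P|P /andP[_ /forall_inP h]]; first by rewrite nc_zip_noncrossing.
rewrite -prodr_const; apply: eq_bigr => V VP.
by rewrite gtn_eqF// h.
Qed.

End NoncrossingSum.

(** * Cumulants of the free Poisson law *)

Section FreePoissonMoments.
Context {R : realType}.
Variables (lambda : R) (alpha : nat -> R) (B : ncProbSpace R) (a : nat -> B).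
Implicit Types chi : seq nat.

Definition block_weight n : R := if n == 1%N then 0 else lambda.
Definition alpha_prod chi : R[i] := \prod_(i <- chi) (alpha i)%:C.

Definition poisson_cumulant chi :=
  free_cumulant [seq a i | i <- chi] = (block_weight (size chi))%:C * alpha_prod chi.

Definition poisson_moment chi :=
  nc_state B (\prod_(i <- chi) a i) = (motzkin lambda (size chi) 0)%:C * alpha_prod chi.

Lemma centered_free_poissonP : centered_free_poisson_seq lambda alpha a <->
  forall chi, chi != [::] -> poisson_cumulant chi.
Proof.
split=> [[h1 h2] [|i [|j chi]] // _|h].
- by rewrite /poisson_cumulant /= h1 /block_weight/= mul0r.
- exact: h2.
split=> [i|[|i [|j chi]] // _]; last exact: h.
by have := h [:: i] isT; rewrite /poisson_cumulant /= /block_weight/= mul0r.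
Qed.

Definition subword chi n (V : {set 'I_n}) := [seq nth 0%N chi i | i : 'I_n <- enum V].

Lemma size_subword chi n (V : {set 'I_n}) : size (subword chi V) = #|V|.
Proof. by rewrite size_map -cardE. Qed.

Lemma restrict_word_map chi (V : {set 'I_(size [seq a i | i <- chi])}) :
  restrict_word V = [seq a i | i <- subword chi V].
Proof.
rewrite /restrict_word /subword -map_comp; apply: eq_map => i /=.
rewrite (tnth_nth (a 0)) /= (nth_map 0%N)//.
by have := ltn_ord i; rewrite [X in (_ < X)%N]size_map.
Qed.

(** The blocks partition the letters, so every P carries the same product of the alphas and only the
    weights remain to be summed. *)
Lemma prod_cumulants chi (P : {set {set 'I_(size [seq a i | i <- chi])}}) : noncrossing P ->
  {in P, forall V, poisson_cumulant (subword chi V)} ->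
  \prod_(V in P) free_cumulant (restrict_word V) =
  (\prod_(V in P) block_weight #|V|)%:C * alpha_prod chi.
Proof.
move=> ncP hP.
have -> : alpha_prod chi = \prod_(V in P) \prod_(i in V) (alpha (nth 0%N chi i))%:C.
  have /andP[partP _] := ncP.
  rewrite -(finset.big_trivIset _ (finset.partition_trivIset partP)).
  rewrite (finset.cover_partition partP) /alpha_prod (big_nth 0%N) big_mkord.
  rewrite -(big_mkord xpredT (fun i => (alpha (nth 0%N chi i))%:C)).
  rewrite -{1}(size_map a chi) big_mkord.
  by apply: eq_bigl => i; rewrite finset.in_setT.
rewrite rmorph_prod -big_split; apply: eq_bigr => V VP.
rewrite restrict_word_map hP// /alpha_prod /subword size_map -cardE big_map.
by rewrite big_enum.
Qed.

Lemma sum_block_weight n (k : R[i]) :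
  \sum_(P : {set {set 'I_n}} | noncrossing P) (\prod_(V in P) block_weight #|V|)%:C * k =
  (motzkin lambda n 0)%:C * k.
Proof. by rewrite -mulr_suml -rmorph_sum noncrossing_sum. Qed.

Lemma moments_of_cumulants chi :
  (forall chi, chi != [::] -> poisson_cumulant chi) -> poisson_moment chi.
Proof.
move=> h; have [->|chi0] := eqVneq chi [::].
  by rewrite /poisson_moment /alpha_prod !big_nil nc_state1 mulr1.
have a0 : [seq a i | i <- chi] != [::] by rewrite -size_eq0 size_map size_eq0.
rewrite /poisson_moment -(big_map a xpredT id) (moment_cumulant a0).
rewrite -[in RHS](size_map a chi) -sum_block_weight; apply: eq_bigr => P ncP.
apply: prod_cumulants => // V VP; apply: h.
by rewrite -size_eq0 size_subword -lt0n (noncrossing_block_gt0 ncP VP).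
Qed.

(** Strong induction on the length: in the moment-cumulant formula all partitions with several
    blocks agree with the Poisson values, so the one-block terms agree too. *)
Lemma cumulants_of_moments chi :
  (forall chi, poisson_moment chi) -> chi != [::] -> poisson_cumulant chi.
Proof.
move=> h; have [n chin] := ubnP (size chi); elim: n chi chin => // n IH chi chin chi0.
have n0 : (0 < size [seq a i | i <- chi])%N by rewrite size_map lt0n size_eq0.
have a0 : [seq a i | i <- chi] != [::] by rewrite -size_eq0 -lt0n.
have := moment_cumulant a0; rewrite big_map h -[X in motzkin _ X _](size_map a chi).
rewrite -sum_block_weight (bigD1 [set [set: 'I_(size [seq a i | i <- chi])]]%SET)/=; last first.
  exact: noncrossing_one_block.
rewrite [RHS](bigD1 [set [set: 'I_(size [seq a i | i <- chi])]]%SET)/=; last first.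
  exact: noncrossing_one_block.
rewrite [X in _ + X](eq_bigr (fun P : {set {set 'I_(size [seq a i | i <- chi])}} =>
    \prod_(V in P) free_cumulant (restrict_word V))); last first.
  move=> P /andP[ncP P1]; apply/esym/prod_cumulants => // V VP.
  apply: IH; last by rewrite -size_eq0 size_subword -lt0n (noncrossing_block_gt0 ncP VP).
  rewrite size_subword (leq_trans (noncrossing_block_lt ncP P1 VP))//.
  by rewrite size_map -ltnS.
move/addIr; rewrite !big_set1 cardsT card_ord.
have -> : restrict_word [set: 'I_(size [seq a i | i <- chi])]%SET = [seq a i | i <- chi].
  by rewrite /restrict_word enum_setT -enumT map_tnth_enum.
by rewrite /poisson_cumulant => <-; rewrite size_map.
Qed.

End FreePoissonMoments.

(** * A noncommutative probability space with prescribed moments *)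

Section PolynomialModel.
Context {R : realType}.
Variable (m : nat -> R[i]).
Hypothesis m0 : m 0 = 1.

Definition moment_functional (p : {poly R[i]}) : R[i] := \sum_(i < size p) p`_i * m i.

Lemma moment_functionalE n (p : {poly R[i]}) : (size p <= n)%N ->
  moment_functional p = \sum_(i < n) p`_i * m i.
Proof.
move=> pn; rewrite /moment_functional -(big_mkord xpredT (fun i => p`_i * m i)).
rewrite -(big_mkord xpredT (fun i => p`_i * m i)) (big_cat_nat (leq0n _) pn)//=.
rewrite [X in _ + X]big_nat_cond [X in _ + X]big1 ?addr0// => i /andP[/andP[pi _] _].
by rewrite nth_default ?mul0r.
Qed.

Lemma moment_functional_linear : scalar moment_functional.
Proof.
move=> k p r; pose n := maxn (size p) (maxn (size r) (size (k *: p + r))).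
rewrite !(@moment_functionalE n) ?leq_max ?leqnn ?orbT// mulr_sumr -big_split/=.
by apply: eq_bigr => i _; rewrite coefD coefZ mulrDl mulrA.
Qed.

HB.instance Definition _ := GRing.isLinear.Build R[i] {poly R[i]} R[i] _
  moment_functional moment_functional_linear.

Lemma moment_functionalX n : moment_functional 'X^n = m n.
Proof.
rewrite /moment_functional size_polyXn big_ord_recr /= big1 ?add0r; last first.
  by move=> i _; rewrite coefXn ltn_eqF ?mul0r.
by rewrite coefXn eqxx mul1r.
Qed.

Lemma moment_functional1 : moment_functional 1 = 1.
Proof. by rewrite -(expr0 'X) moment_functionalX. Qed.

(** An [ncProbSpace] is an algebra with a unital linear functional, so polynomials realize every
    moment sequence that starts with 1. *)
Definition polynomial_space : ncProbSpace R :=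
  @NcProbSpace R {poly R[i]} moment_functional moment_functional1.

End PolynomialModel.

Lemma free_poisson_exists (R : realType) (lambda : R) (alpha : nat -> R) :
  exists (B : ncProbSpace R) (a : nat -> B), centered_free_poisson_seq lambda alpha a.
Proof.
have m0 : (motzkin lambda 0 0)%:C = 1 :> R[i] by [].
exists (@polynomial_space R (fun n => (motzkin lambda n 0)%:C) m0), (fun i => (alpha i)%:C *: 'X).
apply/centered_free_poissonP => chi; apply: cumulants_of_moments => {}chi.
rewrite /poisson_moment.
have -> : \prod_(i <- chi) ((alpha i)%:C *: ('X : {poly R[i]})) = alpha_prod alpha chi *: 'X^(size chi).
  rewrite /alpha_prod; elim: chi => [|i chi IH]; first by rewrite !big_nil scale1r expr0.
  by rewrite !big_cons IH -scalerAl -scalerAr scalerA exprS.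
by rewrite /= linearZ/= moment_functionalX mulrC.
Qed.

(** * Convergence to the free Poisson law *)

Section PoissonLimit.
Context {R : realType} {A : tracialWstarProbSpace R}.
Local Notation phi := (nc_state A).
Local Notation Re := (@complex.Re R).

Lemma cvgCZ k (u : nat -> R[i]) l : cvgC u l -> cvgC (fun n => k * u n) (k * l).
Proof.
move=> /cvgC_dist0 ul; apply: (@cvgC_squeeze _ _ _ (fun n => normc k * normc (u n - l))).
  by rewrite -[0](mulr0 (normc k)); apply: cvgM => //; exact: cvg_cst.
by apply: nearW => n; rewrite -mulrBr normc_mul.
Qed.

Variables (q : nat) (lambda : R) (alpha : nat -> R) (x : nat -> nat -> A).
Hypotheses (lambda_gt0 : 0 < lambda) (q_even : ~~ odd q).
Hypothesis alpha_neq0 : forall i, alpha i != 0.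
Hypothesis xc : forall n i, chaos_limit q (x n i).
Hypothesis xsa : forall n i, ws_adj (x n i) = x n i.
Hypothesis x2 : forall i j, cvgC (fun n => phi (x n i * x n j)) (alpha i * alpha j * lambda)%:C.
Hypothesis x3 : cvgC (fun n => phi (x n 0 ^+ 3)) (lambda * alpha 0 ^+ 3)%:C.
Hypothesis x4 : cvgC (fun n => phi (x n 0 ^+ 4)) ((2 * lambda ^+ 2 + lambda) * alpha 0 ^+ 4)%:C.

Let y n := (alpha 0)^-1%:C *: x n 0.

Let ysa n : ws_adj (y n) = y n.
Proof. by rewrite adjZ xsa; congr (_ *: _); exact: conjc_real. Qed.

Let y_cvg m (l : R) : cvgC (fun n => phi (x n 0 ^+ m)) (l * alpha 0 ^+ m)%:C ->
  cvgC (fun n => phi (y n ^+ m)) l%:C.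
Proof.
move=> /(cvgCZ (k := (alpha 0)^-1%:C ^+ m)).
have -> : (fun n => phi (y n ^+ m)) = (fun n => (alpha 0)^-1%:C ^+ m * phi (x n 0 ^+ m)).
  by apply/funext => n; rewrite exprZn stateZ.
have e : l = (alpha 0)^-1 ^+ m * (l * alpha 0 ^+ m).
  by rewrite mulrCA -exprMn mulVf// expr1n mulr1.
by have -> : l%:C = (alpha 0)^-1%:C ^+ m * (l * alpha 0 ^+ m)%:C by rewrite {1}e rmorphM rmorphXn.
Qed.

Let y2 : cvgC (fun n => phi (y n ^+ 2)) lambda%:C.
Proof.
by apply: y_cvg; under eq_fun do rewrite expr2; rewrite expr2 [X in X%:C]mulrC; exact: x2.
Qed.

Lemma sq_dist_cvg i : (fun n => n2 (x n i - (alpha i)%:C *: y n)) @ \oo --> 0.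
Proof.
pose c := alpha i / alpha 0.
have x2R j k : (fun n => Re (phi (x n j * x n k))) @ \oo --> alpha j * alpha k * lambda.
  by have /= := cvgC_Re (@x2 j k).
have E n : sq (x n i - (alpha i)%:C *: y n) =
    Re (phi (x n i * x n i)) + c ^+ 2 * Re (phi (x n 0 * x n 0)) - 2 * c * Re (phi (x n 0 * x n i)).
  have -> : - ((alpha i)%:C *: y n) = (- c)%:C *: x n 0.
    have -> : (- c)%:C = - ((alpha i)%:C * (alpha 0)^-1%:C) by rewrite rmorphN rmorphM.
    by rewrite scaleNr -scalerA.
  have adjE : ws_adj ((- c)%:C *: x n 0) = (- c)%:C *: x n 0.
    by rewrite adjZ xsa; congr (_ *: _); exact: conjc_real.
  rewrite sqD adjE sqZ sqmodC.
  rewrite -(scalerAl (- c)%:C (x n 0) (x n i)) stateZ ReM /= mul0r subr0 sqrrN.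
  rewrite /sq !xsa; ring.
rewrite /n2 -(@sqrtr0 R); apply: continuous_cvg; first exact: sqrt_continuous.
under eq_fun do rewrite E.
have -> : 0 = alpha i * alpha i * lambda + c ^+ 2 * (alpha 0 * alpha 0 * lambda) -
    2 * c * (alpha 0 * alpha i * lambda) by rewrite /c; field.
apply: cvgB; first by apply: cvgD => //; apply: cvgM => //; exact: cvg_cst.
by apply: cvgM => //; exact: cvg_cst.
Qed.

Lemma chaos_poisson_limit chi :
  cvgC (fun n => phi (\prod_(i <- chi) x n i))
    ((motzkin lambda (size chi) 0)%:C * alpha_prod alpha chi).
Proof.
have yc n : chaos_limit q (y n) by exact: chaos_limitZ.
have y3 := y_cvg x3; have y4 := y_cvg x4.
have prodE n : \prod_(i <- chi) ((alpha i)%:C *: y n) = alpha_prod alpha chi *: y n ^+ size chi.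
  rewrite /alpha_prod; elim: chi => [|i chi' IH]; first by rewrite !big_nil scale1r expr0.
  by rewrite !big_cons IH -scalerAl -scalerAr scalerA exprS.
have := cvgCZ (k := alpha_prod alpha chi) 
  (chaos_limit_moments (m := size chi) lambda_gt0 q_even yc ysa y2 y3 y4).
rewrite [X in cvgC _ X]mulrC; under eq_fun do rewrite -stateZ -prodE.
move=> h; apply: cvgC_sub0 h _; apply: n2_cvg0_phi.
apply: (@prod_dist_cvg R A nat chi x (fun n i => (alpha i)%:C *: y n)) => // i; last first.
  exact: sq_dist_cvg.
have xb := n2_bounded_of_cvg (xsa^~ i) (@x2 i i).
have yb := n2_bounded_of_cvg ysa y2.
pose Cx := q.+1%:R * (alpha i * alpha i * lambda + 3).
pose Cy := normc (alpha i)%:C * (q.+1%:R * (lambda + 3)).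
exists (Num.max Cx Cy); near=> n.
have h1 : n2 (x n i) <= alpha i * alpha i * lambda + 2 by near: n.
have h2 : n2 (y n) <= lambda + 2 by near: n.
split.
  apply: opbd_le (chaos_limit_opbd (@xc n i)) _; rewrite le_max; apply/orP; left.
  by rewrite ler_wpM2l//; lra.
apply: opbd_le (opbdZ _ (chaos_limit_opbd (yc n))) _; rewrite le_max; apply/orP; right.
by rewrite ler_wpM2l ?normc_ge0// ler_wpM2l//; lra.
Unshelve. all: by end_near. Qed.

End PoissonLimit.

Theorem theorem4p2 (R : realType) (A : tracialWstarProbSpace R)
  (F : R -> set A) (S : R -> A) (hS : free_brownian_motion F S)
  (lambda : R) (lambda_gt0 : 0 < lambda)
  (alpha : nat -> R) (alpha_neq0 : forall i, alpha i != 0)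
  (q : nat) (q_even : ~~ odd q)
  (I : (q.-tuple (measurableTypeR R) -> R[i]) -> A)
  (hI : free_stochastic_integral S I)
  (f : nat -> nat -> q.-tuple (measurableTypeR R) -> R[i])
  (f_L2 : forall n i, square_integrable (f n i))
  (f_sym : forall n i, mirror_symmetric (f n i)) :
  (exists (B : ncProbSpace R) (a : nat -> B),
     centered_free_poisson_seq lambda alpha a /\
     converges_in_distribution (fun n i => I (f n i)) a)
  <->
  (forall i j : nat,
     [/\ cvgC (fun n => L2dot (f n i) (f n j))
              (alpha i * alpha j * lambda)%:C,
         cvgC (fun n => nc_state A (I (f n i) ^+ 2 * I (f n j) ^+ 2))
              ((2 * lambda ^+ 2 + lambda) * alpha i ^+ 2 * alpha j ^+ 2)%:C &
         cvgC (fun n => nc_state A (I (f n i) * I (f n j) ^+ 2))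
              (lambda * alpha i * alpha j ^+ 2)%:C]).
Proof.
have f_meas n i : measurableC (f n i) by have [] := (square_integrableE _).1 (f_L2 n i).
have f_approx n i := is_free_integral_approx (hI _ (f_L2 n i)).
have Isa n i := approx_selfadjoint hS (f_meas n i) (f_sym n i) (f_approx n i).
have dotE n i j : L2dot (f n i) (f n j) = nc_state A (I (f n i) * I (f n j)).
  by rewrite (L2dot_phi hS (f_meas n i) (f_meas n j) (f_approx n i) (f_approx n j)) Isa ws_stateC.
split=> [[B [a [aP Ia]]] i j|h].
  have mom chi := moments_of_cumulants chi ((centered_free_poissonP lambda alpha a).1 aP).
  have Ilim chi : chi != [::] -> cvgC (fun n => nc_state A (\prod_(i <- chi) I (f n i)))
      ((motzkin lambda (size chi) 0)%:C * alpha_prod alpha chi).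
    by move=> chi0; rewrite -mom; exact: Ia.
  split.
  (* In the three cases [ring] evaluates [motzkin lambda] at lengths 2, 4 and 3 to lambda, 2
     lambda^2 + lambda and lambda. *)
  - have := Ilim [:: i; j] isT; under eq_fun do rewrite !big_cons big_nil mulr1 -dotE.
    rewrite /alpha_prod !big_cons big_nil mulr1 -!rmorphM/=.
    by congr (cvgC _ _); congr (_%:C); ring.
  - have := Ilim [:: i; i; j; j] isT.
    under eq_fun do rewrite !big_cons big_nil mulr1 mulrA -!expr2.
    rewrite /alpha_prod !big_cons big_nil mulr1 -!rmorphM/=.
    by congr (cvgC _ _); congr (_%:C); ring.
  - have := Ilim [:: i; j; j] isT.
    under eq_fun do rewrite !big_cons big_nil mulr1 -!expr2.
    rewrite /alpha_prod !big_cons big_nil mulr1 -!rmorphM/=.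
    by congr (cvgC _ _); congr (_%:C); ring.
have [B [a aP]] := free_poisson_exists lambda alpha.
exists B, a; split=> // chi _.
rewrite (moments_of_cumulants chi ((centered_free_poissonP lambda alpha a).1 aP)).
apply: (@chaos_poisson_limit _ _ q) => //.
- by move=> n i; exact: (approx_chaos_limit hS (f_approx n i) (Isa n i)).
- by move=> i j; have [+ _ _] := h i j; under eq_fun do rewrite dotE.
- have [_ _] := h 0%N 0%N; under eq_fun do rewrite -exprS.
  by rewrite -mulrA -exprS.
- have [_ + _] := h 0%N 0%N; under eq_fun do rewrite -exprD.
  by rewrite -mulrA -exprD.
Qed.
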